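(* There exists a cellular automaton $\mathcal{A}$ with alphabet $Q$ such that, for every fully supported Bernoulli measure $\mu$ on $Q^{\mathbb{Z}}$, the persistent set $L_{\mu}(\mathcal{A})\subseteq Q^*$ is $\Sigma_3^0$-complete.
   Context: A cellular automaton (CA) $\mathcal{A}$ is given by a finite alphabet $Q$, a radius $r\in\mathbb{N}$ and a local rule $\delta:Q^{2r+1}\to Q$; its global map on $Q^{\mathbb{Z}}$ is $\mathcal{A}(c)_z=\delta(c_{z-r},\dots,c_{z+r})$. For a finite word $u$ and $i\in\mathbb{Z}$, the cylinder $[u]_i$ is the set of configurations $c$ with $c_{[i,i+|u|-1]}=u$. For a Borel probability measure $\mu$ on $Q^{\mathbb{Z}}$ write $\mathcal{A}^t\mu([u]_0)=\mu(\mathcal{A}^{-t}([u]_0))$. The persistent set is $L_\mu(\mathcal{A})=\{u\in Q^*:\ \mathcal{A}^t\mu([u]_0)\not\to 0 \text{ as } t\to\infty\}$. A Bernoulli measure is one with $\mu([u]_i)=\prod_{q\in Q}\mu([q]_0)^{|u|_q}$ for all words $u$ and $i\in\mathbb{Z}$ ($|u|_q$ = number of occurrences of $q$ in $u$); it is fully supported if all coefficients $\mu([q]_0)$ are positive. $\Sigma_3^0$ refers to the arithmetical hierarchy; complete means in $\Sigma_3^0$ and $\Sigma_3^0$-hard under many-one reductions. *)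

(* Defs.v *)
From HB Require Import structures.
From mathcomp Require Import all_boot all_algebra.
From mathcomp Require Import all_classical all_reals all_analysis.

Set Implicit Arguments.
Unset Strict Implicit.
Unset Printing Implicit Defensive.
Import GRing.Theory Num.Theory.
Local Open Scope classical_set_scope.

Inductive code : Type :=
| CZero
| CSucc
| CProj of nat
| CComp of code & seq code
| CRec of code & code
| CMu of code.

Inductive eval : code -> seq nat -> nat -> Prop :=
| ev_zero v : eval CZero v 0
| ev_succ x v : eval CSucc (x :: v) x.+1
| ev_proj i v : (i < size v)%N -> eval (CProj i) v (nth 0%N v i)
| ev_comp f gs v ys y : evals gs v ys -> eval f ys y -> eval (CComp f gs) v y
| ev_rec0 f g v y : eval f v y -> eval (CRec f g) (0%N :: v) y
| ev_recS f g n v z y : eval (CRec f g) (n :: v) z -> eval g (n :: z :: v) y ->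
    eval (CRec f g) (n.+1 :: v) y
| ev_mu f v n : eval f (n :: v) 0 ->
    (forall m, (m < n)%N -> exists k, eval f (m :: v) k.+1) -> eval (CMu f) v n
with evals : seq code -> seq nat -> seq nat -> Prop :=
| evs_nil v : evals [::] v [::]
| evs_cons g gs v y ys : eval g v y -> evals gs v ys -> evals (g :: gs) v (y :: ys).

Definition computable1 (f : nat -> nat) : Prop :=
  exists c : code, forall x, eval c [:: x] (f x).

Definition decidable4 (R : nat -> nat -> nat -> nat -> bool) : Prop :=
  exists c : code, forall x a b d, eval c [:: x; a; b; d] (nat_of_bool (R x a b d)).

Definition Sigma3 (S : nat -> Prop) : Prop :=
  exists R : nat -> nat -> nat -> nat -> bool, decidable4 R /\
    forall x, S x <-> exists a, forall b, exists d, R x a b d.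

Definition Sigma3_hard (S : nat -> Prop) : Prop :=
  forall S' : nat -> Prop, Sigma3 S' ->
    exists f, computable1 f /\ forall x, S' x <-> S (f x).

Definition Sigma3_complete (S : nat -> Prop) : Prop := Sigma3 S /\ Sigma3_hard S.

(* Cellular automata on the alphabet 'I_n.+1 (any finite nonempty     *)
(* alphabet, up to renaming).                                         *)

Definition Conf (n : nat) := int -> 'I_n.+1.
HB.instance Definition _ n := Choice.on (Conf n).
HB.instance Definition _ n := isPointed.Build (Conf n) (fun _ => ord0).

Definition global (n r : nat) (delta : (r.*2.+1).-tuple 'I_n.+1 -> 'I_n.+1)
  (c : Conf n) : Conf n :=
  fun z => delta [tuple c (z + (i%:Z - r%:Z))%R | i < r.*2.+1].

Definition cyl (n : nat) (u : seq 'I_n.+1) (i : int) : set (Conf n) :=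
  [set c | [seq c (i + k%:Z)%R | k <- iota 0 (size u)] = u].

Definition cylinders (n : nat) : set (set (Conf n)) :=
  [set A | exists u i, A = cyl u i].

Definition ConfM (n : nat) := g_sigma_algebraType (@cylinders n).

Definition fully_supported_bernoulli (n : nat) (R : realType)
  (mu : probability (ConfM n) R) : Prop :=
  (forall q : 'I_n.+1, (0 < mu (cyl [:: q] 0))%E) /\
  (forall (u : seq 'I_n.+1) (i : int),
     mu (cyl u i) = (\prod_(q : 'I_n.+1) (fine (mu (cyl [:: q] 0))) ^+ count_mem q u)%:E).

Definition persistent (n r : nat) (delta : (r.*2.+1).-tuple 'I_n.+1 -> 'I_n.+1)
  (R : realType) (mu : probability (ConfM n) R) (u : seq 'I_n.+1) : Prop :=
  ~ ((fun t : nat => mu (iter t (global delta) @^-1` cyl u 0)) @ \oo --> 0%E).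

(* The persistent set, as a set of natural numbers via the canonical
   (computable) encoding [pickle] of words. *)
Definition persistent_codes (n r : nat) (delta : (r.*2.+1).-tuple 'I_n.+1 -> 'I_n.+1)
  (R : realType) (mu : probability (ConfM n) R) : nat -> Prop :=
  fun m => exists u : seq 'I_n.+1, pickle u = m /\ persistent delta mu u.

(* Main.v *)
(** The colors and marks of the cells never change, and a maximal block of cells of one
    color (a segment) evolves independently of the others, except that its leftmost cell
    may send bits to the left; they travel at unit speed through the dead cells.

    A segment in which [Start] comes first among the modes other than [Wait] is erased and
    then runs a counter machine with a sweeping head, the registers being pebbles: their
    initial values [x < a] are the positions of its first two marks, and a timer pebble,
    initially in cell [a], moves by one cell at each machine step.  A segment of length [k]
    therefore performs exactly [k - 1 - a] steps; if the machine is then in a special state,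
    the segment emits a 1 every [2x + 2] steps, and otherwise it emits only 0s.  A base 4
    odometer kills any segment of length [k] by time [3k + 3 * 4 ^ k], while one that was
    properly started survives until time [4 ^ (k - 1)].  The segments that contain a [Start]
    or a [Dead] cell but are not properly started die within [2k] steps, and the long segments
    without such cells, or without two marks near their left end, are exponentially rarer
    than the long segments of the most frequent color.

    Consequently a block of dead cells displays at time [t], with probability tending to 1,
    the emissions of a properly started segment to its right, of length tending to infinity
    with [t]; moreover, at time [4 ^ (k - 1)] the length [k] and the marks [x] and [a] have
    a probability bounded below.  Hence a word persists if and only if all its letters are
    dead and, for some [x < a] and infinitely many [k], its bits are those emitted by a
    segment of length [k] with marks [x] and [a].  Choosing a machine that, started on
    [(x, a)], visits the special state infinitely often exactly when
    [forall b, exists d, R x a b d] makes this condition complete, the number [x] being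
    written as the word [1 0^(2x+1) 1]. *)
Require Import Defs.
From HB Require Import structures.
From mathcomp Require Import all_boot all_order all_algebra.
From mathcomp Require Import all_classical all_reals all_analysis.
From mathcomp Require Import zify ring lra.
Import Defs.

Set Implicit Arguments.
Unset Strict Implicit.
Unset Printing Implicit Defensive.

(** * Computable functions *)

(** The base 4 balances two rates. A segment still alive at time t has length at least about log_4
    t, and the nearest properly started one of length k is expected at a distance of order P^(-k),
    where P is the density of the more frequent color. Since P >= 1/2, this is at most of order 2^k,
    small against 4^k: whatever the measure, the bits have time to travel. The three quantifiers
    arise as follows. Not tending to 0 means being large at infinitely many times, hence for
    infinitely many lengths k; the mark [x] carries the input and the mark [a] the outer existential
    witness. Both are read near the left end, so their cost in probability does not grow with k. As
    a segment only reports one machine state, the remaining forall-exists condition has to be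
    rewritten as infinitely many visits. In the upper bound, every unwanted event must be rarer than
    P^k by an arbitrary constant factor, since about P^(-k) positions are searched. The one
    exception is a segment that dies while its bits are being read, which would splice two emissions
    into one word: it dies only once, so the sum over positions costs a bounded factor. *)

Definition cpt (k : nat) (f : seq nat -> nat) : Prop :=
  exists c, forall v, size v = k -> eval c v (f v).

Fixpoint cpts (k : nat) (gs : seq (seq nat -> nat)) : Prop :=
  if gs is g :: gs' then cpt k g /\ cpts k gs' else True.

Lemma cpt_ext k f g : (forall v, size v = k -> f v = g v) -> cpt k f -> cpt k g.
Proof. by move=> fg [c cP]; exists c => v sv; rewrite -fg //; apply: cP. Qed.

Lemma cpt_p0 k i : i < k -> cpt k (fun v => nth 0 v i).
Proof. by move=> ik; exists (CProj i) => v sv; apply: ev_proj; rewrite sv. Qed.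

(** Every bounded search or iteration conses its index onto the arguments, so an outer variable sits
    under one [behead] per bound variable; these forms let [cpt_tac] find it. *)
Lemma cpt_p1 k i : i.+1 < k -> cpt k (fun v => nth 0 (behead v) i).
Proof. by move=> ik; apply: cpt_ext (cpt_p0 ik) => v _; rewrite nth_behead. Qed.

Lemma cpt_p2 k i : i.+2 < k -> cpt k (fun v => nth 0 (behead (behead v)) i).
Proof. by move=> ik; apply: cpt_ext (cpt_p0 ik) => v _; rewrite !nth_behead. Qed.

Lemma cpt_p3 k i : i.+3 < k -> cpt k (fun v => nth 0 (behead (behead (behead v))) i).
Proof. by move=> ik; apply: cpt_ext (cpt_p0 ik) => v _; rewrite !nth_behead. Qed.

Lemma cpt_comp k f gs : cpt (size gs) f -> cpts k gs ->
  cpt k (fun v => f [seq g v | g <- gs]).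
Proof.
move=> [cf cfP] gsP.
have [cs csP] : exists cs, forall v, size v = k -> evals cs v [seq g v | g <- gs].
  elim: gs gsP {cfP} => [|g gs IH] /=; first by exists [::] => v _; apply: evs_nil.
  case=> -[cg cgP] /IH [cs csP]; exists (cg :: cs) => v sv.
  by apply: evs_cons; [apply: cgP | apply: csP].
exists (CComp cf cs) => v sv; apply: ev_comp (csP v sv) _.
by apply: cfP; rewrite size_map.
Qed.

Lemma cpt_const k n : cpt k (fun=> n).
Proof.
elim: n => [|n [c cP]]; first by exists CZero => v _; apply: ev_zero.
exists (CComp CSucc [:: c]) => v sv.
apply: (@ev_comp _ _ _ [:: n]); last exact: ev_succ.
by apply: evs_cons; [apply: cP | apply: evs_nil].
Qed.

Lemma cpt_succ k f : cpt k f -> cpt k (fun v => (f v).+1).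
Proof.
move=> [c cP]; exists (CComp CSucc [:: c]) => v sv.
apply: (@ev_comp _ _ _ [:: f v]); last exact: ev_succ.
by apply: evs_cons; [apply: cP | apply: evs_nil].
Qed.

Lemma cpt_idcs k d : cpts (k + d) [seq (fun v => nth 0 v i) | i <- iota d k].
Proof.
elim: k d => [|k IH] d //=; split; first by apply: cpt_p0; rewrite addSn ltnS leq_addl.
by rewrite addSnnS; apply: IH.
Qed.

Lemma map_nth_shift (v : seq nat) d k : size v = k + d ->
  [seq g v | g <- [seq (fun v => nth 0 v i) | i <- iota d k]] = drop d v.
Proof.
move=> sv; rewrite -map_comp; apply: (@eq_from_nth _ 0).
  by rewrite size_map size_iota size_drop sv addnK.
move=> i; rewrite size_map size_iota => ik.
by rewrite (nth_map 0) ?size_iota // nth_iota // nth_drop.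
Qed.

Lemma cpt_let k f g : cpt k f -> cpt k.+1 g -> cpt k (fun v => g (f v :: v)).
Proof.
move=> cf cg.
have := @cpt_comp k g (f :: [seq (fun v => nth 0 v i) | i <- iota 0 k]).
rewrite /= size_map size_iota => /(_ cg) H.
apply: cpt_ext (H _); last by split => //; rewrite -[k in cpts k]addn0; apply: cpt_idcs.
by move=> v sv; rewrite map_nth_shift ?drop0 // addn0.
Qed.

Lemma cpt_drop k f d : cpt k f -> cpt (k + d) (fun v => f (drop d v)).
Proof.
move=> cf.
have := @cpt_comp (k + d) f [seq (fun v => nth 0 v i) | i <- iota d k].
rewrite size_map size_iota => /(_ cf (cpt_idcs _ _)); apply: cpt_ext => v sv.
by rewrite map_nth_shift.
Qed.

Lemma cpt_natrec k n b (F : nat -> nat -> seq nat -> nat) :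
  cpt k n -> cpt k b ->
  cpt k.+2 (fun w => F (nth 0 w 0) (nth 0 (behead w) 0) (behead (behead w))) ->
  cpt k (fun v => nat_rec (fun=> nat) (b v) (fun i z => F i z v) (n v)).
Proof.
move=> cn [cb cbP] [cs csP].
suff : cpt k.+1 (fun w => nat_rec (fun=> nat) (b (behead w))
                   (fun i z => F i z (behead w)) (head 0 w)).
  by move=> /(cpt_let cn) H.
exists (CRec cb cs) => -[|x v] //= [sv].
elim: x => [|x IH] /=; first by apply: ev_rec0; apply: cbP.
by apply: ev_recS IH _; apply: csP; rewrite /= sv.
Qed.

Lemma cpt_iter k n b (F : nat -> seq nat -> nat) :
  cpt k n -> cpt k b -> cpt k.+1 (fun w => F (nth 0 w 0) (behead w)) ->
  cpt k (fun v => iter (n v) (fun z => F z v) (b v)).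
Proof.
move=> cn cb cF.
apply: (@cpt_ext _ (fun v => nat_rec (fun=> nat) (b v) (fun i z => F z v) (n v))).
  by move=> v _; elim: (n v) => //= m ->.
apply: cpt_natrec => //.
have := cpt_drop 1 cF; rewrite addn1.
by apply: cpt_ext => v _; rewrite drop1.
Qed.

Definition cpt1 (f : nat -> nat) := cpt 1 (fun v => f (nth 0 v 0)).
Definition cpt2 (f : nat -> nat -> nat) := cpt 2 (fun v => f (nth 0 v 0) (nth 0 v 1)).

Lemma cpt_lift1 f k g : cpt1 f -> cpt k g -> cpt k (fun v => f (g v)).
Proof. by move=> cf cg; apply: (@cpt_comp k _ [:: g] cf). Qed.

Lemma cpt_lift2 f k g h : cpt2 f -> cpt k g -> cpt k h -> cpt k (fun v => f (g v) (h v)).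
Proof. by move=> cf cg ch; apply: (@cpt_comp k _ [:: g; h] cf). Qed.

Lemma cpt_add k f g : cpt k f -> cpt k g -> cpt k (fun v => f v + g v).
Proof.
move=> cf cg; apply: (@cpt_ext _ (fun v => iter (g v) succn (f v))).
  by move=> v _; rewrite iter_succn.
by apply: cpt_iter => //; apply: cpt_succ; apply: cpt_p0.
Qed.

Lemma cpt_mul k f g : cpt k f -> cpt k g -> cpt k (fun v => f v * g v).
Proof.
suff H : cpt2 muln by apply: cpt_lift2.
apply: (@cpt_ext _ (fun v => iter (nth 0 v 1) (fun z => nth 0 v 0 + z) 0)).
  by move=> v _; rewrite iter_addn addn0.
apply: (@cpt_iter _ _ _ (fun z v => nth 0 v 0 + z)); try exact: cpt_p0; first exact: cpt_const.
by apply: cpt_add; [apply: cpt_p1 | apply: cpt_p0].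
Qed.

Lemma cpt_pred k f : cpt k f -> cpt k (fun v => (f v).-1).
Proof.
suff H : cpt1 predn by apply: cpt_lift1.
apply: (@cpt_ext _ (fun v => nat_rec (fun=> nat) 0 (fun i z => i) (nth 0 v 0))).
  by move=> v _; case: (nth 0 v 0).
apply: (@cpt_natrec _ _ _ (fun i z v => i)); try exact: cpt_p0; exact: cpt_const.
Qed.

Lemma cpt_sub k f g : cpt k f -> cpt k g -> cpt k (fun v => f v - g v).
Proof.
move=> cf cg; apply: (@cpt_ext _ (fun v => iter (g v) predn (f v))).
  by move=> v _; rewrite iter_predn.
by apply: cpt_iter => //; apply: cpt_pred; apply: cpt_p0.
Qed.

Lemma cpt_exp k f g : cpt k f -> cpt k g -> cpt k (fun v => f v ^ g v).
Proof.
suff H : cpt2 expn by apply: cpt_lift2.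
apply: (@cpt_ext _ (fun v => iter (nth 0 v 1) (fun z => nth 0 v 0 * z) 1)).
  by move=> v _; rewrite iter_muln muln1.
apply: (@cpt_iter _ _ _ (fun z v => nth 0 v 0 * z)); try exact: cpt_p0; first exact: cpt_const.
by apply: cpt_mul; [apply: cpt_p1 | apply: cpt_p0].
Qed.

Definition cptb k (P : seq nat -> bool) := cpt k (fun v => P v : nat).

Lemma cptb_neg k P : cptb k P -> cptb k (fun v => ~~ P v).
Proof.
move=> cP; apply: (@cpt_ext _ (fun v => 1 - P v)); first by move=> v _; case: (P v).
by apply: cpt_sub => //; apply: cpt_const.
Qed.

Lemma cptb_and k P Q : cptb k P -> cptb k Q -> cptb k (fun v => P v && Q v).
Proof.
move=> cP cQ; apply: (@cpt_ext _ (fun v => P v * Q v)); last exact: cpt_mul.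
by move=> v _; case: (P v); case: (Q v).
Qed.

Lemma cptb_ext k P Q : (forall v, size v = k -> P v = Q v) -> cptb k P -> cptb k Q.
Proof. by move=> PQ; apply: cpt_ext => v sv; rewrite PQ. Qed.

Lemma cptb_or k P Q : cptb k P -> cptb k Q -> cptb k (fun v => P v || Q v).
Proof.
move=> cP cQ; apply: (@cptb_ext _ (fun v => ~~ (~~ P v && ~~ Q v))).
  by move=> v _; rewrite negb_and !negbK.
by apply: cptb_neg; apply: cptb_and; apply: cptb_neg.
Qed.

Lemma cptb_le k f g : cpt k f -> cpt k g -> cptb k (fun v => f v <= g v).
Proof.
move=> cf cg; apply: (@cpt_ext _ (fun v => 1 - (f v - g v))).
  by move=> v _; rewrite /leq; case: (f v - g v).
by apply: cpt_sub; [apply: cpt_const | apply: cpt_sub].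
Qed.

Lemma cptb_eq k f g : cpt k f -> cpt k g -> cptb k (fun v => f v == g v).
Proof.
move=> cf cg; apply: (@cptb_ext _ (fun v => (f v <= g v) && (g v <= f v))).
  by move=> v _; rewrite eqn_leq.
by apply: cptb_and; apply: cptb_le.
Qed.

Lemma cptb_eqb k P Q : cptb k P -> cptb k Q -> cptb k (fun v => P v == Q v).
Proof.
move=> cP cQ; apply: (@cptb_ext _ (fun v => (P v : nat) == (Q v : nat))).
  by move=> v _; case: (P v); case: (Q v).
exact: cptb_eq.
Qed.

Lemma cpt_if k P f g : cptb k P -> cpt k f -> cpt k g ->
  cpt k (fun v => if P v then f v else g v).
Proof.
move=> cP cf cg; apply: (@cpt_ext _ (fun v => P v * f v + (1 - P v) * g v)).
  by move=> v _; case: (P v); rewrite ?mul1n ?mul0n ?addn0.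
apply: cpt_add; apply: cpt_mul => //; apply: cpt_sub => //; exact: cpt_const.
Qed.

Lemma cpt_count k n (P : nat -> seq nat -> bool) :
  cpt k n -> cptb k.+1 (fun w => P (nth 0 w 0) (behead w)) ->
  cpt k (fun v => count (fun i => P i v) (iota 0 (n v))).
Proof.
move=> cn cP.
apply: (@cpt_ext _ (fun v => nat_rec (fun=> nat) 0 (fun i z => P i v + z) (n v))).
  move=> v _; elim: (n v) => // m IH.
  by rewrite -[in RHS]addn1 iotaD count_cat -IH /= add0n addn0 addnC.
apply: (@cpt_natrec _ _ _ (fun i z v => P i v + z)) => //; first exact: cpt_const.
apply: cpt_add; last exact: cpt_p1.
have [c cP'] := cP.
(* Primitive recursion puts the accumulator between the index and the parameters; composing with
   projections drops it. *)
have := @cpt_comp k.+2 _ ((fun v => nth 0 v 0) ::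
  [seq (fun v => nth 0 v i) | i <- iota 2 k]).
rewrite /= size_map size_iota => /(_ _ cP) H.
apply: cpt_ext (H _) => [v sv|].
  by rewrite map_nth_shift ?sv ?addn2 //; case: v sv => [|x [|y v]] //= _; rewrite drop0.
by split; [exact: cpt_p0 | rewrite -addn2; exact: cpt_idcs].
Qed.

Lemma cptb_has k n (P : nat -> seq nat -> bool) :
  cpt k n -> cptb k.+1 (fun w => P (nth 0 w 0) (behead w)) ->
  cptb k (fun v => has (fun i => P i v) (iota 0 (n v))).
Proof.
move=> cn cP.
apply: (@cptb_ext _ (fun v => 0 < count (fun i => P i v) (iota 0 (n v)))).
  by move=> v _; rewrite has_count.
by apply: cptb_le; [apply: cpt_const | apply: cpt_count].
Qed.

Lemma cptb_all k n (P : nat -> seq nat -> bool) :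
  cpt k n -> cptb k.+1 (fun w => P (nth 0 w 0) (behead w)) ->
  cptb k (fun v => all (fun i => P i v) (iota 0 (n v))).
Proof.
move=> cn cP.
apply: (@cptb_ext _ (fun v => ~~ has (fun i => ~~ P i v) (iota 0 (n v)))).
  by move=> v _; rewrite has_predC negbK.
apply: cptb_neg; apply: (@cptb_has k n (fun i v => ~~ P i v)); first exact: cn.
exact: (@cptb_neg _ (fun w => P (nth 0 w 0) (behead w))).
Qed.

Lemma count_ltn_iota n m : n <= m -> count (fun i => i < n) (iota 0 m) = n.
Proof.
move=> le; suff -> : count (fun i => i < n) (iota 0 m) = minn n m by apply/minn_idPl.
elim: m {le} => [|m IH]; first by rewrite minn0.
by rewrite -addn1 iotaD count_cat IH /= add0n addn0; lia.
Qed.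

Lemma cpt_div k f g : cpt k f -> cpt k g -> cpt k (fun v => f v %/ g v).
Proof.
suff H : cpt2 divn by apply: cpt_lift2.
(* The quotient counts the positive multiples of the divisor up to the dividend; a zero divisor, for
   which [divn] returns 0, is treated apart. *)
apply: (@cpt_ext _ (fun v => if nth 0 v 1 == 0 then 0 else
   count (fun i => i.+1 * nth 0 v 1 <= nth 0 v 0) (iota 0 (nth 0 v 0)))).
  move=> v _; case: (eqVneq (nth 0 v 1) 0) => [->|]; first by rewrite divn0.
  move: (nth 0 v 0) (nth 0 v 1) => m d; rewrite -lt0n => d0.
  rewrite (eq_count (a2 := (fun i => i < m %/ d))); last first.
    by move=> i; rewrite leq_divRL.
  by rewrite count_ltn_iota // leq_div.
apply: cpt_if; [by apply: cptb_eq; [apply: cpt_p0|apply: cpt_const]|exact: cpt_const|].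
apply: (@cpt_count _ _ (fun i v => i.+1 * nth 0 v 1 <= nth 0 v 0)); first exact: cpt_p0.
apply: cptb_le; last exact: cpt_p1.
by apply: cpt_mul; [apply: cpt_succ; apply: cpt_p0 | apply: cpt_p1].
Qed.

Lemma cpt_mod k f g : cpt k f -> cpt k g -> cpt k (fun v => f v %% g v).
Proof.
move=> cf cg; apply: (@cpt_ext _ (fun v => f v - f v %/ g v * g v)).
  by move=> v _; rewrite {1}(divn_eq (f v) (g v)) addKn.
by apply: cpt_sub => //; apply: cpt_mul => //; apply: cpt_div.
Qed.

Lemma cptb_dvd k f g : cpt k f -> cpt k g -> cptb k (fun v => f v %| g v).
Proof. by move=> cf cg; apply: cptb_eq; [apply: cpt_mod | apply: cpt_const]. Qed.

Ltac cpt_step := first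
  [ assumption | done
  | apply: cpt_p0; done | apply: cpt_p1; done | apply: cpt_p2; done | apply: cpt_p3; done
  | apply: cpt_const | apply: cptb_le | apply: cptb_eq | apply: cptb_eqb | apply: cptb_dvd
  | apply: cptb_and | apply: cptb_or | apply: cptb_neg
  | apply: cpt_succ | apply: cpt_add | apply: cpt_mul | apply: cpt_sub | apply: cpt_exp
  | apply: cpt_div | apply: cpt_mod | apply: cpt_pred ].
Ltac cpt_tac := repeat cpt_step.

(** * Lists of numbers as numbers *)

(** These functions invert [CodeSeq.code], the coding behind [pickle] on sequences: the code of
    [n :: s] is 2^n times an odd number, so the head is the 2-adic valuation. *)
Definition hdn (N : nat) := count (fun i => 2 ^ i.+1 %| N) (iota 0 N).
Definition tln (N : nat) := N %/ 2 ^ (hdn N).+1.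
Definition consn (n m : nat) := 2 ^ n * (2 * m + 1).
Definition getn (N i : nat) := hdn (iter i tln N).
Definition sizen (N : nat) := count (fun i => 0 < iter i tln N) (iota 0 N).

Lemma cpt_hdn k f : cpt k f -> cpt k (fun v => hdn (f v)).
Proof.
suff H : cpt1 hdn by apply: cpt_lift1.
apply: (@cpt_count _ _ (fun i v => 2 ^ i.+1 %| nth 0 v 0)); cpt_tac.
Qed.

Lemma cpt_tln k f : cpt k f -> cpt k (fun v => tln (f v)).
Proof. by move=> cf; apply: cpt_div => //; cpt_tac; apply: cpt_hdn. Qed.

Lemma cpt_consn k f g : cpt k f -> cpt k g -> cpt k (fun v => consn (f v) (g v)).
Proof. by move=> cf cg; rewrite /consn; cpt_tac. Qed.

Lemma cpt_getn k f g : cpt k f -> cpt k g -> cpt k (fun v => getn (f v) (g v)).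
Proof.
move=> cf cg; apply: cpt_hdn; apply: (@cpt_iter _ _ _ (fun z v => tln z)) => //.
by apply: cpt_tln; cpt_tac.
Qed.

Lemma cpt_sizen k f : cpt k f -> cpt k (fun v => sizen (f v)).
Proof.
suff H : cpt1 sizen by apply: cpt_lift1.
apply: (@cpt_count _ _ (fun i v => 0 < iter i tln (nth 0 v 0))); first by cpt_tac.
apply: cptb_le; first exact: cpt_const.
apply: (@cpt_iter _ _ _ (fun z v => tln z)); [by cpt_tac | by cpt_tac |].
by apply: cpt_tln; cpt_tac.
Qed.

Lemma hdn_consn n m : hdn (consn n m) = n.
Proof.
rewrite /hdn /consn (eq_count (a2 := (fun i => i < n))); last first.
  move=> i; case: (ltnP i n) => [le|le].
    by apply: dvdn_mulr; apply: dvdn_exp2l.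
  rewrite -(subnKC (leqW le)) expnD dvdn_pmul2l ?expn_gt0 //.
  rewrite subSn // expnS; apply/negbTE/negP => /(dvdn_trans (dvdn_mulr _ (dvdnn 2))).
  by rewrite dvdn2 oddD oddM.
apply: count_ltn_iota.
by rewrite (leq_trans (ltnW (ltn_expl n (ltnSn 1)))) // leq_pmulr // addn1.
Qed.

Lemma tln_consn n m : tln (consn n m) = m.
Proof.
rewrite /tln hdn_consn /consn expnSr divnMl ?expn_gt0 // divnD // mulKn //.
by rewrite (_ : 1 %/ 2 = 0) // modnMr addn0 addn0.
Qed.

Lemma tln0 : tln 0 = 0. Proof. by rewrite /tln div0n. Qed.

Lemma getn0 i : getn 0 i = 0.
Proof. by rewrite /getn (_ : iter i tln 0 = 0) //; elim: i => //= i ->; rewrite tln0. Qed.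

Lemma getn_consn n m i : getn (consn n m) i = if i is j.+1 then getn m j else n.
Proof. by case: i => [|i]; rewrite /getn ?hdn_consn // iterSr tln_consn. Qed.

Lemma consn_code n s : CodeSeq.code (n :: s) = consn n (CodeSeq.code s).
Proof. by rewrite /= /consn mul2n addn1. Qed.

Lemma getn_code s i : getn (CodeSeq.code s) i = nth 0 s i.
Proof.
elim: s i => [|n s IH] i; first by rewrite getn0 nth_nil.
by rewrite consn_code getn_consn; case: i.
Qed.

Lemma consn_gt m n : m < consn n m.
Proof. by rewrite /consn; have := expn_gt0 2 n; nia. Qed.

Lemma sizen_code s : sizen (CodeSeq.code s) = size s.
Proof.
rewrite /sizen (eq_count (a2 := (fun i => i < size s))); last first.
  move=> i; elim: s i => [|n s IH] i.
    by rewrite (_ : iter i tln _ = 0) //; elim: i => //= i ->; rewrite tln0.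
  rewrite consn_code; case: i => [|i]; first by rewrite /= (leq_trans _ (consn_gt _ _)).
  by rewrite iterSr tln_consn IH.
apply: count_ltn_iota.
by elim: s => // n s IH; rewrite consn_code (leq_trans _ (consn_gt _ _)).
Qed.

(** The recursion conses the entries r - 1 down to 0 back onto the new entry and the tail beyond
    [r]. *)
Definition updn (N r x : nat) :=
  nat_rec (fun=> nat) (consn x (iter r.+1 tln N))
    (fun i z => consn (getn N (r - i.+1)) z) r.

Lemma getn_updn N r x j : getn (updn N r x) j = if j == r then x else getn N j.
Proof.
pose F i z := consn (getn N (r - i.+1)) z.
suff H i : i <= r -> forall j, getn (nat_rec (fun=> nat) (consn x (iter r.+1 tln N)) F i) j
    = if j == i then x else getn N (r - i + j).
  by rewrite [updn N r x](_ : _ = nat_rec (fun=> nat) (consn x (iter r.+1 tln N)) F r) // H // subnn.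
elim: i => [|i IH] ir {}j.
  rewrite /= getn_consn; case: j => //= j.
  rewrite -[tln (iter r tln N)]/(iter r.+1 tln N) /getn -iterD.
  by congr (hdn (iter _ _ _)); lia.
rewrite /= {1}/F getn_consn; case: j => [|j]; first by rewrite addn0.
by rewrite IH ?(ltnW ir) // eqSS; case: eqP => // _; congr getn; lia.
Qed.

Lemma cpt_updn k f g h : cpt k f -> cpt k g -> cpt k h ->
  cpt k (fun v => updn (f v) (g v) (h v)).
Proof.
suff H : cpt 3 (fun v => updn (nth 0 v 0) (nth 0 v 1) (nth 0 v 2)).
  by move=> cf cg ch; apply: (@cpt_comp k _ [:: f; g; h] H).
apply: (@cpt_natrec _ _ _ (fun i z v => consn (getn (nth 0 v 0) (nth 0 v 1 - i.+1)) z)).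
- by cpt_tac.
- apply: cpt_consn; first by cpt_tac.
  apply: (@cpt_iter _ _ _ (fun z v => tln z)); [by cpt_tac | by cpt_tac |].
  by apply: cpt_tln; cpt_tac.
- by apply: cpt_consn; [apply: cpt_getn|]; cpt_tac.
Qed.
(** * Counter machines *)

Definition store := nat -> nat.
Definition upd (s : store) (r x : nat) : store := fun r' => if r' == r then x else s r'.

(** Structured programs serve as an intermediate language: compositions are verified here, and jumps
    appear only in [flat]. *)
Inductive cmd : Type :=
| Nop | Inc of nat | Dec of nat | Then of cmd & cmd | While of nat & cmd.

Inductive exec : cmd -> store -> store -> Prop :=
| ex_nop s : exec Nop s s
| ex_inc r s : exec (Inc r) s (upd s r (s r).+1)
| ex_dec r s : exec (Dec r) s (upd s r (s r).-1)
| ex_then c1 c2 s1 s2 s3 : exec c1 s1 s2 -> exec c2 s2 s3 -> exec (Then c1 c2) s1 s3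
| ex_while0 r c s : s r = 0 -> exec (While r c) s s
| ex_whileS r c s1 s2 s3 : s1 r <> 0 -> exec c s1 s2 -> exec (While r c) s2 s3 ->
    exec (While r c) s1 s3.

Ltac store_tac := apply: funext => ?; rewrite /upd;
  repeat (case: eqP => ?; subst => //=); try lia; try congruence.

Definition clear r := While r (Dec r).
Definition move a b := While a (Then (Dec a) (Inc b)).
Definition copy a b t := Then (While a (Then (Dec a) (Then (Inc b) (Inc t)))) (move t a).

Lemma exec_eq c s s1 s2 : exec c s s1 -> s1 = s2 -> exec c s s2.
Proof. by move=> H <-. Qed.

Lemma exec_clear r s : exec (clear r) s (upd s r 0).
Proof.
move: {2}(s r) (erefl (s r)) => n; elim: n s => [|n IH] s sr.
  by apply: exec_eq (ex_while0 _ sr) _; store_tac.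
apply: (ex_whileS _ (ex_dec _ _)); first by rewrite sr.
apply: exec_eq (IH _ _) _; first by rewrite /upd eqxx sr.
by store_tac.
Qed.

Lemma exec_move a b s : a <> b -> exec (move a b) s (upd (upd s a 0) b (s b + s a)).
Proof.
move=> ab; move: {2}(s a) (erefl (s a)) => n; elim: n s => [|n IH] s sr.
  by apply: exec_eq (ex_while0 _ sr) _; store_tac.
apply: (ex_whileS _ (ex_then (ex_dec _ _) (ex_inc _ _))); first by rewrite sr.
apply: exec_eq (IH _ _) _; first by rewrite /upd eqxx sr; case: eqP.
by store_tac.
Qed.

Lemma exec_copy a b t s : a <> b -> a <> t -> b <> t -> s t = 0 ->
  exec (copy a b t) s (upd s b (s b + s a)).
Proof.
move=> ab at_ bt st.
suff H : exec (While a (Then (Dec a) (Then (Inc b) (Inc t)))) s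
    (upd (upd (upd s a 0) b (s b + s a)) t (s t + s a)).
  apply: ex_then H _; apply: exec_eq (exec_move _ _) _; first exact/nesym.
  by store_tac.
move: {2}(s a) (erefl (s a)) {st} => n; elim: n s => [|n IH] s sr.
  by apply: exec_eq (ex_while0 _ sr) _; store_tac.
apply: (ex_whileS _ (ex_then (ex_dec _ _) (ex_then (ex_inc _ _) (ex_inc _ _)))).
  by rewrite sr.
apply: exec_eq (IH _ _) _; first by rewrite /upd eqxx sr; do 2 case: eqP.
by store_tac.
Qed.

Fixpoint clears fr m := if m is m'.+1 then Then (clear fr) (clears fr.+1 m') else Nop.

Lemma exec_clears fr m s :
  exec (clears fr m) s (fun r => if fr <= r < fr + m then 0 else s r).
Proof.
elim: m fr s => [|m IH] fr s.
  by apply: exec_eq (ex_nop _) _; apply: funext => r; case: ifP => //; lia.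
apply: ex_then (exec_clear _ _) _; apply: exec_eq (IH _ _) _.
apply: funext => r; rewrite /upd; case: eqP => [->|]; do 2 case: ifP => //; lia.
Qed.

(** Calling convention: arguments are in the registers [ins], [out] is 0, and all registers from
    [fr] on are 0. They are scratch space and must be 0 again at the end, the arguments being
    preserved. *)
Fixpoint compile (c : code) (ins : seq nat) (out fr : nat) {struct c} : cmd :=
  match c with
  | CZero => Nop
  | CSucc => Then (copy (nth 0 ins 0) out fr) (Inc out)
  | CProj i => copy (nth 0 ins i) out fr
  | CComp f gs =>
      let m := size gs in
      Then ((fix comps gs j := if gs is g :: gs' then
               Then (compile g ins j (fr + m)) (comps gs' j.+1) else Nop) gs fr)
        (Then (compile f (iota fr m) out (fr + m)) (clears fr m))
  | CRec f g =>
      let w := behead ins in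
      Then (compile f w fr.+1 fr.+4)
     (Then (copy (nth 0 ins 0) fr.+2 fr.+4)
     (Then (While fr.+2
       (Then (Dec fr.+2)
       (Then (compile g (fr :: fr.+1 :: w) fr.+3 fr.+4)
       (Then (clear fr.+1)
       (Then (move fr.+3 fr.+1) (Inc fr))))))
     (Then (clear fr) (move fr.+1 out))))
  | CMu f =>
      Then (compile f (out :: ins) fr fr.+1)
        (While fr (Then (clear fr)
          (Then (Inc out) (compile f (out :: ins) fr fr.+1))))
  end.

(** Names the anonymous loop inside [compile], to which it is convertible, so that it can be treated
    by induction on [gs]. *)
Definition compiles fr0 ins := fix comps gs j := if gs is g :: gs' then
  Then (compile g ins j fr0) (comps gs' j.+1) else Nop.

Lemma map_upd (s : store) ins r x : r \notin ins -> map (upd s r x) ins = map s ins.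
Proof.
move=> rn; apply/eq_in_map => i ii; rewrite /upd; case: eqP => // e.
by rewrite -e ii in rn.
Qed.

Lemma notin_ge (ins : seq nat) fr r : all (fun i => i < fr) ins -> fr <= r -> r \notin ins.
Proof. by move=> /allP ins_lt frr; apply/negP => /ins_lt; rewrite ltnNge frr. Qed.

Lemma all_lt_le (ins : seq nat) a b : a <= b -> all (fun i => i < a) ins ->
  all (fun i => i < b) ins.
Proof. by move=> ab; apply: sub_all => i /leq_trans; apply. Qed.

Definition compiled c v y := forall ins out fr s,
  map s ins = v -> all (fun i => i < fr) ins -> out < fr ->
  out \notin ins -> s out = 0 -> (forall r, fr <= r -> s r = 0) ->
  exec (compile c ins out fr) s (upd s out y).

(** From [fr] on, the registers hold the current index, the accumulator, the number of iterations
    left and the output of [g]. *)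
Definition recloop g w fr :=
  While fr.+2
    (Then (Dec fr.+2)
    (Then (compile g (fr :: fr.+1 :: w) fr.+3 fr.+4)
    (Then (clear fr.+1)
    (Then (move fr.+3 fr.+1) (Inc fr))))).

Definition recst s fr n y k : store := upd (upd (upd s fr n) fr.+1 y) fr.+2 k.


Lemma eval_rec0_inv f g w y : eval (CRec f g) (0 :: w) y -> eval f w y.
Proof. by move=> H; inversion H. Qed.

Lemma eval_recS_inv f g n w y : eval (CRec f g) (n.+1 :: w) y ->
  exists2 z, eval (CRec f g) (n :: w) z & eval g (n :: z :: w) y.
Proof. by move=> H; inversion H; subst; exists z. Qed.

Lemma eval_mu_inv f v n : eval (CMu f) v n -> eval f (n :: v) 0 /\
  forall m, m < n -> exists k, eval f (m :: v) k.+1.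
Proof. by move=> H; inversion H. Qed.

Lemma eval_comp_inv f gs v y : eval (CComp f gs) v y ->
  exists2 ys, evals gs v ys & eval f ys y.
Proof. by move=> H; inversion H; subst; exists ys. Qed.

Lemma evals_cons_inv g gs v ys : evals (g :: gs) v ys ->
  exists y ys', [/\ ys = y :: ys', eval g v y & evals gs v ys'].
Proof. by move=> H; inversion H; subst; exists y, ys0. Qed.

Section Compile_rec.
Variables (f g : code).
Hypothesis IHf : forall v y, eval f v y -> compiled f v y.
Hypothesis IHg : forall v y, eval g v y -> compiled g v y.

(** An evaluation unfolds from [n] downwards while the loop counts upwards from 0. Hence the
    continuation form: a run of the loop from index [n] is extended backwards to a run from index
    0. *)
Lemma exec_recloop n w y : eval (CRec f g) (n :: w) y ->
  exists2 y0, eval f w y0 & forall ins fr s k sf,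
    map s ins = w -> all (fun i => i < fr) ins -> (forall r, fr <= r -> s r = 0) ->
    exec (recloop g ins fr) (recst s fr n y k) sf ->
    exec (recloop g ins fr) (recst s fr 0 y0 (n + k)) sf.
Proof.
elim: n y => [|n IH] y; first by move/eval_rec0_inv=> H; exists y.
case/eval_recS_inv=> z Hz Hg; have [y0 ey0 Hl] := IH _ Hz; exists y0 => // ins fr s k sf e insfr sfr Hsf.
rewrite addSnnS; apply: Hl => //.
have z3 : s fr.+3 = 0 by apply: sfr; lia.
apply: ex_whileS Hsf; first by rewrite /recst /upd eqxx.
apply: ex_then (ex_dec _ _) _.
have -> : upd (recst s fr n z k.+1) fr.+2 (recst s fr n z k.+1 fr.+2).-1 = recst s fr n z k.
  by rewrite /recst; store_tac.
apply: ex_then (IHg Hg _ _ _ _ _ _) _.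
+ rewrite /= /recst !map_upd ?e; try by apply: notin_ge insfr _; lia.
  by congr [:: _, _ & _]; rewrite /upd; do ?case: eqP => //; lia.
+ rewrite /=; apply/and3P; split; try lia.
  by apply: all_lt_le insfr; lia.
+ by [].
+ rewrite !inE !negb_or; apply/and3P; split; try lia.
  by apply: notin_ge insfr _; lia.
+ by rewrite /recst /upd; do ?case: eqP => //; lia.
+ move=> r rr; rewrite /recst /upd; do ?case: eqP => //; try lia.
  by move=> *; apply: sfr; lia.
apply: ex_then (exec_clear _ _) _.
apply: ex_then (exec_move _ _) _; first by lia.
by apply: exec_eq (ex_inc _ _) _; rewrite /recst; store_tac.
Qed.

Lemma compiled_rec v y : eval (CRec f g) v y -> compiled (CRec f g) v y.
Proof.
case: v => [|n w] H; first by inversion H.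
have [y0 /IHf Hf Hloop] := exec_recloop H.
move=> [|i ins] //= out fr s [si e] /andP[ifr insfr] ofr.
rewrite inE negb_or => /andP[/eqP oi oin] so sfr.
have z0 : s fr = 0 by apply: sfr.
have z1 : s fr.+1 = 0 by apply: sfr; lia.
have z2 : s fr.+2 = 0 by apply: sfr; lia.
have z4 : s fr.+4 = 0 by apply: sfr; lia.
apply: ex_then (Hf ins fr.+1 fr.+4 s e _ _ _ _ _) _.
+ by apply: all_lt_le insfr; lia.
+ by lia.
+ by apply: notin_ge insfr _.
+ by [].
+ by move=> r rr; apply: sfr; lia.
apply: ex_then (exec_copy _ _ _ _) _; try lia.
  by rewrite /upd; case: eqP => E; [lia|].
apply: (@ex_then _ _ _ (recst s fr n y 0)).
  have -> : upd (upd s fr.+1 y0) fr.+2 (upd s fr.+1 y0 fr.+2 + upd s fr.+1 y0 i)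
     = recst s fr 0 y0 (n + 0) by rewrite /recst; store_tac.
  by apply: Hloop => //; apply: ex_while0; rewrite /recst /upd eqxx.
apply: ex_then (exec_clear _ _) _; apply: exec_eq (exec_move _ _) _; first by lia.
by rewrite /recst; store_tac.
Qed.

Lemma compiled_mu v n : eval (CMu f) v n -> compiled (CMu f) v n.
Proof.
case/eval_mu_inv=> Hn Hlt ins out fr s e insfr ofr oin so sfr.
have Hf m k s' : eval f (m :: v) k -> s' = upd s out m ->
    exec (compile f (out :: ins) fr fr.+1) s' (upd s' fr k).
  move=> /IHf Hc ->; apply: Hc.
  + by rewrite /= map_upd // e /upd eqxx.
  + by rewrite /= ltnS (ltnW ofr); apply: all_lt_le insfr.
  + by [].
  + rewrite inE negb_or; apply/andP; split; first by lia.
    exact: notin_ge insfr _.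
  + by rewrite /upd; case: eqP => [E|_]; [lia|apply: sfr].
  + by move=> r rr; rewrite /upd; case: eqP => [E|_]; [lia|apply: sfr; lia].
have z0 : s fr = 0 by apply: sfr.
(* A state with candidate [m] and last test value [k]; the induction is on the distance [j] to the
   minimum, and the test vanishes exactly when [j] does. *)
suff W j m k : m + j = n -> eval f (m :: v) k -> (j = 0 -> k = 0) -> (j <> 0 -> k <> 0) ->
    exec (While fr (Then (clear fr) (Then (Inc out) (compile f (out :: ins) fr fr.+1))))
      (upd (upd s out m) fr k) (upd s out n).
  have [k [ek k0 kn]] : exists k, [/\ eval f (0 :: v) k, n = 0 -> k = 0 & n <> 0 -> k <> 0].
    case: (posnP n) => [n0|n0]; first by exists 0; split=> //; rewrite -{1}n0.
    by have [k ek] := Hlt _ n0; exists k.+1; split=> // n0'; rewrite n0' in n0.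
  have s0 : s = upd s out 0 by store_tac.
  by apply: ex_then (Hf 0 k s ek s0) _; rewrite {1}s0; apply: W k0 kn.
elim: j m k => [|j IH] m k mj ek k0 kn.
  rewrite addn0 in mj; apply: exec_eq (ex_while0 _ _) _.
    by rewrite {1}/upd eqxx k0.
  by rewrite mj k0 //; store_tac.
have [k' [ek' k0' kn']] : exists k, [/\ eval f (m.+1 :: v) k, j = 0 -> k = 0 & j <> 0 -> k <> 0].
  case: (posnP j) => [j0|j0]; first by exists 0; split=> //; rewrite (_ : m.+1 = n) //; lia.
  by have [|k'' ek'] := Hlt m.+1; [lia|exists k''.+1; split=> // E; rewrite E in j0].
apply: ex_whileS (IH m.+1 k' _ ek' k0' kn'); last by rewrite addSnnS.
  by rewrite /upd eqxx; apply: kn.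
apply: ex_then (exec_clear _ _) _; apply: ex_then (ex_inc _ _) _.
by apply: exec_eq (Hf m.+1 k' _ ek' _) _; store_tac.
Qed.

End Compile_rec.

Lemma compiled_comp f gs v y :
  (forall v y, eval f v y -> compiled f v y) ->
  foldr (fun g P => (forall v y, eval g v y -> compiled g v y) /\ P) True gs ->
  eval (CComp f gs) v y -> compiled (CComp f gs) v y.
Proof.
move=> IHf IHs /eval_comp_inv[ys Hys Hy] ins out fr s e insfr ofr oin so sfr.
have Hs gs' ys' j s' fr' : foldr (fun g P => (forall v y, eval g v y -> compiled g v y) /\ P) True gs' ->
    evals gs' v ys' -> map s' ins = v -> all (fun i => i < j) ins ->
    j + size gs' <= fr' -> (forall r, j <= r -> s' r = 0) ->
    size gs' = size ys' /\ exec (compiles fr' ins gs' j) s'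
    (fun r => if j <= r < j + size ys' then nth 0 ys' (r - j) else s' r).
  elim: gs' ys' j s' => [|g gs' IH] ys' j s' /= Hg Hev e' insj jfr s'j.
    inversion Hev; subst; split=> //; apply: exec_eq (ex_nop _) _; apply: funext => r.
    by case: ifP => //=; lia.
  have [y0 [ys0 [-> Hy0 Hys0]]] := evals_cons_inv Hev; have [Hg1 Hg2] := Hg.
  have [||||sz ex] := IH _ j.+1 (upd s' j y0) Hg2 Hys0.
  + by rewrite map_upd //; apply: notin_ge insj _.
  + by apply: all_lt_le insj.
  + by lia.
  + by move=> r rj; rewrite /upd; case: eqP => [E|_]; [lia|apply: s'j; lia].
  split; first by rewrite /= sz.
  apply: (@ex_then _ _ _ (upd s' j y0)).
    apply: Hg1 => //; first by rewrite e'.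
    + by apply: all_lt_le insj; move: jfr => /=; lia.
    + by move: jfr => /=; lia.
    + exact: notin_ge insj _.
    + exact: s'j.
    + by move=> r rr; apply: s'j; lia.
  apply: exec_eq ex _; apply: funext => r /=; rewrite /upd.
  case: eqP => [->|E].
    by rewrite ltnn /= subnn leqnn /=; case: ifP => //; lia.
  case: ifP => H1.
    rewrite (_ : _ && _ = true); last by lia.
    by rewrite (_ : r - j = (r - j.+1).+1) //; lia.
  by rewrite (_ : _ && _ = false) //; lia.
have [sz ex] := Hs gs ys fr s (fr + size gs) IHs Hys e insfr (leqnn _) sfr.
apply: ex_then ex _.
set s1 := fun r => _.
have s1e r : s1 r = if fr <= r < fr + size gs then nth 0 ys (r - fr) else s r.
  by rewrite /s1 sz.
apply: (@ex_then _ _ _ (upd s1 out y)).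
  apply: IHf Hy _ _ _ _ _ _ _ _ _ _.
  + apply: (@eq_from_nth _ 0); first by rewrite size_map size_iota.
    move=> i; rewrite size_map size_iota => im.
    rewrite (nth_map 0) ?size_iota // nth_iota // s1e leq_addr ltn_add2l im /=.
    by rewrite addKn.
  + by apply/allP => i; rewrite mem_iota => /andP[].
  + by rewrite (leq_trans ofr) // leq_addr.
  + by rewrite mem_iota negb_and -ltnNge ofr.
  + by rewrite s1e leqNgt ofr.
  + move=> r rfr; rewrite s1e ltnNge rfr andbF sfr //.
    by rewrite (leq_trans _ rfr) // leq_addr.
apply: exec_eq (exec_clears _ _ _) _; apply: funext => r; rewrite /upd s1e.
case: (eqVneq r out) => E; case: (boolP (fr <= r < fr + size gs)) => H1 //; try lia; try by rewrite sfr; lia.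
Qed.

Lemma compiled_basic v y :
  [/\ eval CZero v y -> compiled CZero v y, eval CSucc v y -> compiled CSucc v y
    & forall i, eval (CProj i) v y -> compiled (CProj i) v y].
Proof.
split=> [H|H|i H]; inversion H; subst.
- by move=> ins out fr s _ _ _ _ so _; apply: exec_eq (ex_nop _) _; store_tac.
- move=> -[|i ins] //= out fr s [<- _] /andP[ifr _] ofr.
  rewrite inE negb_or => /andP[/eqP oi _] so sfr.
  have z0 : s fr = 0 by apply: sfr.
  apply: ex_then (exec_copy _ _ _ _) _; try lia.
  by apply: exec_eq (ex_inc _ _) _; store_tac.
- move=> ins out fr s e insfr ofr oin so sfr.
  have ii : i < size ins by rewrite -(size_map s) e.
  have nin : nth 0 ins i \in ins by apply: mem_nth.
  have nfr := allP insfr _ nin.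
  apply: exec_eq (exec_copy _ _ _ _) _.
  + by move=> E; rewrite -E nin in oin.
  + by move=> E; rewrite E ltnn in nfr.
  + by move=> E; rewrite E ltnn in ofr.
  + exact: sfr.
  + by rewrite so add0n -e (nth_map 0).
Qed.

(** Written by hand because [code] is nested in [seq]: the inner [all] builds the hypotheses on the
    list [gs], which [compiled_comp] expects as a [foldr] of conjunctions. *)
Fixpoint eval_compile c {struct c} : forall v y, eval c v y -> compiled c v y :=
  match c with
  | CZero => fun v y => let: And3 H _ _ := @compiled_basic v y in H
  | CSucc => fun v y => let: And3 _ H _ := @compiled_basic v y in H
  | CProj i => fun v y => let: And3 _ _ H := @compiled_basic v y in H i
  | CComp f gs => fun v y => @compiled_comp f gs v y (@eval_compile f)
      ((fix all gs : foldr (fun g P => (forall v y, eval g v y -> compiled g v y) /\ P) True gs :=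
         match gs with [::] => I | g :: gs' => conj (@eval_compile g) (all gs') end) gs)
  | CRec f g => @compiled_rec f g (@eval_compile f) (@eval_compile g)
  | CMu f => @compiled_mu f (@eval_compile f)
  end.

(** * Flat programs with jumps *)

Definition instr : Type := nat * nat * nat * nat.

(* [(op, r, q1, q0)]: branch to [q0] or [q1] according to whether register [r] is
   zero, after incrementing ([op = 1]) or decrementing ([op > 1]) it. *)
Definition cmstep (P : seq instr) (st : nat * store) : nat * store :=
  let: (op, r, q1, q0) := nth (0, 0, 0, 0) P st.1 in
  (if st.2 r == 0 then q0 else q1,
   if op == 0 then st.2 else upd st.2 r (if op == 1 then (st.2 r).+1 else (st.2 r).-1)).

Fixpoint flen c := match c with
  | Nop => 0 | Inc _ => 1 | Dec _ => 1
  | Then c1 c2 => flen c1 + flen c2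
  | While r c => (flen c).+2 end.

(** [o] is the address of the first instruction; an instruction with two equal targets and operation
    0 is a plain jump, and closes the loop of [While]. *)
Fixpoint flat c o : seq instr := match c with
  | Nop => [::]
  | Inc r => [:: (1, r, o.+1, o.+1)]
  | Dec r => [:: (2, r, o.+1, o.+1)]
  | Then c1 c2 => flat c1 o ++ flat c2 (o + flen c1)
  | While r c => (0, r, o.+1, o + (flen c).+2) :: flat c o.+1 ++ [:: (0, 0, o, o)]
  end.

Lemma size_flat c o : size (flat c o) = flen c.
Proof.
elim: c o => [|r|r|c1 IH1 c2 IH2|r c IH] o //=; first by rewrite size_cat IH1 IH2.
by rewrite size_cat IH addn1.
Qed.

Definition inprog (P : seq instr) o l := forall i, i < size l ->
  nth (0, 0, 0, 0) P (o + i) = nth (0, 0, 0, 0) l i.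

Lemma inprog_cat P o l1 l2 : inprog P o (l1 ++ l2) ->
  inprog P o l1 /\ inprog P (o + size l1) l2.
Proof.
move=> H; split=> i il; first by rewrite H ?nth_cat ?il // size_cat ltn_addr.
by rewrite -addnA H ?size_cat ?ltn_add2l // nth_cat ltnNge leq_addr addKn.
Qed.

(** The bound on the visited addresses guarantees that a halting or special address placed at or
    after [e] is not met during the run. *)
Definition reaches P o e st st' := exists2 m, iter m (cmstep P) st = st' &
  forall j, j < m -> o <= (iter j (cmstep P) st).1 < e.

Lemma reaches_trans P o1 e1 o2 e2 o e st1 st2 st3 :
  reaches P o1 e1 st1 st2 -> reaches P o2 e2 st2 st3 ->
  o <= o1 -> o <= o2 -> e1 <= e -> e2 <= e -> reaches P o e st1 st3.
Proof.
move=> [m1 H1 L1] [m2 H2 L2] oo1 oo2 ee1 ee2.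
exists (m2 + m1); first by rewrite iterD H1.
move=> j jm; case: (ltnP j m1) => jm1.
  by have /andP[a b] := L1 _ jm1; rewrite (leq_trans oo1 a) (leq_trans b ee1).
rewrite -(subnK jm1) iterD H1.
have /andP[a b] : o2 <= (iter (j - m1) (cmstep P) st2).1 < e2 by apply: L2; lia.
by rewrite (leq_trans oo2 a) (leq_trans b ee2).
Qed.

Lemma reaches1 P o e st st' : cmstep P st = st' -> o <= st.1 < e -> reaches P o e st st'.
Proof. by move=> H L; exists 1 => // -[]. Qed.

Lemma flat_exec c s s' : exec c s s' -> forall P o, inprog P o (flat c o) ->
  reaches P o (o + flen c) (o, s) (o + flen c, s').
Proof.
elim=> {c s s'}.
- by move=> s P o _; exists 0; rewrite ?addn0.
- move=> r s P o H; apply: reaches1; last by rewrite /= addn1 leqnn /=.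
  by have := H 0 isT; rewrite addn0 /cmstep /= => ->; rewrite addn1 if_same.
- move=> r s P o H; apply: reaches1; last by rewrite /= addn1 leqnn /=.
  by have := H 0 isT; rewrite addn0 /cmstep /= => ->; rewrite addn1 if_same.
- move=> c1 c2 s1 s2 s3 _ IH1 _ IH2 P o /= /inprog_cat[H1 H2].
  rewrite size_flat in H2.
  apply: reaches_trans (IH1 _ _ H1) _ (leqnn _) (leqnn o) _ _.
  + have [m Hm Lm] := IH2 _ _ H2; exists m; first by rewrite Hm addnA.
    move=> j /Lm /andP[a b]; rewrite (leq_trans _ a) ?leq_addr //=.
    exact: b.
  + by rewrite addnA leq_addr.
  + by rewrite addnA.
- move=> r c s sr P o H; apply: reaches1; last by rewrite /=; lia.
  by have := H 0 isT; rewrite addn0 /cmstep /= => ->; rewrite sr.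
- move=> r c s1 s2 s3 sr _ IH1 _ IH2 P o H.
  have H0 := H 0 isT; rewrite addn0 /= in H0.
  have Hl : inprog P o.+1 (flat c o.+1).
    by have /= := @inprog_cat P o [:: _] _ H; rewrite addn1 => -[_ /inprog_cat[]].
  have Hb : nth (0, 0, 0, 0) P (o.+1 + flen c) = (0, 0, o, o).
    have /= := @inprog_cat P o [:: _] _ H; rewrite addn1 => -[_ /inprog_cat[_ /(_ 0 isT)]].
    by rewrite addn0 size_flat.
  apply: (@reaches_trans _ o (o + (flen c).+2) o (o + (flen c).+2) _ _ _ (o.+1, s1)).
  + apply: reaches1; last by rewrite /=; lia.
    by rewrite /cmstep /= H0 /=; case: eqP.
  + apply: (@reaches_trans _ o (o + (flen c).+2) o (o + (flen c).+2) _ _ _ (o, s2)) => //.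
    * apply: reaches_trans (IH1 _ _ Hl) _ _ (leqnn o) _ (leqnn _); try by lia.
      apply: reaches1; last by rewrite /=; lia.
      by rewrite /cmstep /= Hb /= if_same.
    * exact: IH2.
  + by [].
  + by [].
  + by [].
  + by [].
Qed.

Definition target_le n (i : instr) := let: (_, _, q1, q0) := i in (q1 <= n) && (q0 <= n).

Lemma flat_targets c o : all (target_le (o + flen c)) (flat c o).
Proof.
have mono m n l : m <= n -> all (target_le m) l -> all (target_le n) l.
  by move=> mn; apply: sub_all => -[[[? ?] q1] q0] /= /andP[a b]; apply/andP; lia.
elim: c o => [|r|r|c1 IH1 c2 IH2|r c IH] o //=; rewrite ?addn1 ?leqnn //.
  by rewrite all_cat (mono _ _ _ _ (IH1 o)) ?addnA ?leq_addr //= IH2.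
rewrite all_cat (mono _ _ _ _ (IH o.+1)) /=; last by lia.
by rewrite leq_addr !andbT; lia.
Qed.

(** * Simulation of counter machines by computable functions *)

Definition pcode (P : seq instr) : nat :=
  CodeSeq.code [seq let: (op, r, q1, q0) := i in CodeSeq.code [:: op; r; q1; q0] | i <- P].

Definition simstep (P st : nat) : nat :=
  let I := getn P (hdn st) in
  let x := getn (tln st) (getn I 1) in
  consn (if x == 0 then getn I 3 else getn I 2)
    (if getn I 0 == 0 then tln st
     else updn (tln st) (getn I 1) (if getn I 0 == 1 then x.+1 else x.-1)).

Definition represents (N : nat) (st : nat * store) :=
  hdn N = st.1 /\ forall r, getn (tln N) r = st.2 r.

Lemma simstep_represents P N st :
  represents N st -> represents (simstep (pcode P) N) (cmstep P st).
Proof.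
case: st => pc s [/= Hpc Hs].
have HI j : getn (getn (pcode P) pc) j =
    let: (op, r, q1, q0) := nth (0, 0, 0, 0) P pc in nth 0 [:: op; r; q1; q0] j.
  rewrite getn_code; case: (ltnP pc (size P)) => pcP.
    rewrite (nth_map (0, 0, 0, 0)) //; case: (nth _ _ _) => [[[op r] q1] q0].
    by rewrite getn_code.
  by rewrite nth_default ?size_map // getn0 nth_default //; case: j => [|[|[|[|[|]]]]].
rewrite /simstep /cmstep /= Hpc !HI; case: (nth _ _ _) => [[[op r] q1] q0] /=.
rewrite Hs; split; rewrite ?hdn_consn ?tln_consn //= => r'.
by case: ifP => // _; rewrite getn_updn /upd Hs.
Qed.

Lemma sim_represents P N st n :
  represents N st -> represents (iter n (simstep (pcode P)) N) (iter n (cmstep P) st).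
Proof. by move=> H; elim: n => //= n IH; apply: simstep_represents. Qed.

Lemma cpt_simstep k f g : cpt k f -> cpt k g -> cpt k (fun v => simstep (f v) (g v)).
Proof.
move=> cf cg; suff H : cpt2 simstep by apply: (@cpt_comp k _ [:: f; g] H).
have c1 j : cpt 2 (fun v => getn (getn (nth 0 v 0) (hdn (nth 0 v 1))) j).
  apply: cpt_getn; last exact: cpt_const.
  by apply: cpt_getn; [|apply: cpt_hdn]; apply: cpt_p0.
have c2 : cpt 2 (fun v => tln (nth 0 v 1)) by apply: cpt_tln; apply: cpt_p0.
have c3 : cpt 2 (fun v => getn (tln (nth 0 v 1))
    (getn (getn (nth 0 v 0) (hdn (nth 0 v 1))) 1)) by apply: cpt_getn.
apply: cpt_consn; apply: cpt_if; [by cpt_tac|exact: c1|exact: c1|by cpt_tac|exact: c2|].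
by apply: cpt_updn => //; apply: cpt_if; cpt_tac.
Qed.

Definition init_store (v : seq nat) : store := fun r => nth 0 v r.

Lemma init_represents v : represents (consn 0 (CodeSeq.code v)) (0, init_store v).
Proof. by split=> [|r]; rewrite ?hdn_consn // tln_consn getn_code. Qed.

(** * A universal $\Sigma_3$ process *)

(** [x] is packed as in [progcode]: halting address, program, input. The witness is read as
    [a - x.+1], so that requiring [x < a] of the marks loses none. *)
Definition accepts (x a b d n : nat) : bool :=
  let st := iter n (simstep (hdn (tln x)))
    (consn 0 (consn 0 (consn (tln (tln x)) (consn (a - x.+1) (consn b (consn d 0)))))) in
  (hdn st == hdn x) && (getn (tln st) 0 == 1).

Definition verified (x a b n : nat) : bool :=
  has (fun d => accepts x a b d n) (iota 0 n.+1).

Definition progress (x a n : nat) : nat :=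
  count (fun b => all (fun b' => verified x a b' n) (iota 0 b.+1)) (iota 0 n).

Definition advances (x a n : nat) : bool := progress x a n < progress x a n.+1.

Lemma cpt_accepts : cptb 5 (fun v => accepts (nth 0 v 0) (nth 0 v 1) (nth 0 v 2) (nth 0 v 3) (nth 0 v 4)).
Proof.
have c : cpt 5 (fun v => iter (nth 0 v 4) (simstep (hdn (tln (nth 0 v 0))))
    (consn 0 (consn 0 (consn (tln (tln (nth 0 v 0))) (consn (nth 0 v 1 - (nth 0 v 0).+1)
      (consn (nth 0 v 2) (consn (nth 0 v 3) 0))))))).
  apply: (@cpt_iter _ _ _ (fun z v => simstep (hdn (tln (nth 0 v 0))) z)).
  - exact: cpt_p0.
  - do ! apply: cpt_consn; try exact: cpt_const; try exact: cpt_p0.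
      by do 2 apply: cpt_tln; apply: cpt_p0.
    by apply: cpt_sub; [|apply: cpt_succ]; apply: cpt_p0.
  - apply: cpt_simstep; last exact: cpt_p0.
    by apply: cpt_hdn; apply: cpt_tln; apply: cpt_p1.
apply: cptb_and; apply: cptb_eq; try exact: cpt_const.
- exact: cpt_hdn.
- by apply: cpt_hdn; apply: cpt_p0.
- by apply: cpt_getn; [apply: cpt_tln | apply: cpt_const].
Qed.

Lemma cpt_lift5 (f : nat -> nat -> nat -> nat -> nat -> bool) k g1 g2 g3 g4 g5 :
  cptb 5 (fun v => f (nth 0 v 0) (nth 0 v 1) (nth 0 v 2) (nth 0 v 3) (nth 0 v 4)) ->
  cpt k g1 -> cpt k g2 -> cpt k g3 -> cpt k g4 -> cpt k g5 ->
  cptb k (fun v => f (g1 v) (g2 v) (g3 v) (g4 v) (g5 v)).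
Proof. by move=> H ? ? ? ? ?; apply: (@cpt_comp k _ [:: g1; g2; g3; g4; g5] H). Qed.

Lemma cpt_progress : cpt 3 (fun v => progress (nth 0 v 0) (nth 0 v 1) (nth 0 v 2)).
Proof.
apply: (@cpt_count _ _ (fun b v => all (fun b' =>
  verified (nth 0 v 0) (nth 0 v 1) b' (nth 0 v 2)) (iota 0 b.+1))); first exact: cpt_p0.
apply: (@cptb_all _ _ (fun b' w => verified (nth 0 (behead w) 0) (nth 0 (behead w) 1) b'
  (nth 0 (behead w) 2))); first by cpt_tac.
apply: (@cptb_has _ _ (fun d u => accepts (nth 0 (behead (behead u)) 0)
  (nth 0 (behead (behead u)) 1) (nth 0 u 0) d (nth 0 (behead (behead u)) 2))); first by cpt_tac.
by apply: (cpt_lift5 cpt_accepts); cpt_tac.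
Qed.

Lemma cpt_advances : cptb 3 (fun v => advances (nth 0 v 0) (nth 0 v 1) (nth 0 v 2)).
Proof.
have H g : cpt 3 g -> cpt 3 (fun v => progress (nth 0 v 0) (nth 0 v 1) (g v)).
  move=> cg; apply: (@cpt_comp 3 _ [:: _; _; g] cpt_progress); split; first exact: cpt_p0.
  by split; first exact: cpt_p0.
by apply: cptb_le; [apply: cpt_succ|]; apply: H; cpt_tac.
Qed.
Lemma verifiedP x a b n :
  reflect (exists2 d, d <= n & accepts x a b d n) (verified x a b n).
Proof.
apply: (iffP hasP) => -[d dn H]; exists d => //; first by move: dn; rewrite mem_iota.
by rewrite mem_iota.
Qed.

(** [progress] is nondecreasing in time, and unbounded exactly when every [b] is eventually
    verified; a nondecreasing sequence of integers is unbounded exactly when it increases infinitely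
    often. A forall-exists condition thus becomes the recurrence of a decidable event. *)
Lemma advances_infinitely x a :
  (forall b n m, n <= m -> verified x a b n -> verified x a b m) ->
  (forall K, exists2 n, K <= n & advances x a n) <-> (forall b, exists n, verified x a b n).
Proof.
move=> mono.
have allP' b n : reflect (forall b', b' <= b -> verified x a b' n)
    (all (fun b' => verified x a b' n) (iota 0 b.+1)).
  apply: (iffP allP) => H b'; last by rewrite mem_iota => /andP[_ bb]; apply: H.
  by move=> bb; apply: H; rewrite mem_iota.
have pmono n : progress x a n <= progress x a n.+1.
  rewrite /progress -[n.+1 in X in _ <= X]addn1 [in X in _ <= X]iotaD count_cat.
  apply: leq_trans (leq_addr _ _); apply: sub_count => b /allP' H; apply/allP' => b' bb.
  by apply: (mono _ n); [rewrite leq_addr | apply: H].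
have pmono2 n m : n <= m -> progress x a n <= progress x a m.
  by move=> nm; apply: (@homo_leq _ _ leq) nm; [exact: leqnn|exact: leq_trans|].
split=> [inf b|ver K].
- apply: contrapT => nver.
  have bound n : progress x a n <= b.
    rewrite /progress; case: (leqP n b) => nb; first by rewrite (leq_trans (count_size _ _)) ?size_iota.
    rewrite -(subnKC (ltnW nb)) iotaD count_cat.
    rewrite [X in _ + X](_ : _ = 0); first by rewrite addn0 (leq_trans (count_size _ _)) ?size_iota.
    apply/eqP; rewrite -leqn0 leqNgt -has_count; apply/negP => /hasP[b']; rewrite mem_iota => /andP[bb _].
    by move=> /allP' /(_ b bb) H; apply: nver; exists (b + (n - b)).
  have grow k : exists n, k <= progress x a n.
    elim: k => [|k [n IH]]; first by exists 0.
    have [m nm am] := inf n; exists m.+1.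
    by apply: leq_ltn_trans am; apply: leq_trans IH (pmono2 _ _ nm).
  by have [n] := grow b.+1; rewrite leqNgt ltnS bound.
- apply: contrapT => nadv.
  have const n : K <= n -> progress x a n = progress x a K.
    elim: n => [|n IH]; first by rewrite leqn0 => /eqP ->.
    rewrite leq_eqVlt => /predU1P[-> //|Kn]; rewrite -IH //.
    apply/eqP; rewrite eqn_leq pmono andbT leqNgt; apply/negP => H.
    by apply: nadv; exists n.
  have unb k : exists n, [/\ K <= n & k <= progress x a n].
    suff [n Hn] : exists n, forall b, b < k -> verified x a b n.
      exists (maxn K (maxn n k)); split; first by rewrite leq_maxl.
      have kM : k <= maxn K (maxn n k) by rewrite !leq_max leqnn !orbT.
      rewrite /progress -(subnKC kM) iotaD count_cat.
      apply: leq_trans (leq_addr _ _).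
      rewrite -[X in X <= _](size_iota 0 k) -[X in X <= _]count_predT.
      rewrite leq_eqVlt; apply/orP; left; apply/eqP; apply/eq_in_count => b.
      rewrite mem_iota => /andP[_ bk]; apply/esym/allP' => b' bb.
      by apply: (mono _ n); [rewrite subnKC // !leq_max leqnn orbT|apply: Hn; lia].
    elim: k => [|k [n Hn]]; first by exists 0.
    have [m Hm] := ver k; exists (maxn n m) => b; rewrite ltnS leq_eqVlt.
    case/predU1P => [->|bk]; first by apply: mono Hm; rewrite leq_maxr.
    by apply: mono (Hn _ bk); rewrite leq_maxl.
  have [n [Kn]] := unb (progress x a K).+1.
  by rewrite const // ltnn.
Qed.

Definition progcode (P : seq instr) (hp x : nat) : nat := consn hp (consn (pcode P) x).

Lemma cpt1_progcode P hp : computable1 (progcode P hp).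
Proof.
have [c cP] : cpt1 (progcode P hp).
  by do 2 (apply: cpt_consn; first exact: cpt_const); apply: cpt_p0.
by exists c => x; apply: (cP [:: x]).
Qed.

Lemma accepts_decides R : decidable4 R -> exists P hp, forall x a b d,
  exists m, forall n, accepts (progcode P hp x) a b d n =
    (m <= n) && R x (a - (progcode P hp x).+1) b d.
Proof.
case=> c cP; pose C := compile c [:: 1; 2; 3; 4] 0 5.
(* The appended instruction jumps to itself: once reached, [hp] is never left, which makes
   acceptance monotone in time, and [reaches] shows that it is not met before the result is
   ready. *)
pose hp := flen C; pose P := flat C 0 ++ [:: (0, 0, hp, hp)].
exists P, hp => x a0 b d; set a := a0 - _.
pose s := init_store [:: 0; x; a; b; d].
have ex : exec C s (upd s 0 (R x a b d)).
  apply: (eval_compile (cP x a b d)) => //.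
  by move=> r rr; rewrite /s /init_store nth_default.
have iP : inprog P 0 (flat C 0).
  by move=> i il; rewrite add0n nth_cat il.
have [m Hm Lm] := flat_exec ex iP; rewrite !add0n in Hm Lm.
exists m => n.
have Px : pcode P = hdn (tln (progcode P hp x)) by rewrite tln_consn hdn_consn.
have ax : tln (tln (progcode P hp x)) = x by rewrite !tln_consn.
have := sim_represents P n (init_represents [:: 0; x; a; b; d]).
rewrite !consn_code -/s [CodeSeq.code [::]]/= => -[H1 H2].
rewrite /accepts ax -Px -/a H1 H2 hdn_consn.
case: (leqP m n) => mn.
  have Hst j : iter j (cmstep P) (hp, upd s 0 (R x a b d)) = (hp, upd s 0 (R x a b d)).
    elim: j => //= j ->; rewrite /cmstep /= nth_cat size_flat ltnn subnn /=.
    by rewrite if_same.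
  rewrite -(subnK mn) iterD Hm Hst eqxx /= /upd eqxx.
  by case: (R _ _ _ _).
have /andP[_ L] := Lm _ mn; apply/negbTE; rewrite negb_and.
by rewrite neq_ltn L.
Qed.

(** Converts visits counted in machine time into visits counted in rounds; rounds have positive
    length, so round [n] starts at time [n] or later. *)
Lemma rounds (X : Type) (F : X -> X) (B : nat -> X) (sp : X -> bool) (h : nat -> bool) :
  (forall n, exists T, [/\ 0 < T, iter T F (B n) = B n.+1 &
     h n <-> exists2 j, j < T & sp (iter j F (B n))]) ->
  (forall K, exists2 t, K <= t & sp (iter t F (B 0))) <-> (forall K, exists2 n, K <= n & h n).
Proof.
move=> H; have [T HT] := choice H.
pose tau n := \sum_(i < n) T i.
have tauS n : tau n.+1 = tau n + T n by rewrite /tau big_ord_recr.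
have tauP n : iter (tau n) F (B 0) = B n.
  elim: n => [|n IH]; first by rewrite /tau big_ord0.
  by rewrite tauS addnC iterD IH; case: (HT n).
have taun n : n <= tau n.
  elim: n => // n IH; rewrite tauS -addn1 leq_add //.
  by case: (HT n).
split=> inf K.
- have [t Kt spt] := inf (tau K).
  have [n [nK n1 n2]] : exists n, [/\ K <= n, tau n <= t & t < tau n.+1].
    have ex : exists n, t < tau n by exists t.+1; apply: taun.
    case: (ex_minnP ex) => -[|n] tn mn; first by rewrite /tau big_ord0 in tn.
    have nt : tau n <= t by rewrite leqNgt; apply/negP => /mn; rewrite ltnn.
    exists n; split=> //; rewrite leqNgt; apply/negP => nK.
    have : tau n.+1 <= tau K.
      by rewrite -(subnKC nK) /tau big_split_ord leq_addr.
    by rewrite leqNgt => /negP; apply; apply: leq_ltn_trans Kt tn.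
  exists n => //; have [_ _ ->] := HT n; exists (t - tau n).
    by rewrite ltn_subLR // -tauS.
  by rewrite -tauP -iterD subnK.
- have [n Kn /(proj1 (let: And3 _ _ h := HT n in h)) [j jT spj]] := inf K.
  exists (j + tau n); last by rewrite iterD tauP.
  by rewrite (leq_trans Kn) // (leq_trans (taun n)) // leq_addl.
Qed.

Definition pcat (M : seq instr) (x a t : nat) : nat :=
  (iter t (cmstep M) (0, init_store [:: 0; x; a])).1.

Lemma main_machine : exists (M : seq instr) (sp : nat),
  [/\ all (target_le (size M).-1) M, sp < size M &
    forall x a, (forall K, exists2 t, K <= t & pcat M x a t == sp) <->
      (forall K, exists2 n, K <= n & advances x a n)].
Proof.
have [c cP] := cpt_advances.
pose C := compile c [:: 1; 2; 3] 0 4; pose L := flen C.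
(* Address [L] consumes the answer in register 0 and leads to the special address [L.+1] only if it
   was 1; address [L.+2] increments the stage in register 3 and restarts with clean registers. *)
pose M := flat C 0 ++ [:: (2, 0, L.+1, L.+2); (0, 0, L.+2, L.+2); (1, 3, 0, 0)].
have sM : size M = L.+3 by rewrite size_cat size_flat /= addn3.
exists M, L.+1; split.
- rewrite sM /= all_cat /= !leqnn !leqnSn /= andbT.
  apply: sub_all (flat_targets C 0) => -[[[? ?] q1] q0] /= /andP[]; rewrite add0n -/L; lia.
- by rewrite sM.
- move=> x a.
  pose s n := init_store [:: 0; x; a; n].
  rewrite /pcat; have -> : init_store [:: 0; x; a] = s 0.
    by apply: funext => -[|[|[|[|r]]]] //=; rewrite /s /init_store /= ?nth_nil.
  apply: (@rounds _ (cmstep M) (fun n => (0, s n)) (fun st => st.1 == L.+1)) => n.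
  have ex : exec C (s n) (upd (s n) 0 (advances x a n)).
    apply: (eval_compile (cP [:: x; a; n] erefl)) => //.
    by move=> r rr; rewrite /s /init_store nth_default.
  have iP : inprog M 0 (flat C 0) by move=> i il; rewrite add0n nth_cat il.
  have [m Hm Lm] := flat_exec ex iP; rewrite !add0n -/L in Hm Lm.
  have nthM i : i < 3 -> nth (0, 0, 0, 0) M (L + i) =
     nth (0, 0, 0, 0) [:: (2, 0, L.+1, L.+2); (0, 0, L.+2, L.+2); (1, 3, 0, 0)] i.
    by move=> i3; rewrite nth_cat size_flat ltnNge leq_addr addKn.
  have M0 := nthM 0 isT; have M1 := nthM 1 isT; have M2 := nthM 2 isT.
  rewrite addn0 in M0; rewrite addn1 in M1; rewrite addn2 in M2; rewrite /= in M0 M1 M2.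
  have S2 s' : s' 0 = 0 -> s' = s n -> cmstep M (L.+2, s') = (0, s n.+1).
    move=> z ->; rewrite /cmstep /= M2 if_same; congr pair.
    by apply: funext => -[|[|[|[|r]]]]; rewrite /upd //=.
  case adv : (advances x a n) Hm.
  + move=> Hm.
    have E1 : cmstep M (L, upd (s n) 0 1) = (L.+1, s n).
      rewrite /cmstep /= M0 /=; congr pair.
      by apply: funext => -[|r]; rewrite /upd.
    have E2 : cmstep M (L.+1, s n) = (L.+2, s n) by rewrite /cmstep /= M1 /=.
    exists (3 + m); split=> //; first by rewrite iterD Hm /= E1 E2 S2.
    split=> // _; exists m.+1; first by lia.
    by rewrite iterS Hm E1.
  + move=> Hm.
    have E1 : cmstep M (L, upd (s n) 0 0) = (L.+2, s n).
      rewrite /cmstep /= M0 /=; congr pair.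
      by apply: funext => -[|r]; rewrite /upd.
    exists (2 + m); split=> //; first by rewrite iterD Hm /= E1 S2.
    split=> // -[j jT]; case: (ltnP j m) => jm.
      by have /andP[_ l] := Lm _ jm => /eqP E; rewrite E in l; lia.
    have [->|->] : j = m \/ j = m.+1 by lia.
      by rewrite Hm /= => /eqP; lia.
    by rewrite iterS Hm E1 /= => /eqP; lia.
Qed.

Theorem universal_machine : exists (M : seq instr) (sp : nat),
  [/\ all (target_le (size M).-1) M, sp < size M &
    forall S, Sigma3 S -> exists f, computable1 f /\ forall x, S x <->
      exists2 a, f x < a & forall K, exists2 t, K <= t & pcat M (f x) a t == sp].
Proof.
have [M [sp [tM spM HM]]] := main_machine; exists M, sp; split=> // S [R [/accepts_decides]].
move=> [P [hp HP]] SR; exists (progcode P hp); split; first exact: cpt1_progcode.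
move=> x; rewrite SR; set fx := progcode P hp x.
have acc_inf a : (forall K, exists2 t, K <= t & pcat M fx a t == sp) <->
    forall b, exists d, R x (a - fx.+1) b d.
  rewrite HM advances_infinitely.
    split=> H b; have [] := H b.
      move=> n /verifiedP[d _]; have [m Hm] := HP x a b d.
      by rewrite Hm => /andP[_ ?]; exists d.
    move=> d Rd; have [m Hm] := HP x a b d; exists (maxn m d).
    by apply/verifiedP; exists d; rewrite ?leq_maxr // Hm leq_maxl.
  move=> b n m nm /verifiedP[d dn]; have [k Hk] := HP x a b d.
  rewrite Hk => /andP[kn Rd]; apply/verifiedP; exists d; first exact: leq_trans nm.
  by rewrite Hk (leq_trans kn nm).
split=> [[a Ha]|[a fa /acc_inf Ha]]; last by exists (a - fx.+1).
exists (fx.+1 + a); first by rewrite ltnS leq_addr.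
by apply/acc_inf; rewrite addKn.
Qed.

Lemma cpt_pcat M sp : cptb 3 (fun v => pcat M (nth 0 v 0) (nth 0 v 1) (nth 0 v 2) == sp).
Proof.
apply: (@cptb_ext _ (fun v => hdn (iter (nth 0 v 2) (simstep (pcode M))
   (consn 0 (consn 0 (consn (nth 0 v 0) (consn (nth 0 v 1) 0))))) == sp)).
  move=> v _; have [H _] := sim_represents M (nth 0 v 2) (init_represents [:: 0; nth 0 v 0; nth 0 v 1]).
  by move: H; rewrite !consn_code [CodeSeq.code [::]]/= => ->.
apply: cptb_eq; last exact: cpt_const.
apply: cpt_hdn; apply: (@cpt_iter _ _ _ (fun z v => simstep (pcode M) z)).
- exact: cpt_p0.
- by do ! apply: cpt_consn; try exact: cpt_const; apply: cpt_p0.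
- by apply: cpt_simstep; [exact: cpt_const|exact: cpt_p0].
Qed.

(** * The cellular automaton *)

Section Automaton.
Variables (st reg : finType) (ins : st -> bool * bool * reg * st * st).
Variables (st0 : st) (sp : pred st) (rx ra : reg).

(* [None] stands for the timer, which moves by one cell at every sweep. *)
Local Notation pebbles := {set option reg}.

(** [Fetch] records how many marks have been met. In [Trip q b m1 m2 c], [q] is the next state, [b]
    tells whether the executed state is special, [m1] and [m2] are the pebbles to be shifted on the
    way right and on the way left, and [c] those in hand. *)
Inductive activity : Type :=
| Fetch of option bool
| Exec of st
| Trip of st & bool & pebbles & pebbles & pebbles
| Emit
| Idle.

Definition head_code (h : activity) :
    option bool + st + (st * bool * pebbles * pebbles * pebbles) + bool :=
  match h with
  | Fetch p => inl (inl (inl p))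
  | Exec q => inl (inl (inr q))
  | Trip q b m1 m2 c => inl (inr (q, b, m1, m2, c))
  | Emit => inr true
  | Idle => inr false
  end.

Definition head_decode x : activity :=
  match x with
  | inl (inl (inl p)) => Fetch p
  | inl (inl (inr q)) => Exec q
  | inl (inr (q, b, m1, m2, c)) => Trip q b m1 m2 c
  | inr true => Emit
  | inr false => Idle
  end.

Lemma head_codeK : cancel head_code head_decode. Proof. by case. Qed.

HB.instance Definition _ := Finite.copy activity (can_type head_codeK).

(* Odometer digit, odometer borrow, pebbles, head (with its direction, [true] for right). *)
Definition content : Type := 'I_4 * bool * pebbles * option (bool * activity).

Inductive mode : Type := Dead | Wait | Start | Run of content.

Definition mode_code (m : mode) : option (option content) + unit :=
  match m with
  | Dead => inr tt | Wait => inl None | Start => inl (Some None) | Run c => inl (Some (Some c))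
  end.

Definition mode_decode x : mode :=
  match x with
  | inr tt => Dead | inl None => Wait | inl (Some None) => Start | inl (Some (Some c)) => Run c
  end.

Lemma mode_codeK : cancel mode_code mode_decode. Proof. by case. Qed.

HB.instance Definition _ := Finite.copy mode (can_type mode_codeK).

(** A pebble is shifted by being picked up in one cell and dropped in the next. [Exec] acts in cell
    0, where finding a pebble means that its register is 0. *)
Definition goright (h : activity) (mk : bool) (P : pebbles) : activity * pebbles :=
  match h with
  | Fetch None => if mk then (Fetch (Some false), Some rx |: P) else (h, P)
  | Fetch (Some false) => if mk then (Fetch (Some true), [set Some ra; None] :|: P) else (h, P)
  | Exec q =>
      let: (i, d, r, q1, q0) := ins q in
      let z := Some r \in P in
      let mvR := if i then [set None; Some r] else [set None] in
      let mvL := if d && ~~ z then [set Some r] else finset.set0 in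
      (Trip (if z then q0 else q1) (sp q) mvR mvL (P :&: mvR), P :\: mvR)
  | Trip q b mvR mvL c => (Trip q b mvR mvL (P :&: mvR), (P :\: mvR) :|: c)
  | _ => (h, P)
  end.

Definition goleft (h : activity) (P : pebbles) : activity * pebbles :=
  match h with
  | Trip q b mvR mvL c => (Trip q b mvR mvL (P :&: mvL), (P :\: mvL) :|: c)
  | _ => (h, P)
  end.

(** With the timer in hand at the right end there is no cell to drop it in: the computation is
    over. *)
Definition turnright (h : activity) : activity :=
  match h with
  | Fetch (Some true) => Trip st0 false finset.set0 finset.set0 finset.set0
  | Trip q b mvR mvL c =>
      if None \in c then (if b then Emit else Idle) else Trip q b mvR mvL finset.set0
  | Emit => Emit
  | _ => Idle
  end.

Definition turnleft (h : activity) : activity :=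
  match h with Trip q _ _ _ _ => Exec q | Emit => Emit | _ => Idle end.

(** An emitting head shuttles between cell 0 and the first mark [x], which gives the period 2x +
    2. *)
Definition turns (h : activity) (mk : bool) : bool := if h is Emit then mk else false.

(* The mark and the mode of a neighbour; [None] if it lies in another segment. *)
Definition neighbour : Type := option (bool * mode).

Definition digit_of (c : content) : 'I_4 := c.1.1.1.
Definition borrow_of (c : content) : bool := c.1.1.2.
Definition pebbles_of (c : content) : pebbles := c.1.2.
Definition head_of (c : content) : option (bool * activity) := c.2.

Definition init_content (l : neighbour) : content :=
  (inord 3, false, if l is None then ~: [set Some rx; Some ra; None] else finset.set0,
   if l is None then Some (true, Fetch None) else None).

(** The right end has the least significant digit and loses one unit at every step; borrows travel
    left by one cell per step. *)
Definition incoming (r : neighbour) : bool :=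
  if r is Some (_, Run c) then borrow_of c else true.

Definition next_digit (c : content) (r : neighbour) : 'I_4 :=
  if incoming r then (if digit_of c == 0 :> nat then inord 3 else inord (digit_of c).-1)
  else digit_of c.

Definition next_borrow (c : content) (r : neighbour) : bool :=
  incoming r && (digit_of c == 0 :> nat).

Definition next_pebbles (mk : bool) (c : content) : pebbles :=
  match head_of c with
  | Some (true, h) => (goright h mk (pebbles_of c)).2
  | Some (false, h) => (goleft h (pebbles_of c)).2
  | None => pebbles_of c
  end.

Definition arriving (l r : neighbour) : option (bool * activity) :=
  let fromright := if r is Some (_, Run c') then
      if head_of c' is Some (false, h) then Some (false, (goleft h (pebbles_of c')).1) else None
    else None in
  if l is Some (mk', Run c') then
    if head_of c' is Some (true, h) then
      if turns h mk' then fromright else Some (true, (goright h mk' (pebbles_of c')).1)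
    else fromright
  else fromright.

Definition next_head (l : neighbour) (mk : bool) (c : content) (r : neighbour) :=
  match head_of c with
  | Some (true, h) => if (r == None) || turns h mk
      then Some (false, turnright (goright h mk (pebbles_of c)).1) else arriving l r
  | Some (false, h) => if l == None
      then Some (true, turnleft (goleft h (pebbles_of c)).1) else arriving l r
  | None => arriving l r
  end.

Definition next_content l mk c r : content :=
  (next_digit c r, next_borrow c r, next_pebbles mk c, next_head l mk c r).

Definition isRun (m : mode) : bool := if m is Run _ then true else false.

(** [Start] moves right, overwriting everything and leaving [Wait] behind; at the right end it
    becomes a wave of fresh [Run] cells that comes back through the [Wait] cells. Death moves right
    unconditionally, and left into [Wait] and [Run] cells unless a [Start] arrives. *)
Definition next_mode (l : neighbour) (mk : bool) (m : mode) (r : neighbour) : mode :=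
  match l with
  | Some (_, Start) => Start
  | Some (_, Dead) => Dead
  | _ =>
    match m with
    | Dead => Dead
    | Start => if r is None then Run (init_content l) else Wait
    | Wait => match r with
        | None | Some (_, Dead) => Dead
        | Some (_, Run _) => Run (init_content l)
        | _ => Wait end
    | Run c => if (l == None) && borrow_of c then Dead
        else if (if r is Some (_, m') then isRun m' else true) then Run (next_content l mk c r)
        else Dead
    end
  end.

Definition calm (l : neighbour) : bool :=
  match l with Some (_, Dead) | Some (_, Start) => false | _ => true end.

Lemma next_wait l mk r : calm l -> next_mode l mk Wait r =
  match r with
  | None | Some (_, Dead) => Dead
  | Some (_, Run _) => Run (init_content l)
  | _ => Wait
  end.
Proof. by case: l => [[? []]|]. Qed.

Lemma next_run_dead l mk c mk' m : calm l -> ~~ isRun m ->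
  next_mode l mk (Run c) (Some (mk', m)) = Dead.
Proof. by case: l => [[? []]|] //=; case: m => //; case: borrow_of. Qed.

Lemma next_run l mk c r : calm l -> l <> None ->
  (if r is Some (_, m') then isRun m' else true) = true ->
  next_mode l mk (Run c) r = Run (next_content l mk c r).
Proof. by case: l => [[? [| | |?]]|] //= _ _ ->. Qed.

Section Segment.
Variables (k : nat) (mk : nat -> bool).
Implicit Types V : nat -> mode.

Definition leftn V i : neighbour := if i is j.+1 then Some (mk j, V j) else None.
Definition rightn V i : neighbour := if i.+1 < k then Some (mk i.+1, V i.+1) else None.
Definition segstep V : nat -> mode := fun i => next_mode (leftn V i) (mk i) (V i) (rightn V i).
Local Notation evol t V := (iter t segstep V).

Lemma dead0 V : V 0 = Dead -> segstep V 0 = Dead.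
Proof. by rewrite /segstep /= => ->. Qed.

Lemma dead0_iter V s t : s <= t -> evol s V 0 = Dead -> evol t V 0 = Dead.
Proof.
by move=> /subnK <-; elim: (t - s) => //= n IH /IH; apply: dead0.
Qed.

Lemma dead_spread V t s i : evol t V 0 = Dead -> i <= s -> evol (s + t) V i = Dead.
Proof.
move=> V0; elim: s i => [|s IH] i; first by rewrite leqn0 => /eqP ->.
rewrite leq_eqVlt => /predU1P[->|is_].
  by rewrite addSn iterS /segstep /= (IH s).
have := IH i is_; case: i is_ => [|i] is_ Di; first by rewrite addSn iterS; apply: dead0.
by rewrite addSn iterS /segstep /= (IH i) // ltnW.
Qed.

Definition allrun V := forall i, i < k -> isRun (V i).

Lemma allrun_right V i : allrun V ->
  (if rightn V i is Some (_, m') then isRun m' else true) = true.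
Proof. by move=> aV; rewrite /rightn; case: ifP => // /aV. Qed.

Lemma allrun_step V : allrun V -> segstep V 0 <> Dead -> allrun (segstep V).
Proof.
move=> aV nD i ik.
case: i ik => [|i] ik.
  move: nD; rewrite /segstep /=; have := aV 0 ik; case: (V 0) => // c _.
  by case: (borrow_of c) => //=; rewrite allrun_right.
rewrite /segstep /=.
have := aV i (ltnW ik); have := aV i.+1 ik; case: (V i) => // c; case: (V i.+1) => //= c' _ _.
by rewrite allrun_right.
Qed.

Lemma allrun_iter V s t : s <= t -> allrun (evol s V) -> evol t V 0 <> Dead ->
  allrun (evol t V).
Proof.
move=> /subnK <-; elim: (t - s) => // n IH aV.
rewrite addSn iterS => nD; apply: allrun_step => //; apply: IH => // D0.
by apply: nD; apply: dead0.
Qed.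

(** * The odometer *)

Definition digits V : nat := \sum_(0 <= i < k) 4 ^ (k - i.+1) *
  (if V i is Run c then digit_of c else 0).
Definition borrows V : nat := \sum_(0 <= i < k) 4 ^ (k - i) *
  (if V i is Run c then borrow_of c else false).

Lemma next_digitE (c : content) r :
  next_digit c r + incoming r = digit_of c + 4 * next_borrow c r :> nat.
Proof.
rewrite /next_digit /next_borrow; case: (incoming r) => /=; last by rewrite muln0.
case: eqP => [->|d0]; first by rewrite inordK.
have := ltn_ord (digit_of c); move=> d4; rewrite inordK; lia.
Qed.

(** A borrow pending in cell i is counted with the weight of the digit of cell i - 1, which owes it.
    Then digits minus borrows drops by exactly one per step, the unit taken at the right end. *)
Lemma odometer_step V : 0 < k -> allrun V -> segstep V 0 <> Dead ->
  digits (segstep V) + borrows V + 1 = digits V + borrows (segstep V).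
Proof.
move=> k0 aV nD.
have c0 : exists c, V 0 = Run c by have := aV 0 k0; case: (V 0) => // c _; exists c.
pose inc i : nat := incoming (rightn V i).
have stepE j : j < k -> exists c, V j = Run c /\
    segstep V j = Run (next_content (leftn V j) (mk j) c (rightn V j)).
  move=> ik; have aVn := allrun_step aV nD; have := aV j ik; have := aVn j ik.
  rewrite /segstep; case: (V j) => // c H _; exists c; split=> //; move: H.
  by rewrite /next_mode; case: (leftn V j) => [[m [| | |c']]|] //=; do ?[case: ifP => // _].
have E : digits (segstep V) + \sum_(0 <= j < k) 4 ^ (k - j.+1) * inc j
    = digits V + borrows (segstep V).
  rewrite /digits /borrows -!big_split /=; apply: eq_big_nat => j jk.
  have [c [-> ->]] := stepE j jk.
  by rewrite -(subnSK jk) expnSr -mulnA -!mulnDr next_digitE.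
rewrite -E -addnA; congr addn; rewrite /borrows.
case: c0 => c c0; have b0 : borrow_of c = false.
  by move: nD; rewrite /segstep /= c0 /=; case: (borrow_of c).
rewrite big_ltn // c0 b0 muln0 add0n big_add1.
have -> : \sum_(0 <= j < k) 4 ^ (k - j.+1) * inc j =
    \sum_(0 <= j < k.-1) 4 ^ (k - j.+1) * inc j + 1.
  rewrite -{1}(prednK k0) big_nat_recr //= prednK // subnn mul1n.
  by rewrite /inc /rightn prednK // ltnn.
congr addn; apply: eq_big_nat => j jk; have jk1 : j.+1 < k by lia.
by rewrite /inc /rightn jk1 /incoming; have := aV j.+1 jk1; case: (V j.+1).
Qed.

Lemma geometric4 n : 3 * (\sum_(0 <= i < n) 4 ^ (n - i.+1)) + 1 = 4 ^ n.
Proof.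
elim: n => [|n IH]; first by rewrite big_nil.
rewrite big_nat_recl // subSS subn0; under eq_bigr do rewrite subSS.
by rewrite expnS -IH; lia.
Qed.

Lemma digits_lt V : digits V < 4 ^ k.
Proof.
rewrite -geometric4 addn1 ltnS /digits big_distrr /=; apply: leq_sum => i _.
by rewrite mulnC leq_mul2r; apply/orP; right; case: (V i) => // c; rewrite -ltnS ltn_ord.
Qed.

Lemma borrows_le V : 3 * borrows V <= 4 * 4 ^ k.
Proof.
apply: (@leq_trans (4 * (3 * (\sum_(0 <= i < k) 4 ^ (k - i.+1))))).
  rewrite mulnCA leq_pmul2l // big_distrr /=.
  rewrite /borrows big_nat_cond [X in _ <= X]big_nat_cond; apply: leq_sum => i /andP[/andP[_ ik] _].
  rewrite -expnS subnSK // -[X in _ <= X]muln1 leq_mul2l; apply/orP; right.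
  by case: (V i) => // c; case: (borrow_of c).
by rewrite leq_pmul2l // -geometric4 leq_addr.
Qed.

Lemma borrows_le0 V c : 0 < k -> V 0 = Run c -> borrow_of c = false -> 3 * borrows V < 4 ^ k.
Proof.
move=> k0 V0 b0; rewrite /borrows big_ltn // V0 b0 muln0 add0n big_add1.
apply: (@leq_ltn_trans (3 * (4 * \sum_(0 <= i < k.-1) 4 ^ (k.-1 - i.+1)))).
  rewrite leq_pmul2l // big_distrr /= big_nat_cond [X in _ <= X]big_nat_cond.
  apply: leq_sum => i /andP[/andP[_ ik] _].
  rewrite -expnS (_ : (k.-1 - i.+1).+1 = k - i.+1); last by lia.
  rewrite -[X in _ <= X]muln1 leq_mul2l; apply/orP; right.
  by case: (V _) => // c'; case: (borrow_of c').
rewrite mulnCA -(prednK k0) /= expnS; have := geometric4 k.-1.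
set a := 4 ^ _; lia.
Qed.

Lemma odometer_iter V m : 0 < k -> allrun V -> evol m V 0 <> Dead ->
  digits (evol m V) + borrows V + m = digits V + borrows (evol m V).
Proof.
move=> k0 aV; elim: m => [|m IH] nD; first by rewrite addn0.
have nD' : evol m V 0 <> Dead by move=> H; apply: nD; apply: dead0.
have := odometer_step k0 (allrun_iter (leq0n m) aV nD') nD.
by have := IH nD'; rewrite -iterS; lia.
Qed.

Lemma death V : 0 < k -> allrun V -> evol (3 * 4 ^ k) V 0 = Dead.
Proof.
move=> k0 aV; apply: contrapT => nD.
(* Digits below 4^k and final borrows at most (4/3) 4^k leave room for fewer than (7/3) 4^k
   steps. *)
have := odometer_iter k0 aV nD; have := digits_lt V; have := borrows_le (evol (3 * 4 ^ k) V).
lia.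
Qed.

(** When cell 0 is initialized the cells on its right are already counting, so only the leading
    digit is known. It is worth 3 * 4^(k-1), the pending borrows cost less than 4^k / 3, and death
    requires a borrow of weight 4^k in cell 0: more than (5/3) 4^(k-1) steps are needed. *)
Lemma survival V d P h m : 0 < k -> allrun V -> V 0 = Run (d, false, P, h) -> d = 3 :> nat ->
  m <= 4 ^ k.-1 -> evol m V 0 <> Dead.
Proof.
move=> k0 aV V0 d3; elim: m => [|m IH] mk4; first by rewrite /= V0.
have nD := IH (ltnW mk4); move=> D.
have am := allrun_iter (leq0n m) aV nD.
have b1 : exists2 c, evol m V 0 = Run c & borrow_of c.
  move: D; rewrite iterS /segstep /=; have := am 0 k0; case: (evol m V 0) => // c _.
  case b : (borrow_of c) => /=; first by exists c.
  by rewrite allrun_right.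
case: b1 => c c0 cb.
have := odometer_iter k0 aV nD; have := digits_lt (evol m V).
have := borrows_le0 k0 V0 erefl.
have : 4 ^ k <= borrows (evol m V).
  by rewrite /borrows big_ltn // c0 cb subn0 muln1 leq_addr.
have : 3 * 4 ^ k.-1 <= digits V.
  by rewrite /digits big_ltn // V0 /digit_of /= d3 subn1 mulnC leq_addr.
have : 4 ^ k = 4 * 4 ^ k.-1 by rewrite -expnS prednK.
lia.
Qed.

(** * Fate of a segment according to its initial modes *)

Definition zone lo hi V := [/\ lo <= hi, hi < k, forall i, i < lo -> V i = Wait,
  forall i, lo <= i < hi -> isRun (V i) &
  if lo == hi then V hi = Dead else ~~ isRun (V hi)].

(** Whatever follows the [Run] block kills its last cell, so the death front moves left by one cell
    per step, even though the block keeps growing leftwards into the [Wait] cells. *)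
Lemma zone_dead lo hi V : zone lo hi V -> evol hi V 0 = Dead.
Proof.
elim: hi lo V => [|hi IH] lo V; first by case; rewrite leqn0 => /eqP ->; rewrite eqxx.
move=> [lohi hik VW VR Vhi]; rewrite iterSr.
have [D|nD] := pselect (segstep V 0 = Dead); first exact: dead0_iter (leq0n hi) D.
have calml i : i <= hi -> calm (leftn V i).
  case: i => //= i ihi; case: (ltnP i lo) => il; first by rewrite VW.
  by have : isRun (V i) by [apply: VR; lia]; case: (V i).
have VE i : i <= hi -> rightn V i = Some (mk i.+1, V i.+1).
  by move=> ihi; rewrite /rightn (leq_ltn_trans _ hik).
apply: (IH (minn lo.-1 hi)); split; first exact: geq_minr.
- exact: ltnW.
- move=> i ilo; have [i1 i2] : i.+1 < lo /\ i <= hi by lia.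
  by rewrite /segstep VE // VW 1?ltnW // next_wait ?calml // VW.
- move=> i ilo; have ihi : i < hi by lia.
  have Rr : isRun (V i.+1) by apply: VR; lia.
  rewrite /segstep VE ?(ltnW ihi) //; case: (ltnP i lo) => il.
    by rewrite VW // next_wait ?calml ?(ltnW ihi) //; case: (V i.+1) Rr.
  have : isRun (V i) by [apply: VR; lia]; case Vi : (V i) => [| | |c] // _.
  case: i il ilo ihi Rr Vi => [|i] il ilo ihi Rr Vi.
    move: nD; rewrite /segstep /= VE // Vi /=.
    by case: (borrow_of c) => //=; rewrite Rr.
  by rewrite next_run ?calml ?(ltnW ihi).
- have -> : segstep V hi = Dead.
    rewrite /segstep VE // ; case: (ltnP hi lo) => hlo.
      have E : lo = hi.+1 by lia.
      by rewrite VW // next_wait ?calml //; move: Vhi; rewrite E eqxx => ->.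
    rewrite (_ : (lo == hi.+1) = false) in Vhi; last by lia.
    have : isRun (V hi) by [apply: VR; lia]; case: (V hi) => // c _.
    by rewrite next_run_dead // calml.
  by case: ifP.
Qed.

Definition good j V := [/\ j < k, forall i, i < j -> V i = Wait & V j = Start].
Definition tiny j V := [/\ j < k, forall i, i < j -> V i = Wait &
  forall i, j <= i < k -> isRun (V i)].

Lemma segment_cases V : 0 < k ->
  [\/ exists j, good j V, exists j, tiny j V | evol k V 0 = Dead].
Proof.
move=> k0.
have first (P : nat -> bool) : (forall i, i < k -> ~~ P i) \/
    exists j, [/\ j < k, P j & forall i, i < j -> ~~ P i].
  case: (pselect (exists i, (i < k) && P i)) => [ex|nex]; [right|left].
    case: (ex_minnP ex) => j /andP[jk Pj] mj; exists j; split=> // i ij.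
    by apply/negP => Pi; have := mj i; rewrite (ltn_trans ij jk) Pi leqNgt ij => /(_ isT).
  by move=> i ik; apply/negP => Pi; apply: nex; exists i; rewrite ik.
pose nw i := if V i is Wait then false else true.
have nwP i : ~~ nw i -> V i = Wait by rewrite /nw; case: (V i).
have [W|[j [jk Pj Wj]]] := first nw.
  apply: Or33.
  have Z : zone k.-1 k.-1 (segstep V).
    split; rewrite ?leqnn //; try lia.
      move=> i ik; have ik' : i.+1 < k by lia.
      rewrite /segstep (nwP i) ?W 1?ltnW // next_wait.
        by rewrite /rightn ik' nwP // W.
      by case: i {ik} ik' => //= i ik'; rewrite nwP // W //; lia.
    rewrite eqxx /segstep nwP ?W ?next_wait ?prednK //.
      by rewrite /rightn prednK // ltnn.
    have : k.-1 < k by lia.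
    by case: k.-1 => //= i ik; rewrite nwP // W // ltnW.
  by rewrite -(prednK k0) iterSr; apply: zone_dead Z.
have {}Wj i : i < j -> V i = Wait by move=> /Wj /nwP.
move: Pj; rewrite /nw; case Vj : (V j) => [| | |c] // _.
- apply: Or33; apply: dead0_iter (ltnW jk) _.
  by apply: (@zone_dead j); split=> //; [lia|rewrite eqxx].
- by apply: Or31; exists j.
have [R|[m [mk' Pm Rm]]] := first (fun i => (j <= i) && ~~ isRun (V i)).
  apply: Or32; exists j; split=> // i /andP[ji ik].
  by have := R i ik; rewrite ji negbK.
apply: Or33; apply: dead0_iter (ltnW mk') _.
case/andP: Pm => jm nRm; apply: (@zone_dead j); split=> //.
  by move=> i /andP[ji im]; have := Rm i im; rewrite ji negbK.
by case: eqP => // E; rewrite -E Vj in nRm.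
Qed.

Lemma tiny_allrun j V : tiny j V -> allrun (evol j V).
Proof.
elim: j V => [|j IH] V [jk VW VR]; first by move=> i ik; apply: VR.
rewrite iterSr; apply: IH; split; first exact: ltnW.
  move=> i ij; rewrite /segstep VW 1?ltnW // next_wait /rightn.
    by rewrite (_ : i.+1 < k) ?VW //; lia.
  by case: i ij => //= i ij; rewrite VW //; lia.
move=> i /andP[ji ik]; rewrite /segstep.
have [E|ij] : i = j \/ j < i by lia.
  subst i; rewrite VW // next_wait /rightn ?jk.
    by have := VR j.+1; rewrite leqnn jk => /(_ isT); case: (V j.+1).
  by case: j {VR ji ik} jk VW => //= j jk VW; rewrite VW.
have := VR i; rewrite ij ik => /(_ isT); case: (V i) => // c _.
rewrite next_run //; last by rewrite /rightn; case: ifP => // i1k; apply: VR; lia.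
  case: i ij ik {ji} => // i ij ik /=; case: (ltnP j i) => ji; last by rewrite VW.
  by have : isRun (V i) by [apply: VR; lia]; case: (V i).
by case: i ij {ik ji}.
Qed.

Lemma good_step j V : good j V -> j.+1 < k -> good j.+1 (segstep V).
Proof.
move=> [jk VW VS] j1k; split=> //; last by rewrite /segstep /= VS.
move=> i; rewrite ltnS leq_eqVlt => /predU1P[->|ij]; rewrite /segstep.
  rewrite VS /rightn j1k; case: j jk VW {VS} j1k => //= j _ VW _.
  by rewrite VW.
rewrite VW // next_wait /rightn.
  rewrite (_ : i.+1 < k); last by lia.
  by case: (ltnP i.+1 j) => il; [rewrite VW|rewrite (_ : i.+1 = j) ?VS //; lia].
by case: i ij => //= i ij; rewrite VW // ltnW.
Qed.

Lemma good_iter j V s : good j V -> j + s < k -> good (j + s) (evol s V).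
Proof.
move=> gV; elim: s => [|s IH] js; first by rewrite addn0.
by rewrite addnS; apply: good_step; [apply: IH; lia|lia].
Qed.

(** Behind the returning wave there is neither pebble nor head, since [init_content] creates them at
    the left end only; the digits there have already begun to change. *)
Definition wave i V := [/\ forall c, c < i -> V c = Wait,
  V i = Run (init_content (leftn V i)) &
  forall c, i < c < k -> exists d b, V c = Run (d, b, finset.set0, None)].

Lemma wave_start V : good k.-1 V -> wave k.-1 (segstep V).
Proof.
move=> [k0 VW VS]; split; last by move=> c; lia.
  move=> i ik; rewrite /segstep VW // next_wait /rightn.
    rewrite (_ : i.+1 < k); last by lia.
    by case: (ltnP i.+1 k.-1) => il; [rewrite VW|rewrite (_ : i.+1 = k.-1) ?VS //; lia].
  by case: i ik => //= i ik; rewrite VW // ltnW.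
have k0' : 0 < k by lia.
rewrite {1}/segstep VS /rightn prednK // ltnn.
have : forall i, i < k.-1 -> V i = Wait by [].
by case: k.-1 => //= m H; rewrite H.
Qed.

Lemma wave_step i V : wave i.+1 V -> i.+1 < k -> wave i (segstep V).
Proof.
move=> [VW Vi VR] ik.
have calml c : c <= i.+1 -> calm (leftn V c) by case: c => //= c ci; rewrite VW.
split=> [c ci||c /andP[ic ck]].
- rewrite /segstep VW ?next_wait ?calml /rightn; try lia.
  by rewrite (_ : c.+1 < k) ?VW //; lia.
- rewrite {1}/segstep VW // next_wait ?calml // /rightn ik Vi.
  by case: i {ik Vi VR VW calml}.
- have [d [b Vc]] : exists d b, V c = Run (d, b, finset.set0, None).
    move: ic; rewrite leq_eqVlt => /predU1P[<-|ic]; last by apply: VR; rewrite ic.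
    by rewrite Vi; do 2 eexists.
  have R c' : i < c' < k -> exists d b, V c' = Run (d, b, finset.set0, None).
    rewrite leq_eqVlt => /andP[/predU1P[<-|ic'] ck']; last by apply: VR; rewrite ic'.
    by rewrite Vi; do 2 eexists.
  case: c ic ck Vc => // c ic ck Vc; rewrite /segstep Vc next_run //.
  + rewrite /next_content /next_pebbles /next_head [head_of _]/=.
    rewrite (_ : arriving _ _ = None); first by do 2 eexists.
    rewrite /arriving /= /rightn; have : (V c = Wait) \/ exists d b, V c = Run (d, b, finset.set0, None).
      by case: (ltnP i c) => ci; [right; apply: R; lia|left; apply: VW; lia].
    case: ifP => ck'; last by case=> [->|[d' [b' ->]]].
    by have [|d2 [b2 ->]] := R c.+2; [lia|case=> [->|[d' [b' ->]]]].
  + rewrite /=; case: (ltnP i c) => ci; last by rewrite VW //; lia.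
    by have [|d2 [b2 ->]] := R c; first by lia.
  + by rewrite /rightn; case: ifP => // ck'; have [|d2 [b2 ->]] := R c.+2; first by lia.
Qed.

(** The time 2k - 1 - j is made of k - 1 - j steps for [Start] to reach the right end, one step to
    turn, and k - 1 steps back. *)
Lemma good_wave j V : good j V -> wave 0 (evol (k.*2.-1 - j) V).
Proof.
move=> gV; have jk : j < k by case: gV.
have := good_iter (s := k.-1 - j) gV; rewrite subnKC; last by lia.
move=> /(_ ltac:(lia)) /wave_start; rewrite -iterS.
set U := evol _ V => W0.
have W i : i <= k.-1 -> wave (k.-1 - i) (evol i U).
  elim: i => [|i IH] ik; first by rewrite subn0.
  apply: wave_step; last by lia.
  by rewrite (_ : (k.-1 - i.+1).+1 = k.-1 - i); [apply: IH|]; lia.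
have := W k.-1 (leqnn _); rewrite subnn /U -iterD.
by rewrite (_ : k.-1 + (k.-1 - j).+1 = k.*2.-1 - j) //; lia.
Qed.

Lemma wave_allrun V : wave 0 V -> allrun V.
Proof.
move=> [_ V0 VR] [|i] ik; first by rewrite V0.
by have [|d [b ->]] := VR i.+1; first by rewrite ik.
Qed.

(** * The head as a sweeping automaton *)

Definition hconf : Type := nat * bool * activity * (nat -> pebbles).

Definition hstep (x : hconf) : hconf :=
  let: (pos, d, h, P) := x in
  let hP := if d then goright h (mk pos) (P pos) else goleft h (P pos) in
  let P' := fun i => if i == pos then hP.2 else P i in
  if d then
    if (pos.+1 == k) || turns h (mk pos) then (pos, false, turnright hP.1, P')
    else (pos.+1, true, hP.1, P')
  else if pos == 0 then (0, true, turnleft hP.1, P') else (pos.-1, false, hP.1, P').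

(** As long as the segment lives, its head and pebbles evolve independently of the odometer, whose
    digits and borrows stay existential. *)
Definition agree V (x : hconf) : Prop := let: (pos, d, h, P) := x in
  pos < k /\ forall i, i < k ->
    exists dg b, V i = Run (dg, b, P i, if i == pos then Some (d, h) else None).

Lemma agree_allrun V x : agree V x -> allrun V.
Proof. by case: x => [[[pos d] h] P] [_ H] i /H[dg [b ->]]. Qed.

Lemma run_step V i c : allrun V -> segstep V 0 <> Dead -> i < k -> V i = Run c ->
  segstep V i = Run (next_content (leftn V i) (mk i) c (rightn V i)).
Proof.
move=> aV nD ik Vi; have := allrun_step aV nD ik.
rewrite /segstep Vi /next_mode; case: (leftn V i) => [[m [| | |c']]|] //=; do ?[case: ifP => // _].
Qed.

Lemma agree_step V x : agree V x -> segstep V 0 <> Dead -> agree (segstep V) (hstep x).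
Proof.
move=> aVx nD; have aV := agree_allrun aVx; case: x aVx => [[[pos d] h] P] [posk H].
have arr i : i < k -> arriving (leftn V i) (rightn V i) =
    if [&& i == pos.+1, d & ~~ turns h (mk pos)] then Some (true, (goright h (mk pos) (P pos)).1)
    else if (i.+1 == pos) && ~~ d then Some (false, (goleft h (P pos)).1) else None.
  move=> ik; have R : (if rightn V i is Some (_, Run c') then
      if head_of c' is Some (false, h) then Some (false, (goleft h (pebbles_of c')).1) else None
    else None) = if (i.+1 == pos) && ~~ d then Some (false, (goleft h (P pos)).1) else None.
    rewrite /rightn; case: ifP => i1k; last by case: eqP => // E; rewrite E posk in i1k.
    have [dg [b ->]] := H _ i1k; rewrite /head_of /pebbles_of /=.
    by case: eqP => [->|] //; case: (d).
  rewrite /arriving R; case: i ik {R} => //= i ik.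
  have [dg [b ->]] := H _ (ltnW ik); rewrite /head_of /pebbles_of /= eqSS.
  by case: eqP => [->|] //; case: (d) => //=; case: (turns _ _).
have rN i : i < k -> (rightn V i == None) = (i.+1 == k).
  move=> ik; rewrite /rightn; case: ltnP => ?; last by rewrite eqxx; apply/esym/eqP; lia.
  by apply/esym/negbTE; lia.
have lN i : (leftn V i == None) = (i == 0) by case: i.
have new i : i < k -> exists dg b, segstep V i = Run (dg, b,
    if i == pos then (if d then goright h (mk pos) (P pos) else goleft h (P pos)).2 else P i,
    if i == pos then
      if d then if (i.+1 == k) || turns h (mk i) then
        Some (false, turnright (goright h (mk pos) (P pos)).1) else None
      else if i == 0 then Some (true, turnleft (goleft h (P pos)).1) else None
    else arriving (leftn V i) (rightn V i)).
  move=> ik; have [dg [b Vi]] := H i ik; rewrite (run_step aV nD ik Vi).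
  do 2 eexists; congr (Run (_, _, _, _)).
    by rewrite /next_pebbles /head_of /pebbles_of /=; case: eqP => [->|] //; case: (d).
  rewrite /next_head /head_of /pebbles_of /= rN // lN; case: eqP => // E.
  have A : arriving (leftn V i) (rightn V i) = None.
    rewrite arr // E (_ : (pos == pos.+1) = false); last by lia.
    by rewrite (_ : (pos.+1 == pos) = false) //; lia.
  by rewrite A -E; case: (d).
rewrite /hstep; case: d H arr new => H arr new.
- case: ifP => E; split=> //.
  + move=> i ik; have [dg [b ->]] := new i ik; exists dg, b; congr (Run (_, _, _, _)).
    case: eqP => [->|ne]; first by rewrite E.
    rewrite arr // andbF; case: eqP => //= ei.
    by move: E; rewrite -ei; case: (turns _ _) => //; rewrite orbF => /eqP; lia.
  + by move/negbT: E; rewrite negb_or => /andP[/eqP ? _]; lia.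
  + move=> i ik; have [dg [b ->]] := new i ik; exists dg, b; congr (Run (_, _, _, _)).
    case: eqP => [->|ne]; first by rewrite E (_ : (pos == pos.+1) = false) //; lia.
    rewrite arr // andbF; move/negbT: E; rewrite negb_or => /andP[_ ->].
    by rewrite !andbT.
- case: eqP => p0; split=> //; try lia.
  + move=> i ik; have [dg [b ->]] := new i ik; exists dg, b; congr (Run (_, _, _, _)).
    rewrite p0; case: eqP => [_|ne] //.
    by rewrite arr // andbF andbT p0 /=.
  + move=> i ik; have [dg [b ->]] := new i ik; exists dg, b; congr (Run (_, _, _, _)).
    case: eqP => [->|ne].
      have [-> ->] : (pos == 0) = false /\ (pos == pos.-1) = false by lia.
      by [].
    rewrite arr // andbF andbT.
    by rewrite (_ : (i == pos.-1) = (i.+1 == pos)) //; lia.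
Qed.

Lemma agree_iter V x n : agree V x -> evol n V 0 <> Dead -> agree (evol n V) (iter n hstep x).
Proof.
move=> aVx; elim: n => [|n IH] nD //=; apply: agree_step => //; apply: IH => D.
by apply: nD; apply: dead0.
Qed.

(** * Sweeps simulate counter machine steps *)

Definition place (s : option reg -> nat) (i : nat) : pebbles := [set r | s r == i].

Definition astep (x : st * (reg -> nat)) : st * (reg -> nat) :=
  let: (i, d, r, q1, q0) := ins x.1 in
  (if x.2 r == 0 then q0 else q1,
   fun r' => if r' == r then x.2 r + i - (d && (x.2 r != 0)) else x.2 r').

Definition areg (x a : nat) : reg -> nat := fun r => if r == rx then x else if r == ra then a else 0.
Definition arun (x a n : nat) : st * (reg -> nat) := iter n astep (st0, areg x a).

Lemma iter_path (T : Type) (F : T -> T) (B : nat -> T) n :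
  (forall i, i < n -> F (B i) = B i.+1) -> iter n F (B 0) = B n.
Proof. by elim: n => //= n IH H; rewrite IH ?H // => i ik; apply: H; apply: ltnW. Qed.

Lemma left_sweep q b (mvR mvL : pebbles) (s : option reg -> nat) (P : nat -> pebbles) : 1 < k ->
  (forall r, r \in mvL -> 0 < s r < k) -> (forall i, i < k -> P i = place s i) ->
  exists2 P', iter k hstep (k.-1, false, Trip q b mvR mvL finset.set0, P) = (0, true, Exec q, P')
    & forall i, i < k -> P' i = place (fun r => if r \in mvL then (s r).-1 else s r) i.
Proof.
move=> k1 Hs HP; pose s' r := if r \in mvL then (s r).-1 else s r.
(* Invariant of the sweep: the cells on the right of the head are up to date, and the head carries
   the pebbles taken from the cell that it has just left. *)
pose B n : hconf := (k.-1 - n, false, Trip q b mvR mvL [set r in mvL | s r == (k.-1 - n).+1],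
  fun i => if i <= k.-1 - n then P i else if i < k then place s' i else P i).
have newP i c : i < k -> c = [set r in mvL | s r == i.+1] ->
    (P i :\: mvL) :|: c = place s' i.
  move=> ik ->; rewrite HP //; apply/setP => r; rewrite !inE /s'.
  by case: (boolP (r \in mvL)) => [/Hs ?|_] /=; lia.
have HB : iter k.-1 hstep (B 0) = B k.-1.
  apply: iter_path => n nk; rewrite /B /hstep.
  have -> : (k.-1 - n == 0) = false by lia.
  rewrite -subnS; congr (_, _, _, _).
    rewrite /= leqnn; congr Trip; rewrite HP; last by lia.
    by apply/setP => r; rewrite !inE andbC (_ : (k.-1 - n.+1).+1 = k.-1 - n) //; lia.
  apply: funext => i /=; rewrite leqnn; case: eqP => [->|ne].
    rewrite newP //; last by lia.
    rewrite (_ : (_ <= k.-1 - n.+1) = false); last by lia.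
    by rewrite (_ : (_ < k)) //; lia.
  by rewrite (_ : (i <= k.-1 - n.+1) = (i <= k.-1 - n)) //; lia.
have B0 : B 0 = (k.-1, false, Trip q b mvR mvL finset.set0, P).
  rewrite /B subn0; congr (_, _, Trip _ _ _ _ _, _).
    apply/setP => r; rewrite !inE; apply/negbTE/negP => /andP[/Hs ? /eqP ?]; lia.
  by apply: funext => i; case: ifP => // H; case: ifP => // ?; lia.
exists (fun i => if i == 0 then place s' 0 else if i < k then place s' i else P i).
  rewrite -B0 -{1}(prednK (ltnW k1)) iterS HB /B subnn /hstep /=; congr (_, _, _, _).
  apply: funext => i; case: (eqVneq i 0) => [_|i0] /=; first by rewrite newP // ltnW.
  by rewrite leqn0 (negbTE i0).
by move=> i ik; case: eqP => [->|_] //; rewrite ik.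
Qed.

Lemma right_sweep q (s : option reg -> nat) (P : nat -> pebbles) (i d : bool) r q1 q0 : 1 < k -> ins q = (i, d, r, q1, q0) ->
  (forall i, i < k -> P i = place s i) ->
  let mvR := if i then [set None; Some r] else [set None] in
  let z := s (Some r) == 0 in
  let mvL := if d && ~~ z then [set Some r] else finset.set0 in
  exists2 P', iter k hstep (0, true, Exec q, P) =
     (k.-1, false, turnright (Trip (if z then q0 else q1) (sp q) mvR mvL
        [set r in mvR | (s r).+1 == k]), P')
    & forall i, i < k -> P' i = place (fun r => s r + (r \in mvR)) i.
Proof.
move=> k1 insq HP mvR z mvL; pose s' r := s r + (r \in mvR).
pose h n := Trip (if z then q0 else q1) (sp q) mvR mvL [set r in mvR | (s r).+1 == n].
pose B n : hconf := (n, true, h n, fun i => if i < n then place s' i else P i).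
have newP j : j < k -> (P j :\: mvR) :|: [set r in mvR | (s r).+1 == j] = place s' j.
  move=> jk; rewrite HP //; apply/setP => r'; rewrite [in RHS]inE /s' finset.in_setU finset.in_setD finset.in_set.
  by rewrite finset.in_set; case: (r' \in mvR) => /=; lia.
have carry j : j < k -> P j :&: mvR = [set r in mvR | (s r).+1 == j.+1].
  by move=> jk; rewrite HP //; apply/setP => r'; rewrite finset.in_setI !finset.in_set andbC eqSS.
have step0 : goright (Exec q) (mk 0) (P 0) = (h 1, place s' 0).
  rewrite /= insq; have -> : (Some r \in P 0) = z by rewrite HP 1?ltnW // inE.
  rewrite -/mvR carry 1?ltnW // -newP 1?ltnW //; congr pair.
  rewrite [X in _ :|: X](_ : _ = finset.set0) ?finset.setU0 //.
  by apply/setP => r'; rewrite !inE andbF.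
have HB : iter k.-2 hstep (B 1) = B k.-1.
  have := @iter_path _ hstep (fun n => B n.+1) k.-2; rewrite (_ : k.-2.+1 = k.-1); last by lia.
  apply => n nk; rewrite /B /hstep.
  rewrite (_ : (n.+2 == k) || _ = false); last by rewrite orbF; lia.
  congr (_, _, _, _).
    by rewrite /= ltnn carry //; lia.
  apply: funext => j /=; rewrite ltnn; case: eqP => [->|ne].
    by rewrite newP ?ltnS ?leqnn //; lia.
  by rewrite (_ : (j < n.+2) = (j < n.+1)) //; lia.
exists (fun j => if j < k then place s' j else P j); last by move=> j ->.
have iterE X : iter k hstep X = hstep (iter k.-2 hstep (hstep X)).
  by rewrite -iterSr -iterS; congr (iter _ _ _); lia.
rewrite iterE; have -> : hstep (0, true, Exec q, P) = B 1.
  rewrite /hstep step0 /= (_ : (1 == k) = false) ?orbF /=; last by lia.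
  rewrite /B; congr (_, _, _, _); apply: funext => j; by case: j.
rewrite HB /B /hstep !prednK ?eqxx /=; try lia.
rewrite (_ : (k <= k.-1) = false); last by lia.
rewrite carry; last by lia.
rewrite prednK; last by lia.
congr (_, _, _, _); apply: funext => j; case: eqP => [->|ne].
  by have kk : k.-1 < k by [lia]; rewrite newP // kk.
by rewrite (_ : (j < k) = (j < k.-1)) //; lia.
Qed.

Lemma load_sweep x a : x < a < k -> rx != ra -> mk x -> mk a ->
  (forall i, i < a -> i != x -> ~~ mk i) ->
  exists2 P', iter k hstep (0, true, Fetch None,
      fun i => if i == 0 then ~: [set Some rx; Some ra; None] else finset.set0) =
     (k.-1, false, Trip st0 false finset.set0 finset.set0 finset.set0, P')
    & forall i, i < k -> P' i = place (fun r => if r is Some r' then areg x a r' else a) i.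
Proof.
move=> /andP[xa ak] rxa mx ma mN; pose s r := if r is Some r' then areg x a r' else a.
pose P0 i : pebbles := if i == 0 then ~: [set Some rx; Some ra; None] else finset.set0.
pose ph i := if i <= x then None else if i <= a then Some false else Some true.
pose B n : hconf := (n, true, Fetch (ph n), fun i => if i < n then place s i else P0 i).
have sE r : s r = if r == Some rx then x else if (r == Some ra) || (r == None) then a else 0.
  by case: r => [r|] //=; rewrite /areg /= orbF.
have P0E r i : (r \in P0 i) = (i == 0) && ~~ [|| r == Some rx, r == Some ra | r == None].
  by rewrite /P0; case: eqP; rewrite !inE // orbA.
have excl r : r == Some rx -> (r == Some ra) = false /\ (r == None) = false.
  by move=> /eqP ->; rewrite /eq_op /= (negbTE rxa).
have E i : i < k -> goright (Fetch (ph i)) (mk i) (P0 i) = (Fetch (ph i.+1), place s i).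
  move=> ik; have [ex|ix] := eqVneq i x; last have [ea|ia] := eqVneq i a.
  - rewrite ex /ph leqnn ltnn xa /= mx; congr pair; apply/setP => r; rewrite !inE sE P0E.
    case: (boolP (r == Some rx)) => [/excl[-> ->]|rn] /=; first by rewrite eqxx.
    by case: ifP => /=; lia.
  - rewrite ea /ph leqNgt xa /= leqnn ltnn leqNgt ltnS (ltnW xa) /= ma.
    congr pair; apply/setP => r; rewrite !inE sE P0E.
    case: (boolP (r == Some rx)) => [/excl[-> ->]|rn] /=; first by lia.
    by case: ifP => /= H; lia.
  - have mi : turns (Fetch (ph i)) (mk i) = false by [].
    have pE : place s i = P0 i.
      apply/setP => r; rewrite !inE sE P0E.
      case: (boolP (r == Some rx)) => [/excl[-> ->]|rn] /=; first by lia.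
      by case: ifP => /= H; lia.
    rewrite pE /ph; case: (leqP i x) => h1.
      rewrite (_ : i < x); last by lia.
      by rewrite /= (negbTE (mN _ _ _)) //; lia.
    rewrite (_ : (i < x) = false); last by lia.
    case: (leqP i a) => h2; last by rewrite (_ : (i < a) = false) //; lia.
    rewrite (_ : i < a); last by lia.
    by rewrite /= (negbTE (mN _ _ _)) //; lia.
have HB : iter k.-1 hstep (B 0) = B k.-1.
  apply: iter_path => n nk; rewrite /B /hstep.
  rewrite (_ : (n.+1 == k) || _ = false); last by rewrite orbF; lia.
  rewrite ltnn E /=; last by lia.
  congr (_, _, _, _); apply: funext => i; rewrite ltnS.
  case: (ltngtP i n) => // ->.
  by [].
exists (fun i => if i < k then place s i else P0 i); last by move=> i ->.
have iterE X : iter k hstep X = hstep (iter k.-1 hstep X) by rewrite -iterS prednK //; lia.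
rewrite iterE (_ : (0, true, Fetch None, _) = B 0); last by rewrite /B /ph.
rewrite HB /B /hstep ltnn E /=; last by lia.
rewrite prednK ?eqxx /=; last by lia.
have phk : ph k = Some true.
  by rewrite /ph leqNgt (ltn_trans xa ak) /= leqNgt ak.
rewrite phk.
congr (_, _, _, _); apply: funext => i; case: (ltngtP i k.-1) => ik /=.
- by rewrite (_ : i < k) //; lia.
- by rewrite (_ : (i < k) = false) //; lia.
- by rewrite ik (_ : k.-1 < k) //; lia.
Qed.

Lemma round x a n P : 1 < k ->
  (forall r, (arun x a n).2 r <= a + n) -> a + n < k.-1 ->
  (forall i, i < k -> P i = place (fun r => if r is Some r' then (arun x a n).2 r' else a + n) i) ->
  exists2 P', iter k.*2 hstep (0, true, Exec (arun x a n).1, P) = (0, true, Exec (arun x a n.+1).1, P') &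
   forall i, i < k -> P' i = place (fun r => if r is Some r' then (arun x a n.+1).2 r' else a + n.+1) i.
Proof.
move=> k1 sB ank HP; rewrite /arun iterS -/(arun x a n) /astep; move: (arun x a n) sB HP => [q s] /= sB HP.
case insq : (ins q) => [[[[i d] r] q1] q0].
have [P1 E1 HP1] := right_sweep k1 insq HP; rewrite -addnn iterD E1.
move: HP1; set mvR := if i then _ else _; set mvL := if d && _ then _ else _ => HP1.
have NmvR : None \in mvR by rewrite /mvR; case: (i); rewrite !inE.
have RmvR r' : (Some r' \in mvR) = i && (r' == r) by rewrite /mvR; case: (i); rewrite !inE.
have c0 : [set r' in mvR | ((if r' is Some r'' then s r'' else a + n).+1 == k)] = finset.set0.
  apply/setP => r'; rewrite !inE; apply/negbTE/negP => /andP[_ /eqP].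
  by case: r' => [r'|]; [have := sB r'|]; lia.
rewrite c0 /= inE.
have NmvL : (None \in mvL) = false by rewrite /mvL; case: ifP; rewrite !inE.
have RmvL r' : (Some r' \in mvL) = [&& d, s r != 0 & r' == r].
  by rewrite /mvL; case: (d) => /=; rewrite ?inE //; case: (s r == 0); rewrite /= !inE.
have [r' |P2 E2 HP2] := left_sweep (if s r == 0 then q0 else q1) (sp q) mvR (mvL := mvL) k1 _ HP1.
  case: r' => [r'|]; last by rewrite NmvL.
  rewrite RmvL RmvR => /and3P[_ s0 /eqP ->]; have := sB r.
  by rewrite eqxx; case: (i); lia.
exists P2 => // j jk; rewrite HP2 //; apply/setP => r'; rewrite !inE; congr (_ == _).
case: r' => [r'|]; last by rewrite NmvR NmvL addn1 addnS.
rewrite RmvR RmvL; case: (eqVneq r' r) => [->|ne]; last by rewrite !andbF addn0.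
by rewrite andbT; case: (d); case: (i) => /=; case: (s r == 0) => /=; lia.
Qed.

(** A register gains at most one per step, the pace of the timer, which starts at [a > x]. So no
    register pebble gets ahead of the timer, and none is carried past the right end while the timer
    is still inside. *)
Lemma arun_le x a n r : x < a -> (arun x a n).2 r <= a + n.
Proof.
move=> xa; elim: n r => [|n IH] r.
  by rewrite /= /areg; case: ifP => _; [|case: ifP]; lia.
rewrite /arun iterS -/(arun x a n) /astep; case: (arun x a n) IH => [q s] /= IH.
case: (ins q) => [[[[i d] r'] q1] q0] /=; have := IH r; have := IH r'.
by case: eqP => [->|_]; case: (i); lia.
Qed.

Lemma rounds_sweeps x a n P : 1 < k -> x < a -> a + n < k ->
  (forall i, i < k -> P i = place (fun r => if r is Some r' then areg x a r' else a) i) ->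
  exists2 P', iter (n * k.*2) hstep (0, true, Exec st0, P) = (0, true, Exec (arun x a n).1, P') &
   forall i, i < k -> P' i = place (fun r => if r is Some r' then (arun x a n).2 r' else a + n) i.
Proof.
move=> k1 xa; elim: n => [|n IH] ank HP; first by exists P; rewrite ?addn0.
have [|P1 E1 HP1] := IH _ HP; first by lia.
have [||P2 E2 HP2] := round k1 _ _ HP1; [by move=> r; apply: arun_le|by lia|].
by exists P2 => //; rewrite mulSn iterD E1 E2.
Qed.

Lemma left_plain h P : (forall P, goleft h P = (h, P)) -> turnleft h = h -> 0 < k ->
  iter k hstep (k.-1, false, h, P) = (0, true, h, P).
Proof.
move=> Hg Ht k0.
have same p : (fun i => if i == p then P p else P i) = P.
  by apply: funext => i; case: eqP => [->|].
have iterE X : iter k hstep X = hstep (iter k.-1 hstep X) by rewrite -iterS prednK.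
rewrite iterE.
have := @iter_path _ hstep (fun n => (k.-1 - n, false, h, P)) k.-1; rewrite subn0 => ->.
  by rewrite subnn /= Hg Ht same.
move=> n nk /=; rewrite (_ : (k.-1 - n == 0) = false) ?Hg /= ?same -?subnS //.
by apply/negbTE; lia.
Qed.

Lemma last_sweep q P a (s : reg -> nat) : 1 < k -> a = k.-1 ->
  (forall i, i < k -> P i = place (fun r => if r is Some r' then s r' else a) i) ->
  exists P', iter k.*2 hstep (0, true, Exec q, P) = (0, true, if sp q then Emit else Idle, P').
Proof.
move=> k1 ak HP; case insq : (ins q) => [[[[i d] r] q1] q0].
have [P1 E1 HP1] := right_sweep k1 insq HP; exists P1; rewrite -addnn iterD E1 /=.
rewrite !inE ak prednK ?eqxx ?andbT; last by lia.
rewrite (_ : None \in _); last by case: (i); rewrite !inE.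
by case: (sp q); apply: left_plain => //; lia.
Qed.

Definition emits (V : nat -> mode) : bool :=
  if V 0 is Run c then head_of c == Some (true, Emit) else false.

Lemma emit_period x P n : x < k -> mk x -> (forall i, i < x -> ~~ mk i) ->
  iter n hstep (0, true, Emit, P) =
  (let m := n %% x.*2.+2 in if m <= x then m else x.*2.+1 - m, n %% x.*2.+2 <= x, Emit, P).
Proof.
move=> xk mx mN.
have same p : (fun i => if i == p then P p else P i) = P.
  by apply: funext => i; case: eqP => [->|].
elim: n => [|n IH]; first by rewrite mod0n.
rewrite iterS IH [in RHS]modnS /=.
have ml := ltn_pmod n (ltn0Sn x.*2.+1).
have -> : (x.*2.+2 %| n.+1) = (n %% x.*2.+2 == x.*2.+1).
  rewrite /dvdn -addn1 -modnDml addn1.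
  case: (eqVneq (n %% x.*2.+2) x.*2.+1) => [->|/eqP ne]; first by rewrite modnn.
  by rewrite modn_small //; lia.
move: (n %% x.*2.+2) ml => m ml.
have [mx'|mx'|mx'] : [\/ m < x, x < m | m = x] by case: (ltngtP m x) => ?; [apply: Or31|apply: Or32|apply: Or33].
- have [-> -> ->] : [/\ (m == x.*2.+1) = false, (m <= x) = true & (m.+1 == k) = false] by split; lia.
  by rewrite /= (negbTE (mN _ mx')) mx' same.
- have [-> E2] : (m <= x) = false /\ (m < x) = false by lia.
  case: (eqVneq m x.*2.+1) => E; first by rewrite E subnn /= same.
  have -> : (x.*2.+1 - m == 0) = false by lia.
  by rewrite /= E2 same subnS.
- have [-> -> ->] : [/\ (m == x.*2.+1) = false, (m <= x) = true & (m < x) = false] by split; lia.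
  by rewrite /= mx' mx orbT same; congr (_, _, _, _); lia.
Qed.

Lemma idle_forever n x : x.1.2 = Idle -> (iter n hstep x).1.2 = Idle.
Proof.
elim: n => //= n IH /IH; case: (iter n hstep x) => [[[pos d] h] P] /= ->.
by case: d; case: ifP.
Qed.

Lemma wave_agree V : wave 0 V -> 0 < k -> agree V (0, true, Fetch None,
  fun i => if i == 0 then ~: [set Some rx; Some ra; None] else finset.set0).
Proof.
move=> [_ V0 VR] k0; split=> // -[|i] ik; first by rewrite V0; do 2 eexists.
by have [|d [b ->]] := VR i.+1; [rewrite ik|do 2 eexists].
Qed.

(** [T] adds to the start-up time k - a + 1 round trips of length 2k: one to load the marks, k - 1 -
    a machine steps, and one in which the timer hits the right end. *)
Lemma good_emits j V x a t : good j V -> x < a < k -> rx != ra -> mk x -> mk a ->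
  (forall i, i < a -> i != x -> ~~ mk i) ->
  let T := k.*2.-1 - j + (k - a).+1 * k.*2 in
  T <= t -> evol t V 0 <> Dead ->
  emits (evol t V) = sp (arun x a (k.-1 - a)).1 && (x.*2.+2 %| t - T).
Proof.
move=> gV xak rxa mx ma mN T Tt nD; have /andP[xa ak] := xak.
have k0 : 0 < k by lia. have k1 : 1 < k by lia.
have mN' i : i < x -> ~~ mk i by move=> ix; apply: mN; lia.
have A0 := wave_agree (good_wave gV) k0.
have tE : t = (t - T) + ((k - a).+1 * k.*2) + (k.*2.-1 - j) by rewrite /T in Tt *; lia.
have nD' : evol (t - T + (k - a).+1 * k.*2) (evol (k.*2.-1 - j) V) 0 <> Dead by rewrite -iterD -tE.
have := agree_iter A0 nD'; rewrite -[X in agree X]iterD -tE.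
have [P1 E1 HP1] := load_sweep xak rxa mx ma mN.
have [|P2 E2 HP2] := @left_sweep st0 false finset.set0 finset.set0 _ P1 k1 _ HP1.
  by move=> r; rewrite inE.
have HP2' : forall i, i < k -> P2 i = place (fun r => if r is Some r' then areg x a r' else a) i.
  by move=> i ik; rewrite HP2 //; apply/setP => r; rewrite !inE.
have [|P3 E3 HP3] := rounds_sweeps (n := k.-1 - a) k1 xa _ HP2'; first by lia.
have [|P4 E4] := last_sweep (arun x a (k.-1 - a)).1 k1 _ HP3; first by lia.
have E12 : iter k.*2 hstep (0, true, Fetch None,
  fun i => if i == 0 then ~: [set Some rx; Some ra; None] else finset.set0) = (0, true, Exec st0, P2).
  by rewrite -addnn iterD E1 E2.
have E0 : iter (t - T + (k - a).+1 * k.*2) hstep (0, true, Fetch None,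
  fun i => if i == 0 then ~: [set Some rx; Some ra; None] else finset.set0) =
  iter (t - T) hstep (0, true, if sp (arun x a (k.-1 - a)).1 then Emit else Idle, P4).
  rewrite iterD (_ : (k - a).+1 * k.*2 = k.*2 + ((k.-1 - a) * k.*2 + k.*2)).
    by rewrite iterD (iterD ((k.-1 - a) * k.*2)) E12 E3 E4.
  by rewrite (_ : k - a = (k.-1 - a).+1) ?mulSn; lia.
rewrite {}E0; move: (evol _ _) => W; move: (t - T) => n; case: (sp _) => /=.
  rewrite (emit_period _ _ (ltn_trans xa ak) mx mN') /emits => -[_ /(_ 0 k0)[dg [b ->]]].
  rewrite /head_of /= /dvdn; case: (leqP (n %% x.*2.+2) x) => h.
    by rewrite /= [0 == _]eq_sym; case: (_ == 0); rewrite ?eqxx.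
  have -> : (n %% x.*2.+2 == 0) = false by lia.
  by case: ifP.
case E : (iter n hstep _) => [[[pos d] h] P]; have := @idle_forever n (0, true, Idle, P4) erefl.
rewrite E /= => -> [_ /(_ 0 k0)[dg [b Hb]]]; rewrite /emits Hb /head_of /=.
by apply/negbTE/eqP; case: ifP.
Qed.

Lemma death_time V t : 0 < k -> k.*2 + 3 * 4 ^ k <= t -> evol t V 0 = Dead.
Proof.
move=> k0 tk.
have D s : s <= k.*2 -> allrun (evol s V) -> evol t V 0 = Dead.
  move=> sk /(death k0); rewrite -iterD => H; apply: dead0_iter H; lia.
have [[j gV]|[j tV]|H] := segment_cases V k0.
- by apply: D (wave_allrun (good_wave gV)); lia.
- by apply: D (tiny_allrun tV); case: tV => *; lia.
- by apply: dead0_iter H; lia.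
Qed.

Lemma good_alive j V t : good j V -> k.*2.-1 - j <= t <= k.*2.-1 - j + 4 ^ k.-1 ->
  evol t V 0 <> Dead.
Proof.
move=> gV /andP[t1 t2]; have k0 : 0 < k by case: gV => *; lia.
have W := good_wave gV; have [_ V0 _] := W.
have := survival (m := t - (k.*2.-1 - j)) k0 (wave_allrun W) V0.
by rewrite -iterD subnK //; apply; [rewrite /= inordK | lia].
Qed.

Lemma alive_cases V t : 0 < k -> k.*2 <= t -> evol t V 0 <> Dead ->
  isRun (evol t V 0) /\ ((exists j, good j V) \/ (exists j, tiny j V)).
Proof.
move=> k0 tk nD.
have R s : s <= k.*2 -> allrun (evol s V) -> isRun (evol t V 0).
  by move=> sk aV; apply: (allrun_iter (leq_trans sk tk) aV nD).
have [[j gV]|[j tV]|H] := segment_cases V k0.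
- by split; [apply: R (wave_allrun (good_wave gV)); lia | left; exists j].
- by split; [apply: R (tiny_allrun tV); case: tV => *; lia | right; exists j].
- by case: nD; apply: dead0_iter H; lia.
Qed.

End Segment.

(** * The global map *)

Definition letter : Type := bool * bool * mode * bool.
HB.instance Definition _ := Finite.copy letter (bool * bool * mode * bool)%type.
Definition color (q : letter) : bool := q.1.1.1.
Definition mark (q : letter) : bool := q.1.1.2.
Definition mode_of (q : letter) : mode := q.1.2.
Definition data (q : letter) : bool := q.2.

Definition signal (m : mode) : bool :=
  if m is Run c then head_of c == Some (true, Emit) else false.

Definition step3 (l m r : letter) : letter :=
  let nl := if color l == color m then Some (mark l, mode_of l) else None in
  let nr := if color r == color m then Some (mark r, mode_of r) else None in
  (color m, mark m, next_mode nl (mark m) (mode_of m) nr,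
   if (color l != color m) && isRun (mode_of m) then signal (mode_of m) else data r).

(* One-sided configurations; cell [0] is its own left neighbour. *)
Definition step (g : nat -> letter) : nat -> letter := fun i => step3 (g i.-1) (g i) (g i.+1).

Local Notation evolve g t := (iter t step g).

Lemma colorE g t i : color ((evolve g t) i) = color (g i).
Proof. by elim: t i. Qed.

Lemma markE g t i : mark ((evolve g t) i) = mark (g i).
Proof. by elim: t i. Qed.

Definition left_end g z : bool := color (g z.-1) != color (g z).

Definition segment g z k : Prop :=
  [/\ 0 < k, left_end g z, forall i, i < k -> color (g (z + i)) = color (g z) &
      color (g (z + k)) != color (g z)].

Definition smarks (g : nat -> letter) z i := mark (g (z + i)).
Definition smodes (g : nat -> letter) z i := mode_of (g (z + i)).

Lemma segment_evol g z k t i : segment g z k -> i < k ->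
  mode_of ((evolve g t) (z + i)) = iter t (segstep k (smarks g z)) (smodes g z) i.
Proof.
move=> [k0 zl zc zr]; have z0 : 0 < z by move: zl; rewrite /left_end; case: z {zc zr} => //; rewrite eqxx.
elim: t i => [|t IH] i ik //.
rewrite !iterS {1}/step /segstep /step3 [mode_of (_, _)]/= !colorE !markE zc //.
rewrite IH //; congr next_mode.
  case: i ik => [|i] ik; first by rewrite addn0 (negbTE zl).
  by rewrite addnS /= zc ?eqxx ?IH // ltnW.
rewrite /rightn; case: (ltnP i.+1 k) => ik'.
  by rewrite -addnS zc // eqxx IH.
have E : i.+1 = k by lia.
by rewrite -addnS E (negbTE zr).
Qed.

Definition emitting g t z : bool := left_end g z && isRun (mode_of ((evolve g t) z)).

Lemma data_step g t y : data ((evolve g (t.+1)) y) =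
  if emitting g t y then signal (mode_of ((evolve g t) y)) else data ((evolve g t) y.+1).
Proof. by rewrite iterS {1}/step /step3 /data /= /emitting /left_end !colorE. Qed.

(* Data travel to the left at unit speed from the first emitting left end. *)
Lemma data_trace g t y m : m < t -> (forall i, i < m -> ~~ emitting g (t.-1 - i) (y + i)) ->
  emitting g (t.-1 - m) (y + m) ->
  data ((evolve g t) y) = signal (mode_of ((evolve g (t.-1 - m)) (y + m))).
Proof.
elim: m t y => [|m IH] t y mt H E; case: t mt H E => // t mt H E.
  by rewrite data_step; move: E; rewrite subn0 addn0 /= => ->.
rewrite data_step; have := H 0 isT; rewrite subn0 addn0 => /negbTE ->.
have -> : t.+1.-1 - m.+1 = t.-1 - m by lia.
rewrite addnS -addSn; apply: IH => //.
  move=> i im; have := H i.+1 im; rewrite addnS -addSn.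
  by rewrite (_ : t.+1.-1 - i.+1 = t.-1 - i) //; lia.
by move: E; rewrite addnS -addSn (_ : t.+1.-1 - m.+1 = t.-1 - m) //; lia.
Qed.

(** At a left end this says that the segment has length at least [K], but it reads finitely many
    cells only and does not assume that the segment is finite. *)
Definition mono (g : nat -> letter) z K : bool :=
  all (fun i => color (g (z + i)) == color (g z)) (iota 0 K).

Lemma monoP g z K : reflect (forall i, i < K -> color (g (z + i)) = color (g z)) (mono g z K).
Proof.
apply: (iffP allP) => H i; first by move=> iK; apply/eqP/H; rewrite mem_iota.
by rewrite mem_iota => /andP[_ iK]; apply/eqP/H.
Qed.

Lemma mono_segment g z K : left_end g z -> ~~ mono g z K -> exists2 k, k < K & segment g z k.
Proof.
move=> zl /monoP nm.
have ex : exists i, color (g (z + i)) != color (g z).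
  apply: contrapT => H; apply: nm => i _; apply/eqP/negPn/negP => ne; apply: H.
  by exists i.
case: (ex_minnP ex) => k nk mk; exists k.
  rewrite ltnNge; apply/negP => Kk; apply: nm => i iK; apply/eqP/negPn/negP => /mk.
  by rewrite leqNgt (leq_trans iK Kk).
split=> //; first by case: k nk {mk} => //; rewrite addn0 eqxx.
by move=> i ik; apply/eqP/negPn/negP => /mk; rewrite leqNgt ik.
Qed.

Lemma segment_mono g z k K : segment g z k -> mono g z K = (K <= k).
Proof.
move=> [_ _ zc zr]; apply/monoP/idP => [H|Kk i iK]; last by apply: zc; apply: leq_trans Kk.
by rewrite leqNgt; apply/negP => kK; move: zr; rewrite H // eqxx.
Qed.

(** The left end is dead by time 2k + 3 * 4^k, and k more steps let death spread to the whole
    segment. *)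
Definition DT k : nat := 3 * k + 3 * 4 ^ k.

Lemma leq_DT k k' : k <= k' -> DT k <= DT k'.
Proof. by move=> kk; rewrite leq_add // leq_mul // leq_pexp2l. Qed.

Lemma segment_dead g z k t i : segment g z k -> DT k <= t -> i < k ->
  mode_of (evolve g t (z + i)) = Dead.
Proof.
move=> seg; have k0 : 0 < k by case: seg.
rewrite /DT => kt ik; rewrite (segment_evol _ seg) //.
rewrite (_ : t = k + (t - k)); last by lia.
by apply: dead_spread (ltnW ik); apply: death_time => //; lia.
Qed.

Lemma short_dead g z K t : left_end g z -> ~~ mono g z K -> DT K <= t -> ~~ emitting g t z.
Proof.
move=> zl nm Kt; have [k kK seg] := mono_segment zl nm.
have k0 : 0 < k by case: seg.
have := segment_dead seg (leq_trans (leq_DT (ltnW kK)) Kt) k0.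
by rewrite addn0 /emitting => ->; rewrite andbF.
Qed.

(** The two color changes around [y] put it in a segment shorter than 2K. *)
Lemma cell_dead g y K t : K <= y -> ~~ mono g y K -> ~~ mono g (y.+1 - K) K ->
  DT K.*2 <= t -> mode_of (evolve g t y) = Dead.
Proof.
move=> Ky my my' Kt.
have ex : exists i, left_end g (y - i) && (i < K).
  apply: contrapT => H; move/monoP: my'; apply=> i iK.
  have C j : j < K -> color (g (y - j)) = color (g y).
    elim: j => [|j IH] jK; first by rewrite subn0.
    rewrite -IH 1?ltnW // subnS; apply/eqP/negPn/negP => ne; apply: H.
    by exists j; rewrite /left_end ne /= ltnW.
  rewrite (_ : y.+1 - K + i = y - (K.-1 - i)) 1?C; try lia.
  by rewrite (_ : y.+1 - K = y - K.-1) 1?C; lia.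
case: (ex_minnP ex) => i /andP[il iK] mi.
have C j : j <= i -> color (g (y - j)) = color (g y).
  elim: j => [|j IH] ji; first by rewrite subn0.
  rewrite -IH 1?ltnW // subnS; apply/eqP/negPn/negP => ne.
  have := mi j; rewrite /left_end ne /= (ltn_trans ji iK) => /(_ isT).
  by rewrite leqNgt ji.
have nm : ~~ mono g (y - i) K.*2.
  apply/negP => /monoP H; move/monoP: my; apply=> j jK.
  rewrite (_ : y + j = y - i + (i + j)); last by lia.
  rewrite H ?C //; lia.
have [k kK seg] := mono_segment il nm.
rewrite (_ : y = y - i + i); last by lia.
apply: (segment_dead seg); first exact: leq_trans (leq_DT (ltnW kK)) Kt.
rewrite ltnNge; apply/negP => ki; have [_ _ _ /eqP] := seg; apply.
rewrite (_ : y - i + k = y - (i - k)) ?C //; lia.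
Qed.

(** After the start-up phase the left end is running or dead for good, so emission can only stop;
    testing the end of a time interval then covers all of it. *)
Lemma emitting_antitone g z k t t' : segment g z k -> k.*2 <= t -> t <= t' ->
  emitting g t' z -> emitting g t z.
Proof.
move=> seg kt tt; have [k0 zl _ _] := seg; rewrite /emitting zl /=.
have E s : mode_of (evolve g s z) = iter s (segstep k (smarks g z)) (smodes g z) 0.
  by rewrite -(segment_evol _ seg) // addn0.
rewrite !E => H; have nD : iter t (segstep k (smarks g z)) (smodes g z) 0 <> Dead.
  by move=> D; move: H; rewrite (dead0_iter tt D).
by have [] := alive_cases k0 kt nD.
Qed.

Lemma good_emitting g z k j t : segment g z k -> good k j (smodes g z) ->
  k.*2 <= t <= k.*2.-1 - j + 4 ^ k.-1 -> emitting g t z.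
Proof.
move=> seg gV /andP[kt tk]; have [k0 zl _ _] := seg; rewrite /emitting zl /=.
rewrite -[z in evolve g t z]addn0 (segment_evol _ seg) //.
have [|] // := alive_cases k0 kt (t := t) (V := smodes g z) (mk := smarks g z) _.
by apply: good_alive gV _; lia.
Qed.

(* The timer goes from cell [a] to cell [k.-1], one cell per machine step. *)
Definition event (x a k : nat) : bool := sp (arun x a (k.-1 - a)).1.

Definition marked (mk : nat -> bool) (x a : nat) : Prop :=
  [/\ x < a, mk x, mk a & forall i, i < a -> i != x -> ~~ mk i].

Definition busy (k : nat) : nat := k.*2 + k.+1 * k.*2.

Lemma good_signal g z k j x a t : rx != ra -> segment g z k -> good k j (smodes g z) ->
  marked (smarks g z) x a -> a < k -> emitting g t z ->
  let T := k.*2.-1 - j + (k - a).+1 * k.*2 in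
  T <= t -> signal (mode_of (evolve g t z)) = event x a k && (x.*2.+2 %| t - T).
Proof.
move=> rxa seg gV [xa mx ma mN] ak em T Tt.
have E : mode_of (evolve g t z) = iter t (segstep k (smarks g z)) (smodes g z) 0.
  by rewrite -(segment_evol _ seg) ?addn0 //; case: seg.
have := good_emits gV (t := t) (x := x) (a := a) (mk := smarks g z).
rewrite xa ak => /(_ isT rxa mx ma mN Tt) <-; last first.
  by move=> D; move: em; rewrite /emitting E D andbF.
by rewrite /emits E.
Qed.

Definition shows (g : nat -> letter) t o (u : seq bool) : Prop :=
  forall i, i < size u -> data (evolve g t (o + i)) = nth false u i.

Definition pattern (x a k : nat) (u : seq bool) : Prop :=
  exists phi, forall i, i < size u -> nth false u i = event x a k && (x.*2.+2 %| phi + i).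

(** * Tracing an observed word back to its source *)

Section Observation.
Variables (g : nat -> letter) (t o : nat) (u : seq bool) (K0 K2 Z L : nat).
Hypotheses (rxa : rx != ra) (u0 : 0 < size u) (Zt : Z < t) (nZ : size u <= Z).
Hypotheses (tK0 : DT K0 <= t.-1 - Z) (tK2 : busy K2 <= t.-1 - Z).

(* Time at which a symbol emitted in cell [z] must leave to reach cell [o] at time [t]. *)
Definition emission z := t.-1 - (z - o).

(** The letters of [u] leave [z] at consecutive times; a segment dying among these would leave the
    rest of the word to a farther source. *)
Definition transitional z := emitting g (emission z) z &&
  ~~ emitting g (emission z + (size u).-1) z.

Definition nice z := [/\ o + size u <= z, ~~ transitional z &
  exists k j x a, [/\ segment g z k, k <= K2, good k j (smodes g z),
    marked (smarks g z) x a & a < minn L k]].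

Lemma first_emitter z : (forall y, o <= y < z -> forall i, i < size u -> o + i <= y ->
    ~~ emitting g (emission y + i) y) ->
  z < o + Z -> nice z -> (exists2 i, i < size u & emitting g (emission z + i) z) ->
  exists k x a j, [/\ segment g z k, a < minn L k, x < a &
    let T := k.*2.-1 - j + (k - a).+1 * k.*2 in
    T <= emission z /\ forall i, i < size u ->
    data (evolve g t (o + i)) = event x a k && (x.*2.+2 %| emission z - T + i)].
Proof.
move=> before zZ [uz ntr [k [j [x [a [seg kK2 gV mkd aLk]]]]]] [i0 i0u em0].
exists k, x, a, j; split=> // [|T]; first by case: mkd.
have kk : busy k <= busy K2 by rewrite /busy leq_add ?leq_mul ?leq_double.
have Tk : T <= busy k by rewrite /T /busy leq_add ?leq_mul //; lia.
have eZ : t.-1 - Z <= emission z by rewrite /emission; lia.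
have Te : T <= emission z by lia.
split=> // i iu.
have k2e : k.*2 <= emission z by move: kk; rewrite {1}/busy; lia.
have em : emitting g (emission z + i) z.
  have e0 : emitting g (emission z) z by apply: (emitting_antitone seg) em0 => //; lia.
  have : emitting g (emission z + (size u).-1) z.
    by apply: contraNT ntr => ne; rewrite /transitional e0.
  by apply: (emitting_antitone seg) => //; lia.
have ei : emission z + i = t.-1 - (z - (o + i)) by rewrite /emission; lia.
rewrite (@data_trace g t (o + i) (z - (o + i))).
- rewrite subnKC; last by lia.
  rewrite -ei (good_signal rxa seg gV mkd _ em); [|by lia|by lia].
  by congr (_ && (_ %| _)); rewrite -/T; lia.
- by lia.
- move=> m mz; have := before (o + i + m) _ i iu _.
  rewrite (_ : emission _ + i = t.-1 - m); last by rewrite /emission; lia.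
  by apply; lia.
- by rewrite -ei subnKC //; lia.
Qed.

(** Take the leftmost cell from which some letter could come. No nearer cell interferes, and not
    being transitional it emits throughout, so the whole word comes from it. The cell [z0] ensures
    that it exists within the searched range. *)
Lemma observed_pattern z0 : (forall i, i < size u -> emitting g (emission z0 + i) z0) ->
  o + size u <= z0 < o + Z ->
  (forall z, o <= z < o + Z -> (exists2 i, i < size u & emitting g (emission z + i) z) ->
    mono g z K0 -> nice z) ->
  shows g t o u -> exists k x a, [/\ K0 <= k, x < a, a < L, a < k & pattern x a k u].
Proof.
move=> em0 /andP[z0n z0Z] Hnice sh.
pose E z := (o <= z) && has (fun i => (o + i <= z) && emitting g (emission z + i) z) (iota 0 (size u)).
have ex : exists z, E z.
  exists z0; apply/andP; split; first by lia.
  by apply/hasP; exists 0; rewrite ?mem_iota //= em0 // andbT; lia.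
case: (ex_minnP ex) => z /andP[oz /hasP[i]]; rewrite mem_iota => /andP[_ iu] /andP[oiz ei] mz.
have zz0 : z <= z0.
  apply: mz; apply/andP; split; first by lia.
  by apply/hasP; exists 0; rewrite ?mem_iota //= em0 // andbT; lia.
have zl : left_end g z by case/andP: ei.
have zm : mono g z K0.
  apply: contraTT ei => nm; apply: short_dead zl nm _.
  by rewrite (leq_trans tK0) // /emission; lia.
have nz : nice z by apply: Hnice => //; [rewrite oz /=; lia | exists i].
have [|||k [x [a [j [seg aLk xa [Te dat]]]]]] := first_emitter _ _ nz _.
- move=> y /andP[oy yz] i' i'u oi'; apply/negP => ey.
  have : z <= y; last by lia.
  by apply: mz; rewrite /E oy; apply/hasP; exists i'; rewrite ?mem_iota ?oi'.
- by lia.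
- by exists i.
exists k, x, a; split=> //; try by move: aLk; rewrite leq_min => /andP[].
  by rewrite -(segment_mono _ seg).
by exists (emission z - (k.*2.-1 - j + (k - a).+1 * k.*2)) => i' i'u; rewrite -sh // dat.
Qed.
End Observation.

(** Only a [Start] arriving from the left revives a dead cell; the color change at [o] keeps it out,
    and inside the block every left neighbour is dead. *)
Lemma dead_block g o n t i : left_end g o -> (forall i, i < n -> mode_of (g (o + i)) = Dead) ->
  i < n -> mode_of (evolve g t (o + i)) = Dead.
Proof.
move=> ol gD; elim: t i => [|t IH] i iN; first exact: gD.
have -> : mode_of (evolve g t.+1 (o + i)) = next_mode
    (if color (g (o + i).-1) == color (g (o + i))
     then Some (mark (g (o + i).-1), mode_of (evolve g t (o + i).-1)) else None)
    (mark (g (o + i))) (mode_of (evolve g t (o + i)))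
    (if color (g (o + i).+1) == color (g (o + i))
     then Some (mark (g (o + i).+1), mode_of (evolve g t (o + i).+1)) else None).
  by rewrite iterS {1}/step /step3 [LHS]/= !colorE !markE.
rewrite IH //; case: i iN => [|i] iN; first by rewrite addn0 (negbTE ol).
by rewrite addnS /= IH ?(ltnW iN) //; case: eqP.
Qed.

Lemma planted_pattern g t o (u : seq bool) K z k x a : rx != ra ->
  0 < size u -> left_end g o -> (forall i, i < size u -> mode_of (g (o + i)) = Dead) ->
  o + size u < z -> z - o < t ->
  (forall y, o + size u <= y -> y + K < z -> ~~ mono g y K) ->
  segment g z k -> mode_of (g z) = Start -> marked (smarks g z) x a -> a < k ->
  DT K.+1 <= t.-1 - (z - o) -> busy k <= t.-1 - (z - o) ->
  t.-1 - (z - o) + size u <= 4 ^ k.-1 ->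
  shows g t o [seq event x a k && (x.*2.+2 %| t.-1 - (z - o) - (k.*2.-1 + (k - a).+1 * k.*2) + i)
    | i <- iota 0 (size u)].
Proof.
move=> rxa u0 ol oD oz zt noK seg zS mkd ak tK tk tlife i.
rewrite size_map size_iota => iu; rewrite (nth_map 0) ?size_iota // nth_iota // add0n.
have k0 : 0 < k by case: seg.
have gV : good k 0 (smodes g z) by split=> //; rewrite /smodes addn0.
set e := t.-1 - (z - o) in tK tk tlife *.
have k2e : k.*2 <= e by move: tk; rewrite /busy; lia.
have em : emitting g (e + i) z by apply: (good_emitting seg gV); rewrite subn0; lia.
have Te : k.*2.-1 - 0 + (k - a).+1 * k.*2 <= e.
  by apply: leq_trans tk; rewrite /busy leq_add ?leq_mul //; lia.
rewrite (@data_trace g t (o + i) (z - (o + i))).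
- have -> : t.-1 - (z - (o + i)) = e + i by rewrite /e; lia.
  rewrite subnKC; last by lia.
  rewrite (good_signal rxa seg gV mkd ak em); last by lia.
  by rewrite subn0; congr (_ && (_ %| _)); move: Te; rewrite subn0; lia.
- by lia.
- move=> m mz; have [mn|mn] := ltnP (i + m) (size u).
    by rewrite /emitting -addnA (dead_block _ ol oD) ?andbF.
  case: (boolP (left_end g (o + i + m))) => [yl|/negbTE yl]; last by rewrite /emitting yl.
  (* A block of one color starting here cannot cross the left end [z]. The hypothesis [noK] does not
     cover the cell just before [z], which may lengthen a block by one: hence [K.+1]. *)
  apply: short_dead yl _ (leq_trans tK _); last by rewrite /e; lia.
  apply/negP => /monoP ym.
  have yz : o + i + m + K.+1 <= z.
    rewrite leqNgt; apply/negP => H; have [_ zl _ _] := seg; move: zl.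
    rewrite /left_end.
    have E j : o + i + m <= j -> j <= z -> color (g j) = color (g (o + i + m)).
      by move=> h1 h2; rewrite -(subnKC h1) ym //; lia.
    by rewrite !E ?eqxx //; lia.
  have /negP := noK (o + i + m) ltac:(lia) ltac:(lia); apply.
  by apply/monoP => j jK; apply: ym; apply: ltnW.
- have -> : t.-1 - (z - (o + i)) = e + i by rewrite /e; lia.
  by rewrite subnKC //; lia.
Qed.
End Automaton.

(** * Finite product probabilities *)

Import Order.TTheory GRing.Theory Num.Theory.
Local Open Scope ring_scope.

Section Expectation.
Variables (R : realType) (Q : finType) (p : Q -> R).
Hypotheses (p0 : forall q, 0 < p q) (p1 : \sum_q p q = 1).
Implicit Types (f h : seq Q -> R) (E : seq Q -> bool).

(** Expectation over words with independent letters. By the light cone such finite sums suffice, and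
    measures enter only in the transfer [mu_preimage]. *)
Fixpoint Ex (m : nat) f : R :=
  if m is m'.+1 then \sum_q p q * Ex m' (fun v => f (q :: v)) else f [::].

Definition Pr (m : nat) (E : seq Q -> bool) : R := Ex m (fun v => (E v)%:R).

Lemma Ex_le m f h : (forall v, size v = m -> f v <= h v) -> Ex m f <= Ex m h.
Proof.
elim: m f h => [|m IH] f h fh /=; first exact: fh.
apply: ler_sum => q _; rewrite ler_pM2l //; apply: IH => v sv; apply: fh.
by rewrite /= sv.
Qed.

Lemma Ex_ext m f h : (forall v, size v = m -> f v = h v) -> Ex m f = Ex m h.
Proof. by move=> fh; apply/le_anti/andP; split; apply: Ex_le => v /fh ->. Qed.

Lemma Ex_const m c : Ex m (fun=> c) = c.
Proof. by elim: m => //= m ->; rewrite -mulr_suml p1 mul1r. Qed.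

Lemma Ex_ge0 m f : (forall v, 0 <= f v) -> 0 <= Ex m f.
Proof. by move=> f0; rewrite -[0](Ex_const m); apply: Ex_le. Qed.

Lemma ExZ m c f : Ex m (fun v => c * f v) = c * Ex m f.
Proof.
elim: m f => //= m IH f; rewrite mulr_sumr; apply: eq_bigr => q _.
by rewrite IH mulrCA.
Qed.

Lemma ExD m f h : Ex m (fun v => f v + h v) = Ex m f + Ex m h.
Proof.
elim: m f h => //= m IH f h; rewrite -big_split /=; apply: eq_bigr => q _.
by rewrite IH mulrDr.
Qed.

Lemma Ex_sum m (I : Type) (r : seq I) (P : pred I) (F : I -> seq Q -> R) :
  Ex m (fun v => \sum_(i <- r | P i) F i v) = \sum_(i <- r | P i) Ex m (F i).
Proof.
elim: r => [|i r IH]; first by rewrite big_nil -[RHS](Ex_const m); apply: Ex_ext => v _; rewrite big_nil.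
rewrite big_cons -IH; case: ifP => Pi; last by apply: Ex_ext => v _; rewrite big_cons Pi.
by rewrite -ExD; apply: Ex_ext => v _; rewrite big_cons Pi.
Qed.

Lemma Ex_add m n f : Ex (m + n) f = Ex m (fun v => Ex n (fun w => f (v ++ w))).
Proof. by elim: m f => //= m IH f; apply: eq_bigr => q _; rewrite IH. Qed.

Lemma Ex_indep m n f h :
  Ex (m + n) (fun v => f (take m v) * h (drop m v)) = Ex m f * Ex n h.
Proof.
rewrite Ex_add mulrC -ExZ; apply: Ex_ext => v sv; rewrite mulrC -ExZ; apply: Ex_ext => w _.
by rewrite take_size_cat // drop_size_cat.
Qed.

Lemma Ex_window N z l f : (z + l <= N)%N ->
  Ex N (fun v => f (take l (drop z v))) = Ex l f.
Proof.
move=> zl; rewrite (_ : N = z + (l + (N - z - l)))%N; last by lia.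
rewrite Ex_add -[RHS](Ex_const z); apply: Ex_ext => v sv.
rewrite Ex_add; apply: Ex_ext => w sw; rewrite -[RHS](Ex_const (N - z - l)).
by apply: Ex_ext => w' _; rewrite drop_size_cat // take_size_cat.
Qed.

Lemma Pr_le m E (E' : seq Q -> bool) : (forall v, size v = m -> E v -> E' v) -> Pr m E <= Pr m E'.
Proof.
move=> EE; apply: Ex_le => v sv; rewrite ler_nat; have := EE v sv.
by case: (E v) => // /(_ isT) ->.
Qed.

Lemma Pr_ge0 m E : 0 <= Pr m E. Proof. by apply: Ex_ge0 => v; rewrite ler0n. Qed.

Lemma Pr_window N z l E : (z + l <= N)%N -> Pr N (fun v => E (take l (drop z v))) = Pr l E.
Proof. exact: (@Ex_window N z l (fun v => (E v)%:R)). Qed.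

Lemma Pr_indep m n E (E' : seq Q -> bool) :
  Pr (m + n) (fun v => E (take m v) && E' (drop m v)) = Pr m E * Pr n E'.
Proof.
rewrite -Ex_indep; apply: Ex_ext => v _.
by case: (E _); case: (E' _); rewrite /= ?mulr1 ?mulr0.
Qed.

Lemma Pr_or m E (E' : seq Q -> bool) : Pr m (fun v => E v || E' v) <= Pr m E + Pr m E'.
Proof.
rewrite -ExD; apply: Ex_le => v _.
by case: (E v); case: (E' v); rewrite /= ?addr0 ?add0r ?lexx // lerDl ler01.
Qed.

Lemma Pr_has m (I : Type) (r : seq I) (E : I -> seq Q -> bool) :
  Pr m (fun v => has (fun i => E i v) r) <= \sum_(i <- r) Pr m (E i).
Proof.
elim: r => [|i r IH]; first by rewrite big_nil /Pr Ex_const.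
by rewrite big_cons /=; apply: le_trans (Pr_or _ _ _) _; rewrite lerD2l.
Qed.

Lemma Pr_neg m E : Pr m (fun v => ~~ E v) = 1 - Pr m E.
Proof.
apply/eqP; rewrite eq_sym subr_eq -ExD -[X in X == _](Ex_const m); apply/eqP.
by apply: Ex_ext => v _; case: (E v); rewrite /= ?addr0 ?add0r.
Qed.

Definition weight (P : pred Q) : R := \sum_(q | P q) p q.

Lemma weight_ge0 P : 0 <= weight P.
Proof. by apply: sumr_ge0 => q _; apply: ltW. Qed.

Lemma weight_gt0 (P : pred Q) q : P q -> 0 < weight P.
Proof.
move=> Pq; rewrite /weight (bigD1 q) //=; apply: ltr_pwDl => //.
by apply: sumr_ge0 => i _; apply: ltW.
Qed.

Lemma weight_lt (P P' : pred Q) q : (forall x, P x -> P' x) -> P' q -> ~~ P q ->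
  weight P < weight P'.
Proof.
move=> PP P'q nPq; rewrite [ltRHS](bigID P) /= [X in _ + X](bigD1 q) /=; last by rewrite P'q.
rewrite (eq_bigl P); last by move=> x; case Px: (P x); rewrite ?andbF // (PP _ Px).
rewrite ltrDl; apply: ltr_pwDl => //; by apply: sumr_ge0 => i _; apply: ltW.
Qed.

Fixpoint matches (Ps : seq (pred Q)) (v : seq Q) : bool :=
  match Ps, v with
  | P :: Ps', q :: v' => P q && matches Ps' v'
  | [::], [::] => true
  | _, _ => false
  end.

Lemma Pr_matches Ps : Pr (size Ps) (matches Ps) = \prod_(P <- Ps) weight P.
Proof.
elim: Ps => [|P Ps IH]; first by rewrite big_nil.
rewrite big_cons -IH /weight mulr_suml [RHS]big_mkcond /=; apply: eq_bigr => q _.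
case: (P q) => //=; rewrite -[RHS](mulr0 (p q)); congr (_ * _).
by rewrite -[RHS](Ex_const (size Ps)).
Qed.

Lemma matches_cat Ps Ps' v : matches (Ps ++ Ps') v =
  matches Ps (take (size Ps) v) && matches Ps' (drop (size Ps) v).
Proof.
elim: Ps v => [|P Ps IH] v /=; first by rewrite take0 drop0.
by case: v => //= q v; rewrite IH andbA.
Qed.

Lemma matches_nseq P m v : size v = m -> matches (nseq m P) v = all P v.
Proof. by elim: m v => [|m IH] [|q v] //= [/IH ->]. Qed.

Lemma matches_nth Ps v q0 P0 i : matches Ps v -> (i < size Ps)%N -> nth P0 Ps i (nth q0 v i).
Proof. by elim: Ps v i => [|P Ps IH] [|q v] [|i] //= /andP[Pq /IH H]; [|apply: H]. Qed.

Lemma Pr_all m P : Pr m (all P) = weight P ^+ m.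
Proof.
have := Pr_matches (nseq m P); rewrite size_nseq big_nseq iter_mulr_1 => <-.
by apply: Ex_ext => v sv; rewrite matches_nseq.
Qed.

(* Occurrences of a pattern whose occurrences cannot overlap are mutually exclusive
   renewal events: the first one falls at each position with probability at least
   [Pr l E * q], where [q] is the probability of avoiding the pattern altogether. *)
Lemma Pr_avoid N Z l E : (0 < l)%N -> (Z + l <= N)%N ->
  (forall v z z', (z < z' < z + l)%N -> E (take l (drop z v)) -> ~~ E (take l (drop z' v))) ->
  Pr N (fun v => all (fun z => ~~ E (take l (drop z v))) (iota 0 Z)) * (Z%:R * Pr l E) <= 1.
Proof.
move=> l0 ZN nov.
pose A z v := all (fun z' => ~~ E (take l (drop z' v))) (iota 0 z).
pose F z v := E (take l (drop z v)) && A z v.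
have F1 : \sum_(0 <= z < Z) Pr N (F z) <= 1.
  rewrite -(Ex_sum _ _ _ (fun z v => (F z v)%:R)) -[leRHS](Ex_const N); apply: Ex_le => v _.
  have : (\sum_(0 <= z < Z) (F z v) + A Z v <= 1)%N.
    elim: Z {ZN} => [|Z IH]; first by rewrite big_geq // add0n leq_b1.
    rewrite big_nat_recr //= -addnA; apply: leq_trans IH; rewrite leq_add2l.
    rewrite /F {2}/A -addn1 iotaD all_cat /= andbT -/(A Z v) add0n.
    by case: (E _); case: (A Z v).
  by rewrite -natr_sum -[1%R]/(1%:R) ler_nat; apply: leq_trans; apply: leq_addr.
apply: le_trans F1; rewrite mulrCA -[Z in Z%:R]subn0 mulr_natl -sumr_const_nat.
rewrite big_nat [leRHS]big_nat; apply: ler_sum => z /andP[_ zZ].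
(* [B] avoids only the occurrences that end by position [z], so it is independent of the window at
   [z]; the overlapping ones are excluded by the occurrence at [z] itself. *)
pose B w := all (fun z' => ~~ E (take l (drop z' w))) (iota 0 (z.+1 - l)).
have winE z' v : (z' < z.+1 - l)%N -> take l (drop z' (take z v)) = take l (drop z' v).
  by move=> z'z; rewrite take_drop take_takel -?take_drop //; lia.
apply: (@le_trans _ _ (Pr z B * Pr l E)).
  rewrite ler_wpM2r ?Pr_ge0 // (_ : Pr z B = Pr N (fun v => B (take z v))).
    apply: Pr_le => v sv /allP H; apply/allP => z'; rewrite mem_iota => /andP[_ z'z].
    by rewrite winE //; apply: H; rewrite mem_iota; lia.
  have := @Pr_window N 0 z B; rewrite add0n => <-; last by lia.
  by apply: Ex_ext => v _; rewrite drop0.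
have -> : Pr z B * Pr l E = Pr N (fun v => B (take z v) && E (take l (drop z v))).
  rewrite [in RHS](_ : N = z + (N - z))%N; last by lia.
  rewrite (@Pr_indep z (N - z) B (fun v => E (take l v))); congr (_ * _).
  have := @Pr_window (N - z) 0 l E; rewrite add0n => <-; last by lia.
  by apply: Ex_ext => v _; rewrite drop0.
apply: Pr_le => v sv /andP[/allP H Ez]; rewrite /F Ez; apply/allP => z'.
rewrite mem_iota => /andP[_ z'z]; case: (ltnP z (z' + l)) => zl.
  by apply/negP => /(nov v z' z); rewrite Ez z'z zl => /(_ isT).
by rewrite -(winE _ z' v); [apply: H; rewrite mem_iota|]; lia.
Qed.
End Expectation.

(** * Random configurations of the automaton *)

Lemma count_span (P : nat -> bool) m Z :
  (forall s s', P s -> (s + m <= s')%N -> ~~ P s') -> (count P (iota 0 Z) <= m)%N.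
Proof.
move=> HP; have [[s Ps]|nP] := pselect (exists s, P s); last first.
  rewrite (eq_count (a2 := pred0)) ?count_pred0 // => s; apply/negbTE/negP => Ps.
  by apply: nP; exists s.
have ex : exists s, P s by exists s.
case: (ex_minnP ex) => s0 Ps0 ms0.
have H : (count (fun s => s0 <= s < s0 + m) (iota 0 Z) <= m)%N.
  elim: Z => // Z IH; rewrite -addn1 iotaD count_cat /= addn0 add0n.
  have [Zs|sZ] := leqP (s0 + m) Z; first by rewrite andbF addn0.
  suff : (count (fun s => s0 <= s < s0 + m) (iota 0 Z) <= Z - s0)%N by lia.
  elim: Z {IH sZ} => // Z IH; rewrite -addn1 iotaD count_cat /= addn0 add0n; lia.
apply: leq_trans H; apply: sub_count => s' Ps' /=; rewrite ms0 //= ltnNge.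
by apply/negP => /(HP _ _ Ps0); rewrite Ps'.
Qed.

Section Letters.
Variables (st reg : finType) (ins : st -> bool * bool * reg * st * st).
Variables (st0 : st) (sp : pred st) (rx ra : reg).
Hypothesis rxa : rx != ra.
Variables (R : realType) (p : letter st reg -> R).
Hypotheses (p0 : forall q, 0 < p q) (p1 : \sum_q p q = 1).

Local Notation letter := (letter st reg).
Local Notation Pr := (Pr p).
Local Notation weight := (weight p).
Local Notation step := (step ins st0 sp rx ra).
Local Notation evolve g t := (iter t step g).
Local Notation shows := (shows ins st0 sp rx ra).
Local Notation pattern := (pattern ins st0 sp rx ra).

Definition blank : letter := (false, false, Dead st reg, false).
Definition cfg (v : seq letter) : nat -> letter := nth blank v.

Definition isColor (c : bool) : pred letter := fun q => color q == c.
Definition W (c : bool) : R := weight (isColor c).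
(** The frequent color depends on the measure, which the automaton does not know; its rule treats
    both colors alike. *)
Definition cmax : bool := W false <= W true.
Definition P : R := W cmax.

Lemma W_sum : W true + W false = 1.
Proof.
rewrite -p1 [RHS](bigID (isColor true)) /=; congr (_ + _); apply: eq_bigl => q.
by rewrite /isColor; case: (color q).
Qed.

Lemma W_le c : W c <= P.
Proof. by rewrite /P /cmax; case: (leP (W false) (W true)) => h; case: c; rewrite ?lexx // ltW. Qed.

(** This makes (4P)^k at least 2^k, which absorbs every constant. *)
Lemma P_half : 2^-1 <= P.
Proof. by have := W_sum; have := W_le true; have := W_le false; lra. Qed.

Lemma W_gt0 c : 0 < W c.
Proof. by apply: (weight_gt0 p0 (q := (c, false, Dead st reg, false))); rewrite /isColor eqxx. Qed.

Lemma P_gt0 : 0 < P. Proof. exact: W_gt0. Qed.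

Lemma P_lt1 : P < 1.
Proof. by have := W_sum; rewrite /P; have := W_gt0 (~~ cmax); case: cmax => /=; lra. Qed.

Definition block c (D : pred letter) a l (w : seq letter) : bool :=
  all (isColor c) w && all D (take l (drop a w)).

Lemma block_le c D a l K rho : (a + l <= K)%N ->
  weight (fun q => isColor c q && D q) <= rho -> Pr K (block c D a l) <= rho ^+ l * P ^+ (K - l).
Proof.
move=> aK Wr; pose D' q := isColor c q && D q.
pose Ps := nseq a (isColor c) ++ nseq l (D' : pred letter) ++ nseq (K - a - l) (isColor c).
have sP : size Ps = K by rewrite !size_cat !size_nseq; lia.
apply: (@le_trans _ _ (Pr (size Ps) (matches Ps))).
  rewrite sP; apply: Pr_le => // v sv /andP[ac ad].
  have s1 : size (take a v) = a by rewrite size_take sv; case: ltnP; lia.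
  have s2 : size (take l (drop a v)) = l by rewrite size_take size_drop sv; case: ltnP; lia.
  have s3 : size (drop l (drop a v)) = (K - a - l)%N by rewrite !size_drop sv; lia.
  rewrite !matches_cat !size_nseq !matches_nseq //.
  apply/and3P; split.
  - by apply/allP => q /mem_take; apply: (allP ac).
  - by apply/allP => q qi; rewrite /D' (allP ac) ?(allP ad) //; apply: mem_drop (mem_take qi).
  - by apply/allP => q /mem_drop/mem_drop; apply: (allP ac).
rewrite Pr_matches // !big_cat !big_nseq !iter_mulr_1 /=.
have Wc := W_le c; have Wc0 := W_gt0 c; have w0 := weight_ge0 p0 D'.
rewrite mulrCA; apply: ler_pM; first exact: exprn_ge0.
- by apply: mulr_ge0; apply: exprn_ge0; apply: ltW.
- by rewrite lerXn2r // nnegrE // (le_trans w0).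
- rewrite -exprD (_ : a + (K - a - l) = K - l)%N; last by lia.
  by rewrite lerXn2r // nnegrE ltW // P_gt0.
Qed.

Definition anyblock D a l w := block true D a l w || block false D a l w.

Lemma anyblock_le D a l K rho N z : (a + l <= K)%N -> (z + K <= N)%N ->
  (forall c, weight (fun q => isColor c q && D q) <= rho) ->
  Pr N (fun v => anyblock D a l (take K (drop z v))) <= 2 * (rho ^+ l * P ^+ (K - l)).
Proof.
move=> aK zK Wr; rewrite (Pr_window p0 p1) //; apply: (le_trans (Pr_or p0 _ _ _)).
by rewrite [2]mulr2n mulrDl !mul1r; apply: lerD; apply: block_le.
Qed.

Lemma mono_window v z K : mono (cfg v) z K -> (z + K <= size v)%N ->
  exists c, all (isColor c) (take K (drop z v)).
Proof.
move=> /monoP m zK; exists (color (cfg v z)); apply/(all_nthP blank) => i.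
rewrite size_take size_drop => iz; have iK : (i < K)%N by move: iz; case: (ltnP K); lia.
by rewrite nth_take // nth_drop; apply/eqP/m.
Qed.

Lemma mono_le N z K : (z + K <= N)%N -> Pr N (fun v => mono (cfg v) z K) <= 2 * P ^+ K.
Proof.
move=> zK; have := @anyblock_le predT 0 0 K P N z; rewrite !add0n subn0 expr0 mul1r.
move=> /(_ isT zK) H; apply: le_trans (H _) => [|c]; last first.
  by rewrite (_ : weight _ = W c) ?W_le //; apply: eq_bigl => q; rewrite andbT.
apply: Pr_le => // v sv m; have [|c ac] := mono_window m; first by rewrite sv.
by rewrite /anyblock /block !take0 /= !andbT; case: c ac => ->; rewrite ?orbT.
Qed.

Lemma cell_alive_le N y K t : (0 < K <= y)%N -> (y + K <= N)%N -> (DT K.*2 <= t)%N ->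
  Pr N (fun v => mode_of (evolve (cfg v) t y) != Dead st reg) <= 4 * P ^+ K.
Proof.
move=> /andP[K0 Ky] yN Kt.
apply: (@le_trans _ _ (Pr N (fun v => mono (cfg v) y K || mono (cfg v) (y.+1 - K) K))).
  apply: Pr_le => // v _; apply: contraR; rewrite negb_or => /andP[m1 m2].
  by apply/eqP; apply: cell_dead Kt.
apply: (le_trans (Pr_or p0 _ _ _)).
have -> : 4 * P ^+ K = 2 * P ^+ K + 2 * P ^+ K by ring.
by apply: lerD; apply: mono_le; lia.
Qed.

(** Reads the cells of [w] alone, taken as a whole segment, so that being alive is an event about a
    window and has the same probability at every position. *)
Definition alive (w : seq letter) (t : nat) : bool :=
  isRun (iter t (segstep ins st0 sp rx ra (size w) (fun i => mark (nth blank w i)))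
    (fun i => mode_of (nth blank w i)) 0).

Lemma emitting_alive v z k t : (z + k <= size v)%N -> segment (cfg v) z k ->
  emitting ins st0 sp rx ra (cfg v) t z = alive (take k (drop z v)) t.
Proof.
move=> zk seg; have [k0 zl _ _] := seg; rewrite /emitting zl /= -[z in evolve _ t z]addn0.
rewrite (segment_evol _ _ _ _ _ _ seg) // /alive.
have -> : size (take k (drop z v)) = k by rewrite size_take size_drop; case: ltnP; lia.
have nthE i : (i < k)%N -> nth blank (take k (drop z v)) i = cfg v (z + i).
  by move=> ik; rewrite nth_take // nth_drop.
have E : forall s i, (i < k)%N -> iter s (segstep ins st0 sp rx ra k (smarks (cfg v) z)) (smodes (cfg v) z) i =
  iter s (segstep ins st0 sp rx ra k (fun i => mark (nth blank (take k (drop z v)) i)))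
    (fun i => mode_of (nth blank (take k (drop z v)) i)) i.
  elim=> [|s IH] i ik; first by rewrite /= nthE.
  rewrite !iterS /segstep IH // nthE //; congr next_mode.
    by case: i ik => //= i ik; rewrite IH ?nthE // ltnW.
  by rewrite /rightn; case: ifP => // ik'; rewrite IH ?nthE.
by rewrite E.
Qed.

Lemma alive_antitone w t t' : (0 < size w)%N -> ((size w).*2 <= t)%N -> (t <= t')%N ->
  alive w t' -> alive w t.
Proof.
move=> w0 wt tt; rewrite /alive => H.
set V := iter t _ _; have nD : V 0 <> Dead st reg.
  by move=> D; move: H; rewrite (dead0_iter tt D).
by case: (alive_cases w0 wt nD).
Qed.

Definition calmq : pred letter := fun q => if mode_of q is (Wait | Run _) then true else false.
Definition unmarked : pred letter := fun q => ~~ mark q.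

(** A properly started segment between two cells of the other color. The left one is marked and the
    right one is not, so two occurrences cannot even share a boundary cell, as [Pr_avoid]
    requires. *)
Definition gpat K : seq (pred letter) :=
  [:: (fun q => ~~ isColor cmax q && mark q) : pred letter,
      (fun q => isColor cmax q && (mode_of q == Start st reg)) : pred letter
   & nseq K.-1 (isColor cmax) ++ [:: (fun q => ~~ isColor cmax q && ~~ mark q) : pred letter]].

Definition gconst : R := weight (fun q => ~~ isColor cmax q && mark q) *
  weight (fun q => isColor cmax q && (mode_of q == Start st reg)) *
  weight (fun q => ~~ isColor cmax q && ~~ mark q).

Lemma gconst_gt0 : 0 < gconst.
Proof.
rewrite !mulr_gt0 //.
- by apply: (weight_gt0 p0 (q := (~~ cmax, true, Dead st reg, false))); rewrite /isColor /=; case: cmax.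
- by apply: (weight_gt0 p0 (q := (cmax, true, Start st reg, false))); rewrite /isColor /= !eqxx.
- by apply: (weight_gt0 p0 (q := (~~ cmax, false, Dead st reg, false))); rewrite /isColor /=; case: cmax.
Qed.

Lemma size_gpat K : (0 < K)%N -> size (gpat K) = K.+2.
Proof. by move=> K0; rewrite /= size_cat size_nseq /=; lia. Qed.

Lemma Pr_gpat K : (0 < K)%N -> Pr K.+2 (matches (gpat K)) = gconst * P ^+ K.-1.
Proof.
move=> K0; rewrite -(size_gpat K0) Pr_matches // !big_cons big_cat big_nseq iter_mulr_1 /= big_seq1.
by rewrite /gconst /P /W; ring.
Qed.

Lemma gpat_nth K v y i : (0 < K)%N -> matches (gpat K) (take K.+2 (drop y v)) ->
  (i < K.+2)%N -> nth xpred0 (gpat K) i (cfg v (y + i)).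
Proof.
move=> K0 m iK; have := matches_nth blank xpred0 m (i := i).
by rewrite size_gpat // => /(_ iK); rewrite nth_take // nth_drop.
Qed.

Lemma gpat_mid K i : (0 < i <= K)%N -> forall q, nth xpred0 (gpat K) i q -> isColor cmax q.
Proof.
case: i => //= i iK q; case: i iK => [|i] iK /=; first by case/andP.
rewrite nth_cat size_nseq (_ : i < K.-1)%N; last by lia.
by rewrite nth_nseq (_ : i < K.-1)%N //; lia.
Qed.

Lemma gpat_last K : (0 < K)%N -> forall q, nth xpred0 (gpat K) K.+1 q = ~~ isColor cmax q && ~~ mark q.
Proof. by case: K => // K _ q; rewrite /= nth_cat size_nseq ltnn subnn. Qed.

Lemma gpat_segment K v y : (0 < K)%N -> matches (gpat K) (take K.+2 (drop y v)) ->
  segment (cfg v) y.+1 K /\ good K 0 (smodes (cfg v) y.+1).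
Proof.
move=> K0 m; have H i iK := gpat_nth K0 m (i := i) iK.
have C i : (i < K)%N -> color (cfg v (y.+1 + i)) = cmax.
  move=> iK; have := H i.+1; rewrite addnS -addSn => /(_ ltac:(lia)) h.
  by apply/eqP; apply: gpat_mid h; lia.
have C0 : color (cfg v y.+1) = cmax by have := C 0 K0; rewrite addn0.
split; split=> //.
- have := H 0 isT; rewrite addn0 /= => /andP[nc _]; rewrite /left_end C0; exact: nc.
- by move=> i iK; rewrite C // C0.
- by have := H K.+1 (ltnSn _); rewrite gpat_last // addnS -addSn C0 => /andP[].
- by have := H 1 isT; rewrite /= addn1 /smodes addn0 => /andP[_ /eqP].
Qed.

Lemma gpat_apart K : (0 < K)%N -> forall v z z', (z < z' < z + K.+2)%N ->
  matches (gpat K) (take K.+2 (drop z v)) -> ~~ matches (gpat K) (take K.+2 (drop z' v)).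
Proof.
move=> K0 v z z' /andP[zz' z'K] m; apply/negP => m'.
have := gpat_nth (i := 0) K0 m' isT; rewrite addn0 /= => /andP[nc mk'].
have := gpat_nth (i := z' - z) K0 m ltac:(lia); rewrite subnKC; last by lia.
have [E|ne] := eqVneq (z' - z)%N K.+1; first by rewrite E gpat_last // mk' andbF.
by move=> /gpat_mid; rewrite (negbTE nc); move=> /(_ ltac:(lia)).
Qed.

Definition transit (w : seq letter) e m : bool :=
  [&& all (isColor true) w || all (isColor false) w, alive w e & ~~ alive w (e + m)].

(** By translation, [s] only changes the time at which the same random word is tested. A segment
    dies once, hence while at most [m] of these times are tested: no factor [Z] appears. *)
Lemma transit_le N t Z k m : (0 < k)%N -> (k.*2 <= t.-1 - Z)%N -> (t + Z + k <= N)%N ->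
  \sum_(0 <= s < Z) Pr N (fun v => transit (take k (drop (t + s) v)) (t.-1 - s) m)
    <= m%:R * (2 * P ^+ k).
Proof.
move=> k0 kt tN.
have -> : \sum_(0 <= s < Z) Pr N (fun v => transit (take k (drop (t + s) v)) (t.-1 - s) m) =
    \sum_(0 <= s < Z) Pr k (fun w => transit w (t.-1 - s) m).
  apply: eq_big_nat => s sZ.
  by rewrite (Pr_window p0 p1 (fun w => transit w (t.-1 - s) m)) //; lia.
rewrite -(Ex_sum p0 p1 k _ _ (fun s w => (transit w (t.-1 - s) m)%:R)).
have mono2 : Pr k (fun w => all (isColor true) w || all (isColor false) w) <= 2 * P ^+ k.
  apply: (le_trans (Pr_or p0 _ _ _)); rewrite !Pr_all // [2]mulr2n mulrDl mul1r.
  by apply: lerD; rewrite lerXn2r // ?nnegrE ?W_le // ltW // ?W_gt0 ?P_gt0.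
apply: le_trans (ler_wpM2l (ler0n _ m) mono2); rewrite -ExZ; apply: Ex_le => // w sw.
rewrite /transit; case: (_ || _) => /=; last by rewrite mulr0 big1.
rewrite mulr1 -natr_sum ler_nat.
have := @count_span (fun s => (s < Z)%N && alive w (t.-1 - s) && ~~ alive w (t.-1 - s + m)) m Z.
rewrite -sum1_count big_mkcond /= => H; apply: leq_trans (H _).
  rewrite [iota 0 Z](_ : _ = index_iota 0 Z); last by rewrite /index_iota subn0.
  rewrite [leqLHS]big_nat [leqRHS]big_nat.
  by apply: leq_sum => s /andP[_ sZ]; rewrite sZ; case: (_ && _).
move=> s s' /andP[/andP[sZ a1] a2] ss'; rewrite !negb_and !negbK -orbA.
case: (ltnP s' Z) => //= s'Z; apply/orP; right.
apply: (alive_antitone _ _ _ a1); rewrite ?sw //; lia.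
Qed.

Lemma block_break v z K c D a l : (z + K <= size v)%N -> (a + l <= K)%N ->
  all (isColor c) (take K (drop z v)) -> ~~ anyblock D a l (take K (drop z v)) ->
  exists2 i, (a <= i < a + l)%N & ~~ D (cfg v (z + i)).
Proof.
move=> zK al ac nb; have sK : size (take K (drop z v)) = K.
  by rewrite size_take size_drop; case: (ltnP K); lia.
have : ~~ all D (take l (drop a (take K (drop z v)))).
  by move: nb; rewrite /anyblock /block; case: c ac => ->; case: (all D _); rewrite ?andbT ?orbT.
rewrite -has_predC => /(has_nthP blank)[i]; rewrite size_take size_drop sK => h.
have il : (i < l)%N by move: h; case: (ltnP l); lia.
rewrite nth_take // nth_drop nth_take ?nth_drop; last by lia.
by move=> nD; exists (a + i)%N => //; lia.
Qed.

Lemma marked_exists (mk : nat -> bool) l : (exists2 i, (i < l)%N & mk i) ->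
  (exists2 i, (l <= i < l.*2)%N & mk i) -> exists x a, marked mk x a /\ (a < l.*2)%N.
Proof.
move=> [i1 i1l m1] [i2 i2l m2].
have ex : exists x, mk x by exists i1.
case: (ex_minnP ex) => x mx xmin; have xl : (x < l)%N by apply: leq_ltn_trans (xmin _ m1) _.
have ex2 : exists a, (x < a)%N && mk a by exists i2; rewrite m2 andbT; lia.
case: (ex_minnP ex2) => a /andP[xa ma] amin; exists x, a; split; last first.
  have : (a <= i2)%N by apply: amin; rewrite m2 andbT; lia.
  by lia.
split=> // i ia ne; apply/negP => mi; case: (ltngtP i x) => ix.
- by have := xmin i mi; lia.
- by have := amin i; rewrite ix mi => /(_ isT); lia.
- by rewrite ix eqxx in ne.
Qed.

Lemma sum_iota_le a m (F : nat -> R) c : (forall i, (a <= i < a + m)%N -> F i <= c) ->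
  \sum_(i <- iota a m) F i <= m%:R * c.
Proof.
move=> Fc; rewrite -[X in X%:R](size_iota a) -sum1_size natr_sum mulr_suml !big_seq.
by apply: ler_sum => i; rewrite mem_iota mul1r => /Fc.
Qed.

(** * Union bound for an observed word *)

Section Upper.
Variables (t : nat) (u : seq bool) (K0 K1 K2 l Z N : nat) (rho0 rho1 : R).

Definition showsb (v : seq letter) : bool :=
  all (fun i => data (evolve (cfg v) t (t + i)) == nth false u i) (iota 0 (size u)).

Hypotheses (u0 : (0 < size u)%N) (NE : N = (size u + t.*2)%N).
Hypotheses (Zt : (Z < t)%N) (uZ : ((size u).+1 < Z)%N) (lK0 : (0 < l)%N /\ (l.*2 <= K0)%N).
Hypotheses (K012 : (K0 <= K2)%N) (K20 : (0 < K1)%N).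
Hypotheses (tK0 : (DT K0 <= t.-1 - Z)%N) (tK2 : (busy K2 <= t.-1 - Z)%N).
Hypotheses (tK1 : (K1.*2 <= t.-1 - Z)%N) (tK1' : (t + size u <= 4 ^ K1.-1)%N).
Hypotheses (tN : (Z + K1 + K2 + 3 <= t)%N).
Hypothesis Hpat : forall k x a, (K0 <= k)%N -> (x < a)%N -> (a < l.*2)%N -> (a < k)%N ->
  ~ pattern x a k u.

Definition avoid (v : seq letter) : bool :=
  all (fun z => ~~ matches (gpat K1) (take K1.+2 (drop z (drop (t + size u) v)))) (iota 0 (Z - (size u).+1)).

Definition bad z (v : seq letter) : bool :=
  let w := take K0 (drop z v) in
  mono (cfg v) z K2.+1 || (anyblock calmq 0 K0 w || (anyblock unmarked 0 l w || anyblock unmarked l l w)).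

(** Segments shorter than [K0] are dead, those longer than [K2] are bad, [K1] is the length of a
    sure emitter, and marks are sought in the first 2l cells. Failing [avoid] provides the emitter,
    failing the other events makes every candidate source [nice], and [observed_pattern] then
    contradicts [Hpat]. *)
Lemma showsb_cover v : size v = N -> showsb v ->
  [|| avoid v, has (fun z => bad z v) (iota t Z), has (fun z => mono (cfg v) z K0) (iota t (size u))
    | has (fun k => has (fun s => transit (take k (drop (t + s) v)) (t.-1 - s) (size u).-1)
        (iota 0 Z)) (iota K0 (K2.+1 - K0))].
Proof.
have lK1 : (l <= K0)%N by case: lK0; lia.
have lK2 : (l + l <= K0)%N by rewrite addnn; case: lK0.
have eZ z : (t <= z < t + Z)%N -> (t.-1 - Z <= emission t t z)%N.
  by clear -Zt; rewrite /emission; lia.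
have zN z k : (z < t + Z)%N -> (k <= K2)%N -> (z + k <= N)%N by rewrite NE; lia.
move=> sv sh; apply: contraT => /norP[nA /norP[nB /norP[nM nT]]].
have {nA} [y [y1 y2 my]] : exists y, [/\ (t + size u <= y)%N, (y.+1 < t + Z)%N &
    matches (gpat K1) (take K1.+2 (drop y v))].
  move/allPn: nA => [y]; rewrite mem_iota => /andP[_ yZ]; rewrite negbK drop_drop => m.
  by exists (y + (t + size u))%N; split=> //; lia.
have [seg gd] := gpat_segment K20 my.
have em0 i : (i < size u)%N ->
    emitting ins st0 sp rx ra (cfg v) (emission t t y.+1 + i) y.+1.
  by move=> iu; apply: (good_emitting _ _ _ _ _ seg gd); rewrite /emission subn0; lia.
have Hn : forall z, (t <= z < t + Z)%N ->
    (exists2 i, (i < size u)%N & emitting ins st0 sp rx ra (cfg v) (emission t t z + i) z) ->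
    mono (cfg v) z K0 -> nice ins st0 sp rx ra (cfg v) t t u K2 l.*2 z.
  move=> z /andP[tz zZ] [i iu ei] mz.
  have uz : (t + size u <= z)%N.
    rewrite leqNgt; apply/negP => zu; move/hasPn: nM => /(_ z).
    by rewrite mem_iota tz zu mz => /(_ isT).
  move/hasPn: nB => /(_ z); rewrite mem_iota tz zZ => /(_ isT).
  move=> /norP[nm2 /norP[nc /norP[n1 n2]]].
  have zl : left_end (cfg v) z by case/andP: ei.
  have [k kK2 sg] := mono_segment zl nm2.
  have K0k : (K0 <= k)%N by rewrite -(segment_mono _ sg).
  have k0 : (0 < k)%N by case: sg.
  have [|c ac] := mono_window mz; first by rewrite sv; apply: zN.
  have zK0 : (z + K0 <= size v)%N by rewrite sv; apply: zN.
  have {nc} [i' iK ncal] := block_break zK0 (leqnn (0 + K0)%N : (0 + K0 <= K0)%N) ac nc.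
  have {n1} [i1 i1l m1] := block_break zK0 (lK1 : (0 + l <= K0)%N) ac n1.
  have {n2} [i2 i2l m2] := block_break zK0 lK2 ac n2.
  have busyk : (busy k <= busy K2)%N by rewrite /busy leq_add ?leq_mul ?leq_double //; lia.
  have k2 : (k.*2 <= emission t t z)%N.
    apply: leq_trans (leq_addr _ _) (leq_trans busyk (leq_trans tK2 (eZ _ _))).
    by rewrite tz.
  have kN : (z + k <= size v)%N by rewrite sv; apply: zN.
  have [j gj] : exists j, good k j (smodes (cfg v) z).
    have nD : iter (emission t t z + i) (segstep ins st0 sp rx ra k (smarks (cfg v) z)) (smodes (cfg v) z) 0 <> Dead st reg.
      rewrite -(segment_evol _ _ _ _ _ _ sg) // addn0 => D.
      by move: ei; rewrite /emitting D andbF.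
    have [|_ [//|[j [jk jW jR]]]] := alive_cases k0 _ nD; first by rewrite (leq_trans k2) ?leq_addr.
    move: ncal; rewrite /calmq; case: (ltnP i' j) => ij; first by rewrite (jW i' ij : mode_of _ = _).
    have : isRun (mode_of (cfg v (z + i'))) by apply: jR; rewrite ij (leq_trans _ K0k) //; case/andP: iK.
    by case: (mode_of _).
  have [x [a [mxa al]]] : exists x a, marked (smarks (cfg v) z) x a /\ (a < l.*2)%N.
    by apply: marked_exists; [exists i1 => //; apply/negPn | exists i2; rewrite -?addnn //; apply/negPn].
  split=> //.
  - apply/negP => /andP[e1 e2]; have kin : k \in iota K0 (K2.+1 - K0) by rewrite mem_iota K0k; clear -kK2 K012; lia.
    have zin : (z - t)%N \in iota 0 Z by rewrite mem_iota; clear -tz zZ; lia.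
    move/hasPn: nT => /(_ k kin)/hasPn /(_ _ zin).
    rewrite (subnKC tz).
    rewrite /transit -!emitting_alive // e1 e2 andbT.
    have [|c' ac'] := @mono_window v z k _ kN; first by rewrite (segment_mono _ sg).
    by case: c' ac' => ->; rewrite ?orbT.
  - exists k, j, x, a; split=> //; rewrite leq_min al; apply: leq_trans al (leq_trans _ K0k).
    by case: lK0.
have sh' : shows (cfg v) t t u.
  by move=> i iu; apply/eqP; apply: (allP sh); rewrite mem_iota.
have [||||||k [x [a [K0k xa al ak pat]]]] := observed_pattern rxa _ _ _ _ _ em0 _ Hn sh'; try lia.
by case: (Hpat K0k xa al ak pat).
Qed.

Lemma avoid_le : Pr N avoid * ((Z - (size u).+1)%:R * (gconst * P ^+ K1.-1)) <= 1.
Proof.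
rewrite -Pr_gpat //; set M := (N - (t + size u))%N.
have -> : Pr N avoid = Pr M (fun v => all (fun z => ~~ matches (gpat K1) (take K1.+2 (drop z v)))
    (iota 0 (Z - (size u).+1))).
  have le1 : (t + size u + M <= N)%N by rewrite /M NE; clear; lia.
  rewrite -(Pr_window p0 p1 _ le1).
  apply: Ex_ext => // v sv; rewrite /avoid (@take_oversize _ M) //.
  by rewrite size_drop sv.
apply: Pr_avoid => //; last exact: gpat_apart.
rewrite /M NE; clear -tN; lia.
Qed.

Hypothesis Hrho0 : forall c, weight (fun q => isColor c q && calmq q) <= rho0.
Hypothesis Hrho1 : forall c, weight (fun q => isColor c q && unmarked q) <= rho1.

Lemma upper_bound : Pr N showsb <= Pr N avoid
  + Z%:R * (2 * P ^+ K2.+1 + 2 * rho0 ^+ K0 + 4 * (rho1 ^+ l * P ^+ (K0 - l)))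
  + (size u)%:R * (2 * P ^+ K0) + (K2.+1 - K0)%:R * ((size u)%:R * (2 * P ^+ K0)).
Proof.
have lK1 : (l <= K0)%N by case: lK0; clear; lia.
have lK2 : (l + l <= K0)%N by rewrite addnn; case: lK0.
have zN z k : (z < t + Z)%N -> (k <= K2.+1)%N -> (z + k <= N)%N.
  by rewrite NE; clear -tN; lia.
have Pk k : (K0 <= k)%N -> P ^+ k <= P ^+ K0.
  by move=> K0k; apply: ler_wiXn2l => //; apply: ltW; [exact: P_gt0|exact: P_lt1].
apply: (le_trans (Pr_le p0 showsb_cover)); rewrite -!addrA.
apply: (le_trans (Pr_or p0 _ _ _)); rewrite lerD2l.
apply: (le_trans (Pr_or p0 _ _ _)); apply: lerD.
  apply: (le_trans (Pr_has p0 p1 _ _ _)).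
  apply: sum_iota_le => z /andP[tz zZ].
  have B (D : pred letter) a' l' rho : (a' + l' <= K0)%N ->
      (forall c, weight (fun q => isColor c q && D q) <= rho) ->
      Pr N (fun v => anyblock D a' l' (take K0 (drop z v))) <= 2 * (rho ^+ l' * P ^+ (K0 - l')).
    by move=> al; apply: anyblock_le => //; apply: zN => //; apply: leqW.
  apply: (le_trans (Pr_or p0 _ _ _)); apply: lerD.
    by apply: mono_le; apply: zN.
  apply: (le_trans (Pr_or p0 _ _ _)); apply: lerD.
    by apply: (le_trans (B _ _ _ _ _ Hrho0)); rewrite ?add0n // subnn expr0 mulr1.
  apply: (le_trans (Pr_or p0 _ _ _)).
  have -> : 4 * (rho1 ^+ l * P ^+ (K0 - l)) =
    2 * (rho1 ^+ l * P ^+ (K0 - l)) + 2 * (rho1 ^+ l * P ^+ (K0 - l)) by ring.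
  by apply: lerD; apply: (B _ _ _ _ _ Hrho1).
apply: (le_trans (Pr_or p0 _ _ _)); apply: lerD.
  apply: (le_trans (Pr_has p0 p1 _ _ _)); apply: sum_iota_le => z /andP[tz zu].
  apply: mono_le; apply: zN; last exact: leqW.
  by clear -uZ zu; lia.
apply: (le_trans (Pr_has p0 p1 _ _ _)); apply: sum_iota_le => k /andP[K0k kK2].
have k0 : (0 < k)%N by apply: leq_trans K0k; case: lK0; clear; lia.
have kK2' : (k <= K2)%N by clear -kK2 K012 K0k; lia.
apply: (le_trans (Pr_has p0 p1 _ _ _)).
rewrite [iota 0 Z](_ : _ = index_iota 0 Z); last by rewrite /index_iota subn0.
apply: (le_trans (transit_le _ k0 _ _)).
- apply: leq_trans tK2; rewrite /busy; apply: leq_trans (leq_addr _ _).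
  by rewrite leq_double.
- by rewrite NE; clear -tN kK2'; lia.
- apply: ler_pM.
  + exact: ler0n.
  + by apply: mulr_ge0; rewrite ?ler0n // exprn_ge0 // ltW // P_gt0.
  + by rewrite ler_nat leq_pred.
  + by rewrite ler_pM2l // Pk.
Qed.
End Upper.
End Letters.

Import numFieldNormedType.Exports.

(** * Asymptotic densities *)

Lemma small_pow (R : realType) (x e : R) : 0 <= x < 1 -> 0 < e ->
  exists N, forall n, (N <= n)%N -> x ^+ n <= e.
Proof.
move=> /andP[x0 x1] e0.
have x1' : `|x| < 1 by rewrite ger0_norm.
have /cvgrPdist_le/(_ e e0)[N _ HN] := cvg_expr x1'.
exists N => n Nn; have := HN n Nn.
by rewrite sub0r normrN ger0_norm // exprn_ge0.
Qed.

Lemma nat_bound (R : realType) (x : R) : exists N, x <= N%:R.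
Proof.
exists (Num.truncn x).+1; case: (lerP 0 x) => x0; last by rewrite (le_trans (ltW x0)).
by apply: ltW; rewrite truncnS_gt.
Qed.

Lemma four_leq_exp k : (4 <= k -> 4 * k <= 2 ^ k)%N.
Proof. by elim: k => // k IH; rewrite leq_eqVlt => /predU1P[<-//|k4]; rewrite expnS; have := IH k4; lia. Qed.

(** Start-up and computation take quadratic time, so even segments longer by a constant have
    finished computing when those of length k are dead. *)
Lemma DT_large k C : (4 <= k)%N -> (C <= k)%N -> (busy (k + C) <= DT k)%N.
Proof.
move=> k4 Ck; have E : (16 * (k * k) <= 4 ^ k)%N.
  have := four_leq_exp k4; rewrite (_ : 4 ^ k = 2 ^ k * 2 ^ k)%N; last by rewrite -expnMn.
  by move: (2 ^ k)%N => x; nia.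
rewrite /busy /DT; nia.
Qed.

Section Limits.
Variables (st reg : finType) (ins : st -> bool * bool * reg * st * st).
Variables (st0 : st) (sp : pred st) (rx ra : reg).
Hypothesis rxa : rx != ra.
Variables (R : realType) (p : letter st reg -> R).
Hypotheses (p0 : forall q, 0 < p q) (p1 : \sum_q p q = 1).

Local Notation letter := (letter st reg).
Local Notation Pr := (Pr p).
Local Notation P := (P p).
Local Notation gconst := (gconst p).
Local Notation showsb := (showsb ins st0 sp rx ra).
Local Notation pattern := (pattern ins st0 sp rx ra).

(** One excluded letter of each color makes the weight strictly smaller than that of the color; this
    strict ratio to [P] is the source of the exponential gain. *)
Lemma color_bound (D : pred letter) : (forall c, exists2 q, isColor c q & ~~ D q) ->
  exists2 rho, 0 <= rho < P & forall c, weight p (fun q => isColor c q && D q) <= rho.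
Proof.
move=> HD; pose w c := weight p (fun q => isColor c q && D q).
have wP c : w c < P.
  have [q qc qD] := HD c; apply: lt_le_trans (W_le p c).
  by apply: (weight_lt p0 (q := q)) => [x /andP[]|//|] //=; rewrite (negbTE qD) andbF.
exists (Num.max (w true) (w false)).
  by rewrite gt_max !wP le_max weight_ge0.
by move=> c; rewrite le_max; case: c; rewrite lexx ?orbT.
Qed.

Lemma never_shown (u : seq bool) : (0 < size u)%N ->
  (forall x a, (x < a)%N -> exists K, forall k, (K <= k)%N -> (a < k)%N -> ~ pattern x a k u) ->
  forall e, 0 < e -> exists T, forall t, (T <= t)%N -> Pr (size u + t.*2) (showsb t u) <= e.
Proof.
move=> u0 Hpat e e0; set n := size u in u0 *.
have [rho0 /andP[r00 r0P] Hrho0] : exists2 rho, 0 <= rho < P &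
    forall c, weight p (fun q => isColor c q && @calmq st reg q) <= rho.
  by apply: color_bound => c; exists (c, false, Dead st reg, false); rewrite // /isColor eqxx.
have [rho1 /andP[r10 r1P] Hrho1] : exists2 rho, 0 <= rho < P &
    forall c, weight p (fun q => isColor c q && @unmarked st reg q) <= rho.
  by apply: color_bound => c; exists (c, true, Dead st reg, false); rewrite // /isColor eqxx.
have Pg := P_gt0 p0; have Pl := P_lt1 p0 p1; have Ph := P_half p1; have gg := gconst_gt0 p0.
(* Searching A / P^K0 positions misses every occurrence of [gpat (K0 + 6)] with probability at most
   e / 8; such an occurrence has probability gconst * P^(K0 + 5). *)
pose A := 8 / (e * (gconst * P ^+ 5)).
have A0 : 0 < A.
  by rewrite /A divr_gt0 ?ltr0n // mulr_gt0 // mulr_gt0 // exprn_gt0.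
pose d := e / (16 * (A + 1)).
have d0 : 0 < d by rewrite divr_gt0 //; lra.
have P01 : 0 <= P < 1 by rewrite ltW.
have ratio r : 0 <= r -> r < P -> 0 <= r / P < 1.
  by move=> r0 rP; rewrite divr_ge0 ?(ltW Pg) //= ltr_pdivrMr // mul1r.
(* [C], [l] and [N0] make the too long segments, the badly marked ones and those without [Start] or
   [Dead] rarer than P^K0 by a factor of order [d], which compensates the (A + 1) / P^K0
   positions. *)
have [C HC] := small_pow P01 d0.
have d20 : 0 < d / 2 by lra.
have [l1 Hl1] := small_pow (ratio _ r10 r1P) d20.
pose l := l1.+1.
have [N0 HN0] := small_pow (ratio _ r00 r0P) d0.
(* The first term bounds the boundary and transition contributions by e / 4; the second gives n + 2
   <= P^(-K0), which absorbs the rounding in [Z]. *)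
pose d' := Num.min (e / (8 * (n%:R * (C%:R + 2)))) (n.+2%:R^-1).
have n0 : 0 < n%:R :> R by rewrite ltr0n.
have C0 : 0 <= C%:R :> R by rewrite ler0n.
have d'0 : 0 < d'.
  rewrite /d' lt_min invr_gt0 ltr0n andbT; apply: divr_gt0 => //.
  by rewrite mulr_gt0 // mulr_gt0 //; lra.
have [N1 HN1] := small_pow P01 d'0.
have [B HB] := nat_bound (A + 1).
(* Only finitely many pairs x < a < 2l remain, so one threshold serves them all. *)
have [K HK] : exists K, forall k x a, (K <= k)%N -> (x < a)%N -> (a < l.*2)%N -> (a < k)%N ->
    ~ pattern x a k u.
  have H a x : exists K, forall k, (K <= k)%N -> (x < a)%N -> (a < k)%N -> ~ pattern x a k u.
    have [xa|ax] := ltnP x a; first by have [K HK] := Hpat x a xa; exists K => k Kk _; apply: HK.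
    by exists 0%N.
  have [f Hf] := choice (fun xa : nat * nat => H xa.2 xa.1).
  exists (\max_(a < l.*2) \max_(x < l.*2) f (x : nat, a : nat)) => k x a Kk xa al ak.
  apply: (Hf (x, a)) => //; apply: leq_trans Kk.
  have xl : (x < l.*2)%N by apply: ltn_trans al.
  apply: leq_trans (leq_bigmax (Ordinal al)); exact: (leq_bigmax (Ordinal xl)).
pose Km := (maxn (maxn (maxn (maxn 6 C) (maxn N0 N1)) (maxn B l.*2)) (maxn K (maxn n C.+2)))%N.
exists (2 * DT Km)%N => t Tt.
have ex : exists k, (2 * DT k <= t)%N by exists Km.
have bd k : (2 * DT k <= t)%N -> (k <= t)%N by rewrite /DT; clear; lia.
(* The factor 2 shares the time between dying and travelling; maximality of [K0] makes [t] at most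
   of order 4^K0. *)
case: (ex_maxnP ex bd) => K0 tK0 maxK0.
have KmK0 : (Km <= K0)%N by apply: maxK0.
have tK0' : (t < 2 * DT K0.+1)%N by rewrite ltnNge; apply/negP => /maxK0; rewrite ltnn.
have : [/\ [/\ 6 <= K0, C <= K0, N0 <= K0 & N1 <= K0], B <= K0, l.*2 <= K0, K <= K0 & [/\ n <= K0 & C.+2 <= K0]]%N.
  by move: KmK0; rewrite /Km !geq_max => /and3P[/andP[/andP[/andP[-> ->] /andP[-> ->]] /andP[-> ->]] -> /andP[-> ->]].
move=> [[K06 CK0 N0K0 N1K0] BK0 lK0 KK0 [nK0 C2K0]] {Km KmK0 Tt ex bd maxK0}.
pose Y := (Num.truncn (A / P ^+ K0)).+1; pose Z := (Y + n.+1)%N.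
have PK0 : 0 < P ^+ K0 by rewrite exprn_gt0.
have APge : 0 <= A / P ^+ K0 by rewrite divr_ge0 // ltW.
have YA : A / P ^+ K0 <= Y%:R by apply: ltW; rewrite truncnS_gt.
have YA' : Y%:R <= A / P ^+ K0 + 1 by rewrite -natr1 lerD2r truncn_le.
have ZA : Z%:R <= (A + 1) / P ^+ K0.
  rewrite /Z natrD mulrDl mul1r; have : n.+2%:R <= (P ^+ K0)^-1.
    rewrite -[leLHS]invrK lef_pV2 ?posrE ?invr_gt0 ?ltr0n //.
    by apply: le_trans (HN1 _ N1K0) _; rewrite /d' ge_min lexx orbT.
  have -> : n.+2%:R = n.+1%:R + 1 :> R by rewrite natr1.
  by lra.
(* From A + 1 <= 2^K0 and 4P >= 2: the travel time fits into half of [t], and at least [DT K0] steps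
   remain before the bits leave. *)
have Z4 : (Z <= 4 ^ K0)%N.
  rewrite -(ler_nat R); apply: le_trans ZA _; rewrite ler_pdivrMr //.
  have h2 : A + 1 <= 2 ^+ K0.
    by apply: le_trans HB _; rewrite -natrX ler_nat (leq_trans BK0) // ltnW // ltn_expl.
  have : 4 ^+ K0 * P ^+ K0 >= 2 ^+ K0.
    rewrite -exprMn; apply: lerXn2r; rewrite ?nnegrE; try lra.
  by rewrite natrX; lra.
have DT4 : (3 * 4 ^ K0 + 3 * K0 <= DT K0)%N by rewrite /DT addnC.
have DTZ : (DT K0 <= t.-1 - Z)%N.
  by clear -DT4 Z4 tK0; have := expn_gt0 4 K0; lia.
have c1 : (busy (K0 + C) <= t.-1 - Z)%N.
  by apply: leq_trans DTZ; apply: DT_large => //; apply: leq_trans K06.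
have c2 : (Z < t)%N by clear -DT4 Z4 tK0; have := expn_gt0 4 K0; lia.
have K04 : (K0 <= 4 ^ K0)%N by apply: ltnW; apply: ltn_expl.
have c3 : ((K0 + 6).*2 <= t.-1 - Z)%N.
  by apply: leq_trans DTZ; clear -DT4 K04 K06; lia.
(* Maximality of [K0] keeps [t] near or below 24 * 4^K0, while a started segment of length K0 + 6
   survives until time 1024 * 4^K0. *)
have c4 : (t + n <= 4 ^ (K0 + 6).-1)%N.
  have -> : (4 ^ (K0 + 6).-1 = 1024 * 4 ^ K0)%N by rewrite addnS /= expnD mulnC.
  by move: tK0'; rewrite /DT expnS; clear -nK0 K04 K06; lia.
have c5 : (Z + (K0 + 6) + (K0 + C) + 3 <= t)%N.
  by clear -DT4 Z4 tK0 C2K0 K06 K04; lia.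
have c6 : (n.+1 < Z)%N by rewrite /Z /Y; clear; lia.
have c7 : (0 < l)%N /\ (l.*2 <= K0)%N by split.
have Hp k x a : (K0 <= k)%N -> (x < a)%N -> (a < l.*2)%N -> (a < k)%N -> ~ pattern x a k u.
  by move=> Kk; apply: HK; apply: leq_trans Kk.
have lK : (l <= K0)%N by clear -lK0; lia.
have ub := upper_bound rxa p0 p1 u0 (erefl _) c2 c6 c7 (leq_addr C K0) (ltn_addl K0 (isT : 0 < 6)%N)
  DTZ c1 c3 c4 c5 Hp Hrho0 Hrho1.
have al := avoid_le rxa p0 p1 (erefl (size u + t.*2)%N) (ltn_addl K0 (isT : 0 < 6)%N) c5.
apply: (le_trans ub); move: al; move: (Pr _ (avoid _ _ _ _ _)) (Pr_ge0 p0 p1 (size u + t.*2) (avoid p t u (K0 + 6) Z)) => av av0.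
have E5 : ((K0 + 6).-1 = K0 + 5)%N by rewrite addnS.
rewrite (_ : Z - (size u).+1 = Y)%N ?addnK // E5 => al.
have av8 : av <= e / 8.
  have h : A * (gconst * P ^+ 5) <= Y%:R * (gconst * P ^+ (K0 + 5)).
    rewrite exprD (_ : _ * (gconst * _) = (Y%:R * P ^+ K0) * (gconst * P ^+ 5)); last by ring.
    apply: ler_wpM2r; last by rewrite -ler_pdivrMr.
    by rewrite mulr_ge0 // ?exprn_ge0 // ltW.
  have hA : A * (gconst * P ^+ 5) = 8 / e.
    by rewrite /A; field; rewrite !gt_eqF // exprn_gt0.
  have : av * (8 / e) <= 1 by rewrite -hA; apply: le_trans al; apply: ler_wpM2l.
  by rewrite mulrA ler_pdivrMr // mul1r; lra.
have PC : P ^+ (K0 + C).+1 <= d * P ^+ K0.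
  by rewrite -addnS exprD mulrC ler_wpM2r ?(ltW PK0) // HC.
have r0e : rho0 ^+ K0 <= d * P ^+ K0.
  by have := HN0 _ N0K0; rewrite expr_div_n ler_pdivrMr.
have r1e : rho1 ^+ l * P ^+ (K0 - l) <= d / 2 * P ^+ K0.
  have := Hl1 l (leqnSn _); rewrite expr_div_n ler_pdivrMr ?exprn_gt0 // => h.
  by rewrite -[in leRHS](subnKC lK) exprD mulrA ler_wpM2r // exprn_ge0 // ltW.
have t2 : Z%:R * (2 * P ^+ (K0 + C).+1 + 2 * rho0 ^+ K0 + 4 * (rho1 ^+ l * P ^+ (K0 - l))) <= 6 * e / 16.
  apply: (@le_trans _ _ ((A + 1) / P ^+ K0 * (6 * d * P ^+ K0))).
    apply: ler_pM => //.
      by rewrite !addr_ge0 ?mulr_ge0 ?exprn_ge0 ?ler0n // ltW.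
    by lra.
  have -> : (A + 1) / P ^+ K0 * (6 * d * P ^+ K0) = (A + 1) * (6 * d) by field; rewrite gt_eqF.
  have -> : (A + 1) * (6 * d) = 6 * e / 16 by rewrite /d; field; rewrite gt_eqF //; lra.
  by [].
have Pd : 2 * (n%:R * (C%:R + 2)) * P ^+ K0 <= e / 4.
  have : P ^+ K0 <= e / (8 * (n%:R * (C%:R + 2))).
    by apply: le_trans (HN1 _ N1K0) _; rewrite /d' ge_min lexx.
  rewrite ler_pdivlMr; last by rewrite !mulr_gt0 //; lra.
  by lra.
rewrite (_ : (K0 + C).+1 - K0 = C.+1)%N; last by clear; lia.
rewrite -(natr1 C) -/n; move: t2 av8 Pd.
set X := Z%:R * _; set Q := P ^+ K0; move: X Q => X Q *.
have -> : av + X + n%:R * (2 * Q) + (C%:R + 1) * (n%:R * (2 * Q)) = av + X + 2 * (n%:R * (C%:R + 2)) * Q by ring.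
lra.
Qed.
End Limits.

(** * Lower bound on the probability of a persistent word *)

Section LowerBound.
Variables (st reg : finType) (ins : st -> bool * bool * reg * st * st).
Variables (st0 : st) (sp : pred st) (rx ra : reg).
Hypothesis rxa : rx != ra.
Variables (R : realType) (p : letter st reg -> R).
Hypotheses (p0 : forall q, 0 < p q) (p1 : \sum_q p q = 1).

Local Notation letter := (letter st reg).
Local Notation Pr := (Pr p).
Local Notation P := (P p).
Local Notation cmax := (cmax p).
Local Notation blank := (blank st reg).
Local Notation step := (step ins st0 sp rx ra).
Local Notation evolve g t := (iter t step g).
Local Notation pattern := (pattern ins st0 sp rx ra).

Definition wordb (t : nat) (w v : seq letter) : bool :=
  all (fun i => evolve (cfg v) t (t + i) == nth blank w i) (iota 0 (size w)).

Definition other (c : bool) : pred letter := fun q => ~~ isColor c q.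

(* Cells to be read, with a boundary on their left. *)
Definition lpat (w : seq letter) : seq (pred letter) :=
  (other (color (head blank w))) ::
  [seq (fun q => [&& color q == color q', mark q == mark q' & mode_of q == Dead st reg]) : pred letter | q' <- w].

Definition mpat (x a : nat) (i : nat) : pred letter := fun q =>
  [&& isColor cmax q, mark q == ((i == x) || (i == a)) & (i == 0) ==> (mode_of q == Start st reg)].

Definition rpat (x a k : nat) : seq (pred letter) :=
  other cmax :: [seq mpat x a i | i <- iota 0 a.+1] ++ nseq (k - a.+1) (isColor cmax) ++ [:: other cmax].

Definition nomono K (w : seq letter) : bool :=
  all (fun y => ~~ mono (cfg w) y K) (iota 0 ((size w).+1 - K)).

Definition planted (w : seq letter) x a k t K m (v : seq letter) : bool :=
  matches (lpat w) (take (size w).+1 (drop t.-1 v)) &&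
  (nomono K (take m (drop (t + size w) v)) && matches (rpat x a k) (take k.+2 (drop (t + size w + m) v))).

Lemma size_lpat w : size (lpat w) = (size w).+1.
Proof. by rewrite /= size_map. Qed.

Lemma size_rpat x a k : (a < k)%N -> size (rpat x a k) = k.+2.
Proof. by move=> ak; rewrite /= !size_cat size_map size_iota size_nseq /=; lia. Qed.

Lemma nth_window (v : seq letter) z l i : (i < l)%N -> nth blank (take l (drop z v)) i = cfg v (z + i).
Proof. by move=> il; rewrite nth_take // nth_drop. Qed.

Lemma lpatP w v t : (0 < t)%N -> (0 < size w)%N -> matches (lpat w) (take (size w).+1 (drop t.-1 v)) ->
  left_end (cfg v) t /\ forall i, (i < size w)%N -> [/\ color (cfg v (t + i)) = color (nth blank w i),
    mark (cfg v (t + i)) = mark (nth blank w i) & mode_of (cfg v (t + i)) = Dead st reg].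
Proof.
move=> t0 w0 m; have H i := matches_nth blank xpred0 m (i := i).
rewrite size_lpat in H.
have C i : (i < size w)%N -> [/\ color (cfg v (t + i)) = color (nth blank w i),
    mark (cfg v (t + i)) = mark (nth blank w i) & mode_of (cfg v (t + i)) = Dead st reg].
  move=> iw; have := H i.+1 iw; rewrite nth_window //= (nth_map blank) //.
  rewrite (_ : t.-1 + i.+1 = t + i)%N; last by lia.
  by case/and3P => /eqP -> /eqP -> /eqP ->.
split=> //; have := H 0%N isT; rewrite nth_window // addn0 /= /other /isColor /left_end.
by have [] := C 0%N w0; rewrite addn0 nth0 => -> _ _.
Qed.

Lemma rpat_nth x a k i q : (a < k)%N -> (i <= k)%N -> nth xpred0 (rpat x a k) i.+1 q =
  if (i <= a)%N then mpat x a i q else if (i < k)%N then isColor cmax q else other cmax q.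
Proof.
move=> ak ik; rewrite -[nth _ _ _]/(nth xpred0 ([seq mpat x a j | j <- iota 0 a.+1] ++
  (nseq (k - a.+1) (isColor cmax) ++ [:: other cmax])) i).
rewrite nth_cat size_map size_iota ltnS; case: (leqP i a) => ia.
  have iN : (i < size (iota 0 a.+1))%N by rewrite size_iota.
  by rewrite (nth_map 0%N _ _ iN) nth_iota ?ltnS // add0n.
rewrite nth_cat size_nseq; case: (ltnP i k) => ik'.
  have h : (i - a.+1 < k - a.+1)%N by lia.
  by rewrite h nth_nseq h.
by rewrite (_ : i = k) ?ltnn ?subnn //; lia.
Qed.

Lemma rpatP x a k v y : (x < a)%N -> (a < k)%N -> matches (rpat x a k) (take k.+2 (drop y v)) ->
  [/\ color (cfg v y) != cmax, segment (cfg v) y.+1 k, color (cfg v y.+1) = cmax,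
    mode_of (cfg v y.+1) = Start st reg & marked (smarks (cfg v) y.+1) x a].
Proof.
move=> xa ak m; have H i := matches_nth blank xpred0 m (i := i).
rewrite size_rpat // in H.
have H' i : (i < k.+2)%N -> nth xpred0 (rpat x a k) i (cfg v (y + i)).
  by move=> ik; have := H i ik; rewrite nth_window.
have M i : (i <= a)%N -> mpat x a i (cfg v (y.+1 + i)).
  by move=> ia; have := H' i.+1 ltac:(lia); rewrite rpat_nth ?ia ?addnS //; lia.
have C i : (i < k)%N -> color (cfg v (y.+1 + i)) = cmax.
  move=> ik; case: (leqP i a) => ia; first by have /and3P[/eqP] := M i ia.
  have := H' i.+1 ltac:(lia); rewrite rpat_nth ?(ltnW ik) // leqNgt ia ik /=.
  by rewrite addnS => /eqP.
have C0 : color (cfg v y.+1) = cmax by have := C 0%N ltac:(lia); rewrite addn0.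
have nc : color (cfg v y) != cmax by have := H' 0%N isT; rewrite addn0.
split=> //.
- split; [by lia|by rewrite /left_end C0|by move=> i ik; rewrite C // C0|].
  by rewrite C0 addSn -addnS; have := H' k.+1 (ltnSn _); rewrite rpat_nth // leqNgt ak ltnn.
- by have /and3P[_ _ /eqP] := M 0%N isT; rewrite addn0.
- have mk i : (i <= a)%N -> smarks (cfg v) y.+1 i = (i == x) || (i == a).
    by move=> ia; have /and3P[_ /eqP] := M i ia.
  split=> //; rewrite ?mk ?eqxx ?orbT // 1?ltnW //.
  by move=> i ia ne; rewrite mk 1?ltnW // (negbTE ne) /=; apply/negP => /eqP; lia.
Qed.

Lemma nomonoP K v o m : nomono K (take m (drop o v)) -> (o + m <= size v)%N ->
  forall y, (o <= y)%N -> (y + K <= o + m)%N -> ~~ mono (cfg v) y K.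
Proof.
move=> /allP H om y oy ym; have sm : size (take m (drop o v)) = m.
  by rewrite size_take size_drop; case: (ltnP m); lia.
have := H (y - o)%N; rewrite mem_iota sm => /(_ ltac:(lia)); apply: contra => /monoP h.
apply/monoP => i iK; rewrite /cfg !nth_window; try lia.
by rewrite addnA (subnKC oy) h.
Qed.

Lemma planted_wordb w x a k t K m v : (x < a)%N -> (a < k)%N -> (0 < size w)%N ->
  all (fun q => mode_of q == Dead st reg) w -> size v = (size w + t.*2)%N ->
  (size w + m + k.+2 <= t)%N -> (DT K.+1 <= t.-1 - (size w + m).+1)%N -> (busy k <= t.-1 - (size w + m).+1)%N ->
  (t <= 4 ^ k.-1)%N -> planted w x a k t K m v ->
  (forall i, (i < size w)%N -> data (nth blank w i) = event ins st0 sp rx ra x a k &&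
     (x.*2.+2 %| t.-1 - (size w + m).+1 - (k.*2.-1 + (k - a).+1 * k.*2) + i)%N) ->
  wordb t w v.
Proof.
move=> xa ak w0 wD sv mt tK tk t4 /and3P[ml nm mr] wdat.
have t0 : (0 < t)%N by clear -mt; lia.
have [tl wc] := lpatP t0 w0 ml.
have [nc seg zc zS mkd] := rpatP xa ak mr.
have noK := nomonoP nm.
pose u := [seq data q | q <- w]; have su : size u = size w by rewrite size_map.
have zt : ((t + size w + m).+1 - t = (size w + m).+1)%N by clear; lia.
have sh := @planted_pattern st reg ins st0 sp rx ra (cfg v) t t u K (t + size w + m).+1 k x a rxa.
rewrite su zt in sh.
have {}sh := sh w0 tl (fun i iw => let: And3 _ _ h := wc i iw in h).
apply/allP => i; rewrite mem_iota add0n => /andP[_ iw].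
have [ci mi di] := wc i iw.
have e1 : color (evolve (cfg v) t (t + i)) = color (nth blank w i) by rewrite colorE ci.
have e2 : mark (evolve (cfg v) t (t + i)) = mark (nth blank w i) by rewrite markE mi.
have e3 : mode_of (evolve (cfg v) t (t + i)) = mode_of (nth blank w i).
  rewrite (dead_block _ _ _ _ _ _ tl _ iw); last by move=> j jw; have [] := wc j jw.
  by apply/esym/eqP/(allP wD)/mem_nth.
have e4 : data (evolve (cfg v) t (t + i)) = data (nth blank w i).
  rewrite sh ?size_map ?size_iota //.
  - by rewrite (nth_map 0%N) ?size_iota // nth_iota // add0n wdat.
  - by clear; lia.
  - by clear -mt; lia.
  - by move=> y oy yz; apply: noK => //; clear -sv mt yz; lia.
  - by apply: leq_trans t4; clear -mt; lia.
apply/eqP; move: e1 e2 e3 e4; rewrite /color /mark /mode_of /data.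
by case: (evolve _ _ _) => [[[? ?] ?] ?]; case: (nth _ _ _) => [[[? ?] ?] ?] /= -> -> -> ->.
Qed.

(** With the larger gap, the segment planted for the smaller one would put a block of [K] equal
    colors inside the gap. *)
Lemma planted_apart w x a k t K m m' v : (x < a)%N -> (a < k)%N -> (0 < K <= k)%N ->
  size v = (size w + t.*2)%N -> (size w + m' + k.+2 <= t)%N -> (m < m')%N ->
  planted w x a k t K m v -> ~~ planted w x a k t K m' v.
Proof.
move=> xa ak /andP[K0 Kk] sv m't mm /and3P[_ _ mr]; apply/negP => /and3P[_ nm' mr'].
have [_ seg zc _ _] := rpatP xa ak mr; have [nc' _ _ _ _] := rpatP xa ak mr'.
have := nomonoP nm' _ (y := (t + size w + m).+1).
rewrite (segment_mono _ seg) Kk => H.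
suff : false by []. 
apply: H; [by clear -sv m't; lia|by clear; lia|].
have [_ _ zk _] := seg.
rewrite leqNgt; apply/negP => h; move/negP: nc'; apply; apply/eqP.
rewrite (_ : t + size w + m' = (t + size w + m).+1 + (m' - m.+1))%N; last by clear -mm; lia.
by rewrite zk // ; clear -h mm Kk; lia.
Qed.

Definition lconst (w : seq letter) : R := Pr (size w).+1 (matches (lpat w)).
Definition rconst (x a : nat) : R :=
  weight p (other cmax) * \prod_(i <- iota 0 a.+1) weight p (mpat x a i) * weight p (other cmax).

Lemma other_gt0 c : 0 < weight p (other c).
Proof.
apply: (weight_gt0 p0 (q := (~~ c, false, Dead st reg, false))).
by rewrite /other /isColor; case: c.
Qed.

Lemma lconst_gt0 w : 0 < lconst w.
Proof.
rewrite /lconst -size_lpat Pr_matches // big_cons big_map mulr_gt0 ?other_gt0 //.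
apply: prodr_gt0 => q _; apply: (weight_gt0 p0 (q := (color q, mark q, Dead st reg, false))).
by rewrite !eqxx.
Qed.

Lemma rconst_gt0 x a : 0 < rconst x a.
Proof.
rewrite !mulr_gt0 ?other_gt0 //; apply: prodr_gt0 => i _.
apply: (weight_gt0 p0 (q := (cmax, (i == x) || (i == a), Start st reg, false))).
by rewrite /mpat /isColor !eqxx implybT.
Qed.

Lemma Pr_rpat x a k : (a < k)%N -> rconst x a * P ^+ k <= Pr k.+2 (matches (rpat x a k)).
Proof.
move=> ak; have P0 := P_gt0 p0; rewrite -(size_rpat x ak) Pr_matches //.
have -> : \prod_(D <- rpat x a k) weight p D = rconst x a * P ^+ (k - a.+1).
  rewrite /rpat big_cons !big_cat big_map big_nseq iter_mulr_1 big_seq1 /rconst /=.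
  by rewrite -/(W p cmax) -/P; ring.
apply: ler_wpM2l; first by rewrite ltW ?rconst_gt0.
by apply: ler_wiXn2l; rewrite ?leq_subr // ltW ?P_lt1.
Qed.

Lemma nomono_ge K m : (0 < K)%N -> 1 - m%:R * (2 * P ^+ K) <= Pr m (nomono K).
Proof.
move=> K0; have -> : Pr m (nomono K) = 1 - Pr m (fun w => has (fun y => mono (cfg w) y K) (iota 0 (m.+1 - K))).
  rewrite -Pr_neg //; apply: Ex_ext => // w sw; congr ((_ : bool)%:R).
  by rewrite -all_predC /nomono sw.
rewrite lerD2l lerN2; apply: (le_trans (Pr_has p0 p1 _ _ _)).
apply: (@le_trans _ _ ((m.+1 - K)%:R * (2 * P ^+ K))).
  by apply: sum_iota_le => y /andP[_ ym]; apply: mono_le => //; lia.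
apply: ler_wpM2r; first by rewrite mulr_ge0 ?exprn_ge0 // ltW ?P_gt0.
by rewrite ler_nat; lia.
Qed.

Lemma Pr_planted w x a k t K m : (0 < t)%N -> (a < k)%N -> (size w + m + k.+2 <= t)%N ->
  Pr (size w + t.*2) (planted w x a k t K m) =
  lconst w * (Pr m (nomono K) * Pr k.+2 (matches (rpat x a k))).
Proof.
move=> t0 ak mt; rewrite /lconst -Pr_indep // -Pr_indep //.
rewrite -[RHS](Pr_window p0 p1 (N := size w + t.*2) (z := t.-1)); last by lia.
apply: Ex_ext => // v sv; congr ((_ : bool)%:R).
have E d l L (s : seq letter) : (d + l <= L)%N -> take l (drop d (take L s)) = take l (drop d s).
  by move=> dl; rewrite !take_drop take_takel // addnC.
rewrite /planted; congr [&& _, _ & _]; first by rewrite take_takel ?leq_addr.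
- by rewrite E ?drop_drop; [congr (nomono _ (take _ (drop _ _))); lia|lia].
- rewrite drop_drop -[drop (m + _) _]take_size size_drop size_take_min size_drop sv.
  rewrite (_ : (_ - _ = k.+2)%N); last by lia.
  by rewrite E ?drop_drop; [congr (matches _ (take _ (drop _ _))); lia|lia].
Qed.

Lemma Pr_disjoint N (I : eqType) (r : seq I) (E : I -> seq letter -> bool) (F : seq letter -> bool) :
  uniq r -> (forall i v, i \in r -> size v = N -> E i v -> F v) ->
  (forall i j v, i \in r -> j \in r -> size v = N -> E i v -> E j v -> i = j) ->
  \sum_(i <- r) Pr N (E i) <= Pr N F.
Proof.
move=> ur EF EE; rewrite -Ex_sum //; apply: Ex_le => // v sv.
have [/hasP[i ir Ei]|/hasPn nE] := boolP (has (fun i => E i v) r); last first.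
  by rewrite big_seq big1 ?ler0n // => i ir; rewrite (negbTE (nE i ir)).
rewrite (bigD1_seq i) //= Ei (EF i v) // big_seq_cond big1 ?addr0 // => j /andP[jr ji].
case Ej: (E j v) => //; move: ji; by rewrite (EE j i v) ?eqxx.
Qed.

Lemma often_shown w x a : (0 < size w)%N -> all (fun q => mode_of q == Dead st reg) w ->
  (x < a)%N -> (forall K, exists2 k, (K <= k)%N & (a < k)%N /\ pattern x a k [seq data q | q <- w]) ->
  exists2 e : R, 0 < e & forall T, exists2 t, (T <= t)%N & e <= Pr (size w + t.*2) (wordb t w).
Proof.
move=> w0 wD xa often; set n := size w; set d := x.*2.+2.
have Pg := P_gt0 p0; have Pl : P < 1 := P_lt1 p0 p1.
have d0 : 0 < d%:R :> R by rewrite ltr0n.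
have lr0 : 0 < lconst w * rconst x a by rewrite mulr_gt0 ?lconst_gt0 ?rconst_gt0.
(* The product of at least y / 2 admissible gaps, where y = 1 / (4 d P^K), and of the probability
   lconst * rconst * P^k / 2 of each, with k = K + 4. *)
exists (lconst w * rconst x a * P ^+ 4 / (16 * d%:R)).
  by apply: divr_gt0; apply: mulr_gt0; rewrite ?exprn_gt0 ?ltr0n.
move=> T.
have [N HN] := @small_pow R P (4 * d%:R)^-1 ltac:(by rewrite (ltW Pg)) ltac:(by rewrite invr_gt0 mulr_gt0).
have [k kN [ak [phi Hphi]]] := often (T + N + n + d + 8)%N.
(* At this [t] a started segment of length k is alive, whereas those shorter than k - 3 have been
   dead since a time close to 3t / 16; lowering k to [K] only costs the constant P^4. *)
set K := (k - 4)%N; set t := (4 ^ k.-1)%N; set e := (4 ^ (k - 3))%N.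
have te : t = (16 * e)%N.
  by rewrite /t /e (_ : k.-1 = 2 + (k - 3))%N ?expnD //; clear -kN; lia.
have ke : (k <= e)%N.
  have := @four_leq_exp (k - 3) ltac:(clear -kN; lia).
  have : (2 ^ (k - 3) <= e)%N by rewrite /e leq_exp2r //; clear -kN; lia.
  by move: (2 ^ (k - 3))%N => z; clear -kN; lia.
have Ke : (2 ^ K <= e)%N.
  apply: (@leq_trans (4 ^ K)); first by rewrite leq_exp2r // /K; clear -kN; lia.
  by rewrite leq_exp2l // /K; clear -kN; lia.
have DTe : DT K.+1 = (3 * (k - 3) + 3 * e)%N.
  by rewrite /DT /e /K (_ : (k - 4).+1 = k - 3)%N //; clear -kN; lia.
have tle : (t <= 4 ^ k.-1)%N by [].
have KE : K = (k - 4)%N by [].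
clearbody t e K.
exists t; first by rewrite te; clear -ke kN; lia.
have PK0 : 0 < P ^+ K by rewrite exprn_gt0.
have dPK : 4 * d%:R * P ^+ K <= 1.
  have := HN K ltac:(clear -KE kN; lia).
  by rewrite -(@ler_pM2l _ (4 * d%:R)) ?mulr_gt0 // divff // mulf_neq0 ?gt_eqF.
(* As many gaps as possible while a gap of length d * J contains a block of [K] equal colors with
   probability at most 1/2. *)
pose y := (4 * d%:R * P ^+ K)^-1; pose J := Num.truncn y.
have y0 : 0 < y by rewrite invr_gt0 !mulr_gt0.
have y1 : 1 <= y by rewrite -[1]invr1 lef_pV2 ?posrE ?mulr_gt0.
have Jy : J%:R <= y by rewrite truncn_le // ltW.
have yJ : y / 2 <= J%:R.
  have : y < J.+1%:R by rewrite truncnS_gt.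
  have : 1 <= J%:R :> R by rewrite ler1n truncn_gt0.
  by rewrite -[J.+1%:R]natr1; lra.
have dJP : (d * J)%:R * (2 * P ^+ K) <= 2^-1.
  have -> : 2^-1 = (d%:R * y) * (2 * P ^+ K) by rewrite /y; field; rewrite !gt_eqF.
  by rewrite natrM ler_wpM2r ?mulr_ge0 ?(ltW PK0) // ler_pM2l.
have dJ : (d * J <= 2 ^ K)%N.
  rewrite -(ler_nat R) natrX; have : (2^-1) ^+ K <= P ^+ K :> R.
    by apply: lerXn2r; rewrite ?nnegrE ?invr_ge0 ?(ltW Pg) //; exact: P_half.
  rewrite exprVn => h; have h2 : 0 < 2 ^+ K :> R by rewrite exprn_gt0.
  have {}h : 1 <= 2 ^+ K * P ^+ K by rewrite -(ler_pM2l h2) divff ?gt_eqF // in h.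
  have : (d * J)%:R * P ^+ K <= 2 ^+ K * P ^+ K by lra.
  by rewrite ler_pM2r.
set c := (k.*2.-1 + (k - a).+1 * k.*2)%N; set X := (t.-1 - n.+1 - c)%N.
have XE : X = (t.-1 - n.+1 - c)%N by [].
(* The gaps run through one residue class modulo the period [d], chosen so that the emission meets
   the word with phase [phi]. *)
clearbody X; pose m0 := ((X + (d - phi %% d)) %% d)%N; pose m j := (m0 + d * j)%N.
have phid : (phi %% d < d)%N by rewrite ltn_mod.
have m0d : (m0 < d)%N by rewrite ltn_mod.
have mJ j : (j < J)%N -> (m j < d * J)%N.
  by move=> jJ; apply: (@leq_trans (d * j.+1)); [rewrite mulnS /m; clear -m0d; lia|rewrite leq_mul2l jJ orbT].
have mX j : (m j + phi = X %[mod d])%N.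
  rewrite (_ : m j + phi = j * d + (m0 + phi))%N; last by rewrite /m (mulnC d) addnAC addnC.
  rewrite modnMDl /m0 modnDml (_ : X + _ + _ = (phi %/ d).+1 * d + X)%N ?modnMDl //.
  by rewrite mulSn {2}(divn_eq phi d); move: (phi %/ d * d)%N (phi %% d)%N phid => A B; clear; lia.
have cE : c = (k.*2.-1 + (k - a).+1 * k.*2)%N by [].
have cb : (c <= busy k)%N.
  by rewrite /c /busy leq_add ?leq_pred // leq_mul2r ltnS leq_subr orbT.
clearbody c.
have bD : (busy k <= DT K.+1)%N.
  have := @DT_large (k - 3) 3 ltac:(clear -kN; lia) ltac:(clear -kN; lia).
  have -> : (k - 3 + 3 = k)%N by clear -kN; lia.
  by have -> : (k - 3 = K.+1)%N by clear -KE kN; lia.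
have Je j : (j < J)%N -> (m j < e)%N by move=> jJ; apply: leq_trans (mJ j jJ) (leq_trans dJ Ke).
have Dt j : (j < J)%N -> (DT K.+1 <= t.-1 - (n + m j).+1)%N.
  by move=> jJ; have := Je j jJ; rewrite DTe te; move: (m j) => mj; clear -ke kN; lia.
have kt j : (j < J)%N -> (n + m j + k.+2 <= t)%N.
  by move=> jJ; have := Je j jJ; rewrite te; move: (m j) => mj; clear -ke kN; lia.
have t0 : (0 < t)%N by rewrite te; clear -ke kN; lia.
have cX j : (j < J)%N -> (m j <= X)%N /\ (t.-1 - (n + m j).+1 - c = X - m j)%N.
  move=> jJ; have := Dt j jJ; have := Je j jJ; have := leq_trans cb bD.
  by rewrite DTe XE te; move: (m j) => mj; clear -ke kN; lia.
have dd j i : (j < J)%N -> (d %| t.-1 - (n + m j).+1 - c + i)%N = (d %| phi + i)%N.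
  move=> jJ; have [mjX ->] := cX j jJ.
  rewrite /dvdn -modnDml -[in RHS]modnDml; congr (_ %% d == _)%N; congr (_ + _)%N.
  by apply/eqP; rewrite -(eqn_modDl (m j)) subnKC // mX.
have := @Pr_disjoint (n + t.*2) _ (iota 0 J) (fun j => planted w x a k t K (m j)) (wordb t w).
move=> /(_ (iota_uniq _ _)) H; apply: le_trans (H _ _) => {H}; last first.
- have Kk : (0 < K <= k)%N by clear -KE kN; lia.
  move=> j j' v; rewrite !mem_iota !add0n => /andP[_ jJ] /andP[_ j'J] sv Ej Ej'.
  have ap l l' : (l < J)%N -> (l' < J)%N -> planted w x a k t K (m l) v -> planted w x a k t K (m l') v -> (l < l')%N -> False.
    move=> lJ l'J El El' ll; suff /negP : ~~ planted w x a k t K (m l') v by [].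
    apply: planted_apart El => //; first exact: kt.
    by rewrite /m ltn_add2l ltn_mul2l ll.
  by case: (ltngtP j j') => // jj; [case: (ap j j')|case: (ap j' j)].
- move=> j v; rewrite mem_iota add0n => /andP[_ jJ] sv Ej.
  apply: (planted_wordb xa ak w0 wD sv (kt j jJ) (Dt j jJ) (leq_trans bD (Dt j jJ)) _ Ej) => // i iw.
  by rewrite -cE dd // -Hphi ?size_map // (nth_map blank).
have HP j : (j < J)%N -> lconst w * rconst x a / 2 * P ^+ k <= Pr (n + t.*2) (planted w x a k t K (m j)).
  move=> jJ; rewrite Pr_planted //; last exact: kt.
  have -> : lconst w * rconst x a / 2 * P ^+ k = lconst w * (2^-1 * (rconst x a * P ^+ k)) by ring.
  rewrite ler_pM2l ?lconst_gt0 //; apply: ler_pM.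
  - by rewrite invr_ge0.
  - by rewrite mulr_ge0 ?(ltW (rconst_gt0 _ _)) ?exprn_ge0 ?(ltW Pg).
  - apply: le_trans (nomono_ge _ _); last by clear -KE kN; lia.
    have : (m j)%:R * (2 * P ^+ K) <= (d * J)%:R * (2 * P ^+ K).
      by apply: ler_wpM2r; rewrite ?mulr_ge0 ?(ltW PK0) // ler_nat ltnW // mJ.
    lra.
  - exact: Pr_rpat.
apply: (@le_trans _ _ (\sum_(j <- iota 0 J) (lconst w * rconst x a / 2 * P ^+ k))); last first.
  by rewrite big_seq [leRHS]big_seq; apply: ler_sum => j; rewrite mem_iota => /andP[_ jJ]; exact: HP.
rewrite big_const_seq count_predT size_iota iter_addr_0 -[_ *+ J]mulr_natl.
apply: (@le_trans _ _ (y / 2 * (lconst w * rconst x a / 2 * P ^+ k))); last first.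
  apply: ler_wpM2r => //; apply: mulr_ge0; last by rewrite exprn_ge0 ?(ltW Pg).
  by rewrite divr_ge0 ?(ltW lr0).
rewrite le_eqVlt; apply/orP; left; apply/eqP.
rewrite (_ : k = K + 4)%N ?exprD /y; last by clear -KE kN; lia.
by field; rewrite !gt_eqF.
Qed.
End LowerBound.

Local Open Scope classical_set_scope.

(** * Bernoulli measures *)

(** Additivity over the values of [f]; measurability of [A] is obtained from the same pieces. *)
Lemma measure_split d (T : measurableType d) (R : realType) (mu : {measure set T -> \bar R})
    (I : finType) (f : T -> I) (A : set T) (m : I -> R) :
  (forall i, measurable (A `&` [set x | f x = i]) /\ mu (A `&` [set x | f x = i]) = (m i)%:E) ->
  measurable A /\ mu A = (\sum_i m i)%:E.
Proof.
move=> H; have HA : A = A `&` [set x | f x \in enum I].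
  by apply/seteqP; split=> x //= => [|[]//]; split=> //; rewrite mem_enum.
rewrite HA -big_enum; elim: (enum I) (enum_uniq I) => [_|i r IH /= /andP[ir /IH[mr Er]]].
  rewrite big_nil (_ : _ `&` _ = set0) ?measure0 //.
  by apply/seteqP; split=> x //= [].
have [mi Ei] := H i.
have -> : A `&` [set x | f x \in i :: r] = (A `&` [set x | f x = i]) `|` (A `&` [set x | f x \in r]).
  apply/seteqP; split=> x /=; rewrite inE.
    by move=> [Ax /predU1P[]]; [left|right].
  by move=> [[Ax ->]|[Ax ->]]; rewrite ?eqxx ?orbT.
split; first exact: measurableU.
rewrite measureU //; last first.
  by apply/seteqP; split=> x //= [[_ ->] [_]]; rewrite (negbTE ir).
by rewrite big_cons EFinD; congr (_ + _)%E.
Qed.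

Section Bernoulli.
Variables (Q : finType) (n : nat) (enc : Q -> 'I_n.+1) (dec : 'I_n.+1 -> Q).
Hypotheses (encK : cancel enc dec) (decK : cancel dec enc).
Variables (R : realType) (mu : probability (ConfM n) R).
Hypothesis bern : fully_supported_bernoulli mu.

Definition coef (q : Q) : R := fine (mu (cyl [:: enc q] 0)).

Lemma measurable_cyl u i : measurable (cyl u i : set (ConfM n)).
Proof. by apply: sub_sigma_algebra; exists u, i. Qed.

Lemma coef_gt0 q : 0 < coef q.
Proof.
apply: fine_gt0; rewrite bern.1 /=; apply: le_lt_trans (ltry 1).
by apply: probability_le1; apply: measurable_cyl.
Qed.

Lemma mu_cyl v i : mu (cyl [seq enc q | q <- v] i) = (\prod_(q <- v) coef q)%:E.
Proof.
rewrite bern.2; congr (_%:E); elim: v => [|q v IH].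
  by rewrite big_nil big1 // => q _; rewrite expr0.
rewrite big_cons -IH /= /coef (bigD1 (enc q)) //= [in RHS](bigD1 (enc q)) //= eqxx exprD expr1 mulrA.
by congr (_ * _); apply: eq_bigr => q' /negbTE; rewrite eq_sym => ->.
Qed.

Definition window (c : Conf n) (i : int) (l : nat) : seq Q := [seq dec (c (i + k%:Z)) | k <- iota 0 l].

Lemma windowS c i l : window c i l.+1 = dec (c i) :: window c (i + 1) l.
Proof.
rewrite /window /= addr0; congr (_ :: _); rewrite -[1%N]addn0 iotaDl -map_comp.
by apply: eq_map => k /=; rewrite PoszD addrA.
Qed.

Lemma window_cat c i l l' : window c i (l + l') = window c i l ++ window c (i + l%:Z) l'.
Proof.
rewrite /window iotaD map_cat; congr (_ ++ _); rewrite add0n -[l in iota l]addn0 iotaDl -map_comp.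
by apply: eq_map => k /=; rewrite PoszD addrA.
Qed.

Lemma cylE v i : cyl [seq enc q | q <- v] i = [set c | window c i (size v) = v].
Proof.
have W c : window c i (size v) = v <-> [seq c (i + k%:Z) | k <- iota 0 (size v)] = map enc v.
  split=> E; last by rewrite /window (map_comp dec (fun k : nat => c (i + k%:Z))) E mapK.
  by rewrite -[in RHS]E /window -map_comp; apply: eq_map => k /=; rewrite decK.
by apply/seteqP; split=> c /=; rewrite /cyl /= size_map => /W.
Qed.

(** The fixed prefix [v] lets the induction on [l] split on the next letter; at the end the event is
    a cylinder or empty. *)
Lemma mu_window l (E : seq Q -> bool) i v :
  let A := [set c : ConfM n | window c i (size v) = v /\ E (window c (i + (size v)%:Z) l)] in
  measurable A /\ mu A = ((\prod_(q <- v) coef q) * Pr coef l E)%:E.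
Proof.
elim: l E i v => [|l IH] E i v A.
  case Ev: (E [::]); last first.
    have -> : A = set0 by apply/seteqP; split=> c //= []; rewrite /window /= Ev.
    by rewrite measure0 /Pr /= Ev mulr0.
  have -> : A = cyl [seq enc q | q <- v] i.
    rewrite cylE; apply/seteqP; split=> c; rewrite /A /=; last by move->; rewrite /window /= Ev.
    by case.
  rewrite /Pr /= Ev mulr1. split; first exact: measurable_cyl.
  exact: mu_cyl.
rewrite (_ : _ * _ = \sum_q (\prod_(q <- rcons v q) coef q) * Pr coef l (fun w => E (q :: w))); last first.
  by rewrite /Pr /= mulr_sumr; apply: eq_bigr => q _; rewrite big_rcons mulrA.
apply: (measure_split (f := fun c : ConfM n => dec (c (i + (size v)%:Z)))) => q.
have := IH (fun w => E (q :: w)) i (rcons v q).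
set B := [set c | _]; set B' := _ `&` _; suff -> : B' = B by [].
rewrite /B /B' /A size_rcons.
have W c : window c i (size v).+1 = rcons (window c i (size v)) (dec (c (i + (size v)%:Z))).
  by rewrite -[(size v).+1]addn1 window_cat windowS cats1.
have P c : window c (i + (size v)%:Z) l.+1 = dec (c (i + (size v)%:Z)) :: window c (i + (size v).+1%:Z) l.
  by rewrite windowS -addrA -addn1 PoszD.
apply/seteqP; split=> c /=; rewrite W P => - [].
  by move=> [-> Ec] <-.
by move/rcons_inj => [-> ->].
Qed.

Lemma sum_coef : \sum_q coef q = 1.
Proof.
have [_] := mu_window 1 xpredT 0 [::]; rewrite (_ : [set _ | _] = setT); last first.
  by apply/seteqP; split.
rewrite probability_setT big_nil mul1r /Pr /= => -[->].
by apply: eq_bigr => q _; rewrite mulr1.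
Qed.

Variable f3 : Q -> Q -> Q -> Q.

Definition local_rule (u : (1.*2.+1).-tuple 'I_n.+1) : 'I_n.+1 :=
  enc (f3 (dec (nth ord0 u 0)) (dec (nth ord0 u 1)) (dec (nth ord0 u 2))).

Definition halfstep (g : nat -> Q) : nat -> Q := fun i => f3 (g i.-1) (g i) (g i.+1).

Lemma globalE (c : Conf n) z :
  dec (global local_rule c z) = f3 (dec (c (z - 1))) (dec (c z)) (dec (c (z + 1))).
Proof.
rewrite /global /local_rule encK.
have E (i : 'I_(1.*2.+1)) : nth ord0 [tuple c (z + (j%:Z - 1%:Z)) | j < 1.*2.+1] i = c (z + (i%:Z - 1%:Z)).
  by rewrite -tnth_nth tnth_mktuple.
have e0 := E (@Ordinal 3 0 isT); have e1 := E (@Ordinal 3 1 isT); have e2 := E (@Ordinal 3 2 isT).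
by rewrite e0 e1 e2 /= subrr addr0.
Qed.

(** The artificial left neighbour of index 0 in [halfstep] spreads right at unit speed, so indices
    at least [s] are still exact at time [s]. *)
Lemma light_cone (c : Conf n) (o : int) (g : nat -> Q) N : (forall i, (i < N)%N -> dec (c (o + i%:Z)) = g i) ->
  forall s i, (s <= i)%N -> (i + s < N)%N ->
    dec (iter s (global local_rule) c (o + i%:Z)) = iter s halfstep g i.
Proof.
move=> cg; elim=> [|s IH] i si iN; first by apply: cg; lia.
rewrite /= globalE /halfstep -!IH; try lia.
congr (f3 (dec (iter s _ c _)) _ (dec (iter s _ c _))); lia.
Qed.

Lemma mu_preimage b (w : seq Q) t :
  mu (iter t (global local_rule) @^-1` cyl [seq enc q | q <- w] 0) =
  (Pr coef (size w + t.*2) (fun v => all (fun i => iter t halfstep (nth b v) (t + i) == nth b w i) (iota 0 (size w))))%:E.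
Proof.
set E := (X in Pr _ _ X); have [_] := mu_window (size w + t.*2) E (- t%:Z) [::].
rewrite big_nil mul1r => <-; congr (mu _); rewrite cylE; apply/seteqP.
have H c : window (iter t (global local_rule) c) 0 (size w) = w <-> E (window c (- t%:Z + 0%:Z) (size w + t.*2)).
  rewrite addr0; set v := window c _ _.
  have L i : (i < size w)%N -> dec (iter t (global local_rule) c (0 + i%:Z)) = iter t halfstep (nth b v) (t + i).
    move=> iw; rewrite -(@light_cone c (- t%:Z) (nth b v) (size w + t.*2)); try lia.
      by congr (dec (iter t _ c _)); lia.
    by move=> j jN; rewrite (nth_map 0%N) ?size_iota // nth_iota.
  split=> [Ew|/allP Ew].
    apply/allP => i; rewrite mem_iota add0n => /andP[_ iw].
    by rewrite -L //; apply/eqP; rewrite -[in RHS]Ew (nth_map 0%N) ?size_iota // nth_iota.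
  apply: (@eq_from_nth _ b); first by rewrite size_map size_iota.
  rewrite size_map size_iota => i iw; rewrite (nth_map 0%N) ?size_iota // nth_iota // add0n L //.
  by apply/eqP/Ew; rewrite mem_iota.
by split=> c /= => [/H|[_ /H]].
Qed.
End Bernoulli.

Lemma cvg0_bound (R : realType) (u : nat -> R) : (forall t, 0 <= u t) ->
  (fun t => (u t)%:E) @ \oo --> 0%E <-> forall e, 0 < e -> exists T, forall t, (T <= t)%N -> u t <= e.
Proof.
move=> u0; split=> [/fine_cvgP[_ /cvgrPdist_le H] e /H[T _ HT]|H].
  by exists T => t /HT /=; rewrite sub0r normrN ger0_norm.
apply/fine_cvgP; split; first by near=> t.
apply/cvgrPdist_le => e /H[T HT]; exists T => // t /= /HT.
by rewrite sub0r normrN ger0_norm.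
Unshelve. all: by end_near.
Qed.

(** * Characterization of the persistent words *)

Section Persistence.
Variables (st reg : finType) (ins : st -> bool * bool * reg * st * st).
Variables (st0 : st) (sp : pred st) (rx ra : reg).
Hypothesis rxa : rx != ra.
Local Notation letter := (letter st reg).
Local Notation pattern := (pattern ins st0 sp rx ra).
Variables (n : nat) (enc : letter -> 'I_n.+1) (dec : 'I_n.+1 -> letter).
Hypotheses (encK : cancel enc dec) (decK : cancel dec enc).
Variables (R : realType) (mu : probability (ConfM n) R).
Hypothesis bern : fully_supported_bernoulli mu.

Theorem persistentE (w : seq letter) :
  persistent (local_rule enc dec (step3 ins st0 sp rx ra)) mu [seq enc q | q <- w] <->
  all (fun q => mode_of q == Dead st reg) w /\
  exists x a, (x < a)%N /\ forall K, exists2 k, (K <= k)%N & (a < k)%N /\ pattern x a k [seq data q | q <- w].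
Proof.
set p := coef enc mu.
have p0 : forall q, 0 < p q by exact: coef_gt0 bern.
have p1 : \sum_q p q = 1 by exact: sum_coef bern.
have C : persistent (local_rule enc dec (step3 ins st0 sp rx ra)) mu [seq enc q | q <- w] <->
    ~ forall e, 0 < e -> exists T, forall t, (T <= t)%N ->
        Pr p (size w + t.*2) (wordb ins st0 sp rx ra t w) <= e.
  rewrite /persistent (_ : (fun t => _) = fun t =>
    (Pr p (size w + t.*2) (wordb ins st0 sp rx ra t w))%:E); last first.
    by apply: funext => t; rewrite (mu_preimage encK decK bern _ (blank st reg)).
  by split=> H; apply: contra_not H => /cvg0_bound; apply => t; exact: Pr_ge0.
rewrite {}C; split=> [H|[wD [x [a [xa often]]]] H]; last first.
  (* The empty word has probability 1 at all times. *)
  have [w0|w0] := posnP (size w).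
    have [T /(_ T (leqnn _))] := H 2^-1 ltac:(by rewrite invr_gt0).
    rewrite (size0nil w0) (_ : Pr _ _ _ = 1) ?lerNgt; last by rewrite /Pr Ex_const.
    by lra.
  have [e e0 He] := often_shown rxa p0 p1 w0 wD xa often.
  have [T HT] := H (e / 2) ltac:(by rewrite divr_gt0).
  have [t Tt] := He T; have := HT t Tt; lra.
have [wD|nD] := boolP (all (fun q => mode_of q == Dead st reg) w); last first.
  (* A single cell is not dead with probability tending to 0, which already rules out a word with a
     letter that is not dead. *)
  case: H => e e0; move/allPn: nD => [q qw qD].
  have [K0 HK] := small_pow (x := P p) (e := e / 4) ltac:(by rewrite ltW ?P_gt0 // P_lt1) ltac:(by rewrite divr_gt0).
  set K := K0.+1; exists (K + DT K.*2)%N => t tT; set i := index q w.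
  have iw : (i < size w)%N by rewrite index_mem.
  have : Pr p (size w + t.*2) (fun v => mode_of (iter t (step ins st0 sp rx ra) (cfg v) (t + i)) != Dead st reg) <= 4 * P p ^+ K.
    by apply: cell_alive_le => //; lia.
  have := HK K (leqnSn _) => h1 h2; apply: (@le_trans _ _ (4 * P p ^+ K)); last by lra.
  apply: le_trans h2; apply: Pr_le => // v sv /allP/(_ i); rewrite mem_iota iw => /(_ isT)/eqP ->.
  by rewrite nth_index.
split=> //; have [->|wn] := eqVneq w [::].
  (* On the empty word [pattern] holds vacuously, so any marks will do. *)
  exists 0%N, 1%N; split=> // K; exists K.+2; first by lia.
  by split=> //; exists 0%N => i; rewrite ltn0.
have w0 : (0 < size w)%N by case: (w) wn.
apply: contrapT => nE; apply: H => e e0.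
set u := [seq data q | q <- w]; have su : size u = size w by rewrite size_map.
have nu : forall x a, (x < a)%N -> exists K, forall k, (K <= k)%N -> (a < k)%N -> ~ pattern x a k u.
  move=> x a xa; apply: contrapT => nK; apply: nE; exists x, a; split=> // K.
  apply: contrapT => nk; apply: nK; exists K => k Kk ak pt; apply: nk; by exists k.
have [] := never_shown rxa p0 p1 _ nu e0; rewrite su //.
move=> T HT; exists T => t /HT; apply: le_trans; apply: Pr_le => // v sv /allP Hw.
rewrite /showsb su; apply/allP => i ii; have := Hw i ii; move: ii.
rewrite mem_iota add0n => /andP[_ iw] /eqP ->.
by rewrite (nth_map (blank st reg)).
Qed.
End Persistence.

Local Close Scope classical_set_scope.
Local Close Scope ring_scope.

(** Targets stay within the program and [B] bounds every register that occurs, as well as the input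
    registers 1 and 2, so [inord] never truncates. *)
Lemma ordinal_machine (M : seq instr) (sp : nat) : all (target_le (size M).-1) M ->
  exists (st reg : finType) (ins : st -> bool * bool * reg * st * st) (st0 : st) (ssp : pred st) (rx ra : reg),
    rx != ra /\ forall x a k, event ins st0 ssp rx ra x a k = (pcat M x a (k.-1 - a) == sp).
Proof.
move=> tM; pose S := (size M).-1; pose i0 : instr := (0, 0, 0, 0).
pose B := maxn 2 (\max_(i <- M) i.1.1.2).
have regB q : (nth i0 M q).1.1.2 <= B.
  case: (ltnP q (size M)) => qM; last by rewrite nth_default.
  by rewrite leq_max (@leq_bigmax_seq _ M xpredT (fun i : instr => i.1.1.2)) ?orbT // mem_nth.
pose ins (q : 'I_S.+1) : bool * bool * 'I_B.+1 * 'I_S.+1 * 'I_S.+1 :=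
  let: (op, r, q1, q0) := nth i0 M q in (op == 1, 1 < op, inord r, inord q1, inord q0).
have B2 : 2 <= B by rewrite leq_maxl.
exists 'I_S.+1, 'I_B.+1, ins, ord0, (fun q => val q == sp), (inord 1), (inord 2); split.
  by apply/eqP => /(congr1 val); rewrite /= !inordK //; lia.
move=> x a k; rewrite /event /pcat; move: (k.-1 - a) => t.
set s := arun _ _ _ _ _ _ _; set c := iter _ _ _.
suff [-> _] : val s.1 = c.1 /\ forall r : 'I_B.+1, s.2 r = c.2 r by [].
rewrite {}/s {}/c; elim: t => [|t [IH1 IH2]].
  split=> // r; rewrite /= /areg /init_store.
  have v1 : val (inord 1 : 'I_B.+1) = 1 by rewrite /= inordK //; lia.
  have v2 : val (inord 2 : 'I_B.+1) = 2 by rewrite /= inordK //; lia.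
  rewrite -!val_eqE v1 v2; case: r => -[|[|[|r]]] rB //=; by rewrite nth_nil.
rewrite [arun _ _ _ _ _ _ _]/= [iter _ _ _]/=.
move: (arun _ _ _ _ _ _ _) (iter _ _ _) IH1 IH2 => [q s] [q' s'] /= qE sE.
rewrite /astep /cmstep /ins /= qE.
have := regB q'; have : target_le S (nth i0 M q').
  by case: (ltnP q' (size M)) => qM; [rewrite (allP tM) // mem_nth|rewrite nth_default].
case: (nth i0 M q') => [[[op r] q1] q0] /= /andP[q1S q0S] rB.
have rE : s (inord r) = s' r by rewrite sE /= inordK.
split; first by rewrite rE; case: ifP => _ /=; rewrite inordK.
move=> r'; rewrite -val_eqE /= inordK // rE.
case: op => [|[|op]] /=; rewrite /upd; case: eqP => [<-|_] //; rewrite ?sE ?addn0 ?subn0 ?addn1 //.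
by case: (s' r') => [|m] //=; rewrite subn1.
Qed.

Lemma cptb_mem k f (s : seq nat) : cpt k f -> cptb k (fun v => f v \in s).
Proof.
move=> cf; elim: s => [|i s IH]; first exact: cpt_const.
apply: (@cptb_ext _ (fun v => (f v == i) || (f v \in s))); first by move=> v _; rewrite inE.
by cpt_tac.
Qed.

(** * Arithmetical complexity *)

Section Codes.
Variables (st reg : finType) (ins : st -> bool * bool * reg * st * st).
Variables (st0 : st) (sp : pred st) (rx ra : reg).
Local Notation letter := (letter st reg).
Local Notation event := (event ins st0 sp rx ra).
Local Notation pattern := (pattern ins st0 sp rx ra).
Variables (n : nat) (enc : letter -> 'I_n.+1) (dec : 'I_n.+1 -> letter).
Hypotheses (encK : cancel enc dec) (decK : cancel dec enc).

(** Convertible to [pickle] of the renamed word, an ordinal being coded by its value. *)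
Definition word_code (w : seq letter) : nat := CodeSeq.code [seq val (enc q) | q <- w].

Definition deads : seq nat := [seq val (enc q) | q <- enum {: letter} & mode_of q == Dead st reg].
Definition ones : seq nat := [seq val (enc q) | q <- enum {: letter} & data q].

(** The phase matters only modulo the period, so the existential in [pattern] becomes a bounded
    search. *)
Definition spells (x a k m : nat) : bool :=
  has (fun phi => all (fun i => (getn m i \in ones) == (event x a k && (x.*2.+2 %| phi + i))) (iota 0 (sizen m)))
    (iota 0 x.*2.+2).

(** The marks are packed as [y = consn x a], so that one outer existential covers both and the
    prefix is exactly exists-forall-exists. *)
Definition shown (m y K k : nat) : bool :=
  [&& all (fun i => getn m i \in deads) (iota 0 (sizen m)), hdn y < tln y, K <= k, tln y < k &
    spells (hdn y) (tln y) k m].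

Lemma mem_letters (D : pred letter) q : (val (enc q) \in [seq val (enc q) | q <- enum {: letter} & D q]) = D q.
Proof.
have inj : injective (fun q : letter => val (enc q)) by move=> u v /val_inj/(can_inj encK).
by rewrite (mem_map inj) mem_filter mem_enum andbT.
Qed.

Lemma getn_word w i : i < size w -> getn (word_code w) i = enc (nth (blank st reg) w i).
Proof. by move=> iw; rewrite getn_code (nth_map (blank st reg)). Qed.

Lemma sizen_word w : sizen (word_code w) = size w.
Proof. by rewrite sizen_code size_map. Qed.

Lemma spellsP x a k w : reflect (pattern x a k [seq data q | q <- w]) (spells x a k (word_code w)).
Proof.
have E phi : all (fun i => (getn (word_code w) i \in ones) == (event x a k && (x.*2.+2 %| phi + i)))
    (iota 0 (sizen (word_code w))) <->
    forall i, i < size w -> nth false [seq data q | q <- w] i = event x a k && (x.*2.+2 %| phi + i).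
  rewrite sizen_word; split=> [/allP H i iw|H].
    have := H i; rewrite mem_iota => /(_ iw)/eqP <-.
    by rewrite getn_word // mem_letters (nth_map (blank st reg)).
  apply/allP => i; rewrite mem_iota => /andP[_ iw].
  by rewrite -H // getn_word // mem_letters (nth_map (blank st reg)).
apply: (iffP hasP) => [[phi _ /E H]|[phi]]; first by exists phi; rewrite size_map.
rewrite size_map => H.
exists (phi %% x.*2.+2); first by rewrite mem_iota add0n ltn_mod.
by apply/E => i iw; rewrite H // /dvdn modnDml.
Qed.

Lemma shown_exists m : (exists y, forall K, exists k, shown m y K k) <->
  exists w, [/\ word_code w = m, all (fun q => mode_of q == Dead st reg) w & exists x a, x < a /\
    forall K, exists2 k, K <= k & a < k /\ pattern x a k [seq data q | q <- w]].
Proof.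
split=> [[y H]|[w [<- wD [x [a [xa H]]]]]]; last first.
  exists (consn x a) => K; have [k Kk [ak pt]] := H K; exists k; rewrite /shown hdn_consn tln_consn.
  rewrite xa Kk ak /=; apply/andP; split; last exact/spellsP.
  apply/allP => i; rewrite sizen_word mem_iota => /andP[_ iw].
  by rewrite getn_word // mem_letters; apply/(allP wD)/mem_nth.
(* Every number codes a sequence of numbers; membership in [deads] shows that the entries are values
   of letters, so [inord] loses nothing. *)
pose w : seq letter := [seq dec (inord j) | j <- CodeSeq.decode m].
have [k0 /and5P[mD xa _ _ _]] := H 0.
have wE : word_code w = m.
  rewrite /word_code -map_comp -[RHS]CodeSeq.decodeK; congr CodeSeq.code.
  rewrite -[RHS]map_id; apply/eq_in_map => j /(nthP 0)[i ij <-].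
  move/allP : mD => /(_ i); rewrite -{1 2}[m]CodeSeq.decodeK sizen_code getn_code mem_iota => /(_ ij).
  by move=> /mapP[q _ ->] /=; rewrite decK inordK.
exists w; split=> //.
  apply/allP => q /(nthP (blank st reg))[i iw <-].
  by move/allP: mD => /(_ i); rewrite -wE sizen_word mem_iota => /(_ iw); rewrite getn_word // mem_letters.
exists (hdn y), (tln y); split=> // K; have [k /and5P[_ _ Kk ak sh]] := H K.
by exists k => //; split=> //; apply/spellsP; rewrite wE.
Qed.

Lemma decidable_shown : cptb 3 (fun v => event (nth 0 v 0) (nth 0 v 1) (nth 0 v 2)) -> decidable4 shown.
Proof.
move=> ce.
have H : cptb 4 (fun v => shown (nth 0 v 0) (nth 0 v 1) (nth 0 v 2) (nth 0 v 3)).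
  have ch : cpt 4 (fun v => hdn (nth 0 v 1)) by apply: cpt_hdn; cpt_tac.
  have ct : cpt 4 (fun v => tln (nth 0 v 1)) by apply: cpt_tln; cpt_tac.
  apply: cptb_and.
    apply: (@cptb_all _ _ (fun i v => getn (nth 0 v 0) i \in deads)); first by apply: cpt_sizen; cpt_tac.
    by apply: cptb_mem; apply: cpt_getn; cpt_tac.
  apply: cptb_and; first by cpt_tac.
  apply: cptb_and; first by cpt_tac.
  apply: cptb_and; first by cpt_tac.
  apply: (@cptb_has _ _ (fun phi v => all (fun i => (getn (nth 0 v 0) i \in ones) ==
    (event (hdn (nth 0 v 1)) (tln (nth 0 v 1)) (nth 0 v 3) && ((hdn (nth 0 v 1)).*2.+2 %| phi + i)))
    (iota 0 (sizen (nth 0 v 0))))).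
    by apply: cpt_ext (_ : cpt 4 (fun v => (2 * hdn (nth 0 v 1)).+2)) => [v _|]; [rewrite mul2n|cpt_tac].
  apply: (@cptb_all _ _ (fun i w => (getn (nth 0 (behead w) 0) i \in ones) ==
    (event (hdn (nth 0 (behead w) 1)) (tln (nth 0 (behead w) 1)) (nth 0 (behead w) 3) &&
      ((hdn (nth 0 (behead w) 1)).*2.+2 %| nth 0 w 0 + i)))); first by apply: cpt_sizen; cpt_tac.
  have ch' : cpt 6 (fun v => hdn (nth 0 (behead (behead v)) 1)) by apply: cpt_hdn; cpt_tac.
  have ct' : cpt 6 (fun v => tln (nth 0 (behead (behead v)) 1)) by apply: cpt_tln; cpt_tac.
  apply: cptb_eqb; first by apply: cptb_mem; apply: cpt_getn; cpt_tac.
  apply: cptb_and; first by apply: (@cpt_comp 6 _ [:: _; _; _] ce); split=> //; split=> //; split=> //; cpt_tac.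
  apply: cptb_dvd; last by cpt_tac.
  by apply: cpt_ext (_ : cpt 6 (fun v => (2 * hdn (nth 0 (behead (behead v)) 1)).+2)) => [v _|]; [rewrite mul2n|cpt_tac].
have [c cP] := H; exists c => x a b d; exact: (cP [:: x; a; b; d]).
Qed.

Definition bit_letter (b : bool) : letter := (false, false, Dead st reg, b).
Definition number_word (y : nat) : seq letter :=
  bit_letter true :: rcons (nseq y.*2.+1 (bit_letter false)) (bit_letter true).

Lemma number_word_dead y : all (fun q => mode_of q == Dead st reg) (number_word y).
Proof. by rewrite /= all_rcons all_nseq /= eqxx orbT. Qed.

(** The first 1 forces the event and a phase divisible by the period, the last one forces 2x + 2 to
    divide 2y + 2, and x < y would produce a third 1 at position 2x + 2. *)
Lemma pattern_number x a k y :
  pattern x a k [seq data q | q <- number_word y] <-> event x a k /\ x = y.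
Proof.
set u := map _ _; have su : size u = y.*2.+3 by rewrite size_map /= size_rcons size_nseq.
have nu i : i < y.*2.+3 -> nth false u i = (i == 0) || (i == y.*2.+2).
  have -> : u = true :: rcons (nseq y.*2.+1 false) true by rewrite /u map_cons map_rcons map_nseq.
  case: i => [|i] iy //; rewrite -[LHS]/(nth false (rcons (nseq y.*2.+1 false) true) i).
  by rewrite nth_rcons size_nseq nth_nseq eqSS; case: ltngtP => // h; lia.
split=> [[phi H]|[ev xy]]; last first.
  subst x; exists 0 => i; rewrite su => iy; rewrite nu // ev add0n /=.
  have [->|i0] := posnP i; first by rewrite dvdn0.
  apply/eqP/idP => [->|di]; first exact: dvdnn.
  by have := dvdn_leq i0 di; case/dvdnP: di => -[|[|q]]; lia.
have h0 := H 0; have hd := H y.*2.+2; have hx := H x.*2.+2.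
move: h0 hd; rewrite su !nu // addn0 !eqxx orbT => /(_ isT)/esym/andP[ev d0] /(_ (ltnSn _))/esym/andP[_].
rewrite (dvdn_addr _ d0) => /dvdn_leq xy; split=> //.
have {}xy : x.*2.+2 <= y.*2.+2 by exact: xy.
move: hx; rewrite su nu ?ltnS // ev (dvdn_addr _ d0) dvdnn => /(_ _)/orP[]; lia.
Qed.

Lemma computable_number : computable1 (fun y => word_code (number_word y)).
Proof.
have H : cpt 1 (fun v => word_code (number_word (nth 0 v 0))).
  set c1 : nat := enc (bit_letter true); set c0 : nat := enc (bit_letter false).
  apply: cpt_ext (_ : cpt 1 (fun v => consn c1 (iter (2 * nth 0 v 0).+1 (consn c0) (consn c1 0)))).
    move=> v _; rewrite /word_code /number_word map_cons consn_code; congr consn.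
    rewrite map_rcons map_nseq mul2n; elim: _.+1 => [|i IH].
      exact/esym/(consn_code _ [::]).
    by rewrite iterS IH -consn_code.
  apply: cpt_consn; first exact: cpt_const.
  apply: (@cpt_iter _ _ _ (fun z v => consn c0 z)); [by cpt_tac|exact: cpt_const|].
  by apply: cpt_consn; cpt_tac.
have [c cP] := H; by exists c => x; exact: (cP [:: x]).
Qed.
End Codes.

Theorem theorem5 :
  exists (n r : nat) (delta : (r.*2.+1).-tuple 'I_n.+1 -> 'I_n.+1),
    forall (R : realType) (mu : probability (ConfM n) R),
      fully_supported_bernoulli mu ->
      Sigma3_complete (persistent_codes delta mu).
Proof.
have [M [s [tM _ univ]]] := universal_machine.
have [st [reg [ins [st0 [sp [rx [ra [rxa ev]]]]]]]] := ordinal_machine s tM.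
pose Q : finType := letter st reg.
have cQ : 0 < #|Q| by apply/card_gt0P; exists (blank st reg).
pose enc (q : Q) := cast_ord (esym (prednK cQ)) (enum_rank q).
pose dec i : Q := enum_val (cast_ord (prednK cQ) i).
have encK : cancel enc dec by move=> q; rewrite /enc /dec cast_ordKV enum_rankK.
have decK : cancel dec enc by move=> i; rewrite /enc /dec enum_valK cast_ordK.
exists #|Q|.-1, 1, (local_rule enc dec (step3 ins st0 sp rx ra)) => R mu bern.
have codes m : persistent_codes (local_rule enc dec (step3 ins st0 sp rx ra)) mu m <->
    exists w, [/\ word_code enc w = m, all (fun q => mode_of q == Dead st reg) w & exists x a, x < a /\
      forall K, exists2 k, K <= k & a < k /\ pattern ins st0 sp rx ra x a k [seq data q | q <- w]].
  split=> [[u [<- pu]]|[w [<- wD H]]].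
    have uE : u = [seq enc q | q <- map dec u] by rewrite mapK.
    exists (map dec u); rewrite uE in pu; have [wD H] := (persistentE ins st0 sp rxa encK decK bern _).1 pu.
    by split=> //; rewrite /word_code (map_comp val enc) -uE.
  exists (map enc w); split; last by apply/(persistentE ins st0 sp rxa encK decK bern).
  by rewrite /word_code (map_comp val enc).
split.
  exists (shown ins st0 sp rx ra enc); split.
    apply: (decidable_shown (ins := ins)).
    apply: (@cptb_ext _ (fun v => pcat M (nth 0 v 0) (nth 0 v 1) ((nth 0 v 2).-1 - nth 0 v 1) == s)).
      by move=> v _; rewrite ev.
    apply: (@cpt_comp 3 _ [:: _; _; fun v => (nth 0 v 2).-1 - nth 0 v 1] (cpt_pcat M s)).
    by split; [|split]; [| |split]; cpt_tac.
  move=> m; rewrite codes; split=> H; by apply/(shown_exists _ _ _ _ _ encK decK).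
move=> S /univ[f [[c cP] SH]].
have [c' c'P] := computable_number enc (st := st) (reg := reg).
exists (fun x => word_code enc (number_word st reg (f x))); split.
  exists (CComp c' [:: c]) => x; apply: (ev_comp (ys := [:: f x])); last exact: c'P.
  by apply: evs_cons => //; exact: evs_nil.
move=> x; rewrite SH codes; split=> [[a fa H]|[w [/(congr1 CodeSeq.decode) ww _ [y [a [ya H]]]]]].
  exists (number_word st reg (f x)); split=> //; first exact: number_word_dead.
  (* With length t + a + 1, the time k - 1 - a available to the machine is exactly [t]. *)
  exists (f x), a; split=> // K; have [t Kt pt] := H K; exists (t + a).+1; first by lia.
  split; first by lia.
  by apply/pattern_number; split=> //; rewrite ev /= addnK.
rewrite /word_code !CodeSeq.codeK in ww.
have {}ww : w = number_word st reg (f x) by apply: (inj_map _ ww) => ? ? /val_inj/(can_inj encK).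
have yf : y = f x.
  by have [k _ [_]] := H 0; rewrite ww => /pattern_number[_ ->].
rewrite -yf; exists a => // K; have [k Kk [ak]] := H (K + a).+1.
rewrite ww => /pattern_number[]; rewrite ev => pt _; exists (k.-1 - a) => //; lia.
Qed.
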